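(* (Mean metastable exit time.) Let $p\in(0,1)$. For $\beta>1$, $h>0$ small enough and for $s>0$, there exist absolute constants $k_1,k_2>0$ and constants $C_1=C_1(p,\beta,h)<C_2=C_2(p,\beta,h)$ independent of $N$, such that $$\lim_{N\uparrow\infty}\mathbb{P}_J\left(C_1\,\mathrm{e}^{-s}(1+o(1))\le\frac{\mathbb{E}_{\nu^N_{m_-,m_+}}\big[\tau_{\mathcal{S}_N[m_+(N)]}\big]}{\mathbb{E}^{\mathrm{CW}}_{m_-(N)}\big[\tau_{m_+(N)}\big]}\le C_2\,\mathrm{e}^{s}(1+o(1))\right)\ge1-k_1\mathrm{e}^{-k_2s^2}.$$ The constants can be written explicitly as $$C_1=\mathrm{e}^{-2\beta(1+h)-\alpha+\kappa},\qquad C_2=\mathrm{e}^{2\beta(1+h)+2\alpha}.$$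
   Context: **Randomly dilute Curie--Weiss (RDCW) model.** $[N]=\{1,\dots,N\}$, $\mathcal{S}_N=\{-1,+1\}^N$. $(J_{ij})_{1\le i<j\le N}$ are i.i.d. Bernoulli($p$) with $p\in(0,1)$ fixed, $J_{ji}=J_{ij}$; $\mathbb{P}_J$ is their joint law. The random Hamiltonian is $$H_N(\sigma)=-\frac1{Np}\sum_{1\le i<j\le N}J_{ij}\sigma_i\sigma_j-h\sum_{i\in[N]}\sigma_i,$$ with Gibbs measure $\mu_{\beta,N}(\sigma)=\mathrm{e}^{-\beta H_N(\sigma)}/Z_{\beta,N}$, $Z_{\beta,N}=\sum_{\sigma\in\mathcal{S}_N}\mathrm{e}^{-\beta H_N(\sigma)}$. Given $J$, the discrete-time Metropolis chain $(\sigma(t))_{t\ge0}$ on $\mathcal{S}_N$ has transition probabilities $p_N(\sigma,\sigma')=\frac1N\exp(-\beta[H_N(\sigma')-H_N(\sigma)]_+)$ if $\sigma,\sigma'$ differ in exactly one spin, $p_N(\sigma,\sigma)=1-\sum_{\eta\ne\sigma}p_N(\sigma,\eta)$, and $0$ otherwise, where $[x]_+=\max(x,0)$. $\mathbb{P}_\nu,\mathbb{E}_\nu$ denote the quenched (given $J$) law and expectation of the chain with initial distribution $\nu$, and $\mathbb{P}_\sigma=\mathbb{P}_{\delta_\sigma}$. Hitting times: $\tau_A=\inf\{t>0:\sigma(t)\in A\}$. **Magnetisation and last-exit biased distribution.** $m(\sigma)=\frac1N\sum_i\sigma_i\in\Gamma_N=\{-1,-1+\frac2N,\dots,1-\frac2N,1\}$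 and $\mathcal{S}_N[m]=\{\sigma\in\mathcal{S}_N:m(\sigma)=m\}$. For disjoint $A,B\subset\mathcal{S}_N$, $$\nu_{A,B}(\sigma)=\frac{\mu_{\beta,N}(\sigma)\mathbb{P}_\sigma(\tau_B<\tau_A)}{\sum_{\sigma'\in A}\mu_{\beta,N}(\sigma')\mathbb{P}_{\sigma'}(\tau_B<\tau_A)},\quad\sigma\in A,$$ and $\nu^N_{m_-,m_+}=\nu_{\mathcal{S}_N[m_-(N)],\mathcal{S}_N[m_+(N)]}$. **Curie--Weiss (CW) objects.** $E(m)=-\frac12m^2-hm$, $I(m)=\frac{1-m}2\log\frac{1-m}2+\frac{1+m}2\log\frac{1+m}2$, $f_\beta(m)=E(m)+\beta^{-1}I(m)$ on $[-1,1]$. For $\beta>1$ and $h>0$ small, $f_\beta$ is a double-well function whose critical points, the solutions of $m=\tanh(\beta(m+h))$, are $m_-<m^*<m_+$: $m_-$ is a local minimiser, $m^*$ a local maximiser (saddle point), $m_+$ the global minimiser. $m_-(N),m_+(N)$ are the points of $\Gamma_N$ closest to $m_-,m_+$ respectively. $\mathbb{E}^{\mathrm{CW}}_{m}$ is expectation for the discrete-time Markov chain $m(t)$ on $\Gamma_N$ started at $m$ with transition probabilities $$\tilde r_N(m,m\pm\tfrac2N)=\exp\big(-\beta N[E(m\pm\tfrac2N)-E(m)]_+\big)\tfrac{1\mp m}{2},$$ the remaining probability being that of staying at $m$; $\tau_{m'}=\inf\{t>0:m(t)=m'\}$. **Constants.** $$\alpha=\frac{\beta^2(1-p)}{4p},\qquad\kappa=\alpha+\max_{\eta\in(0,1)}\left\{\log\eta-\frac{\beta\sqrt{2\alpha+\log\left(\frac{c_1}{(1-\eta)^2}\right)}}{p\sqrt{2c_2}}\right\},$$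 where $c_1,c_2>0$ are the absolute constants of Talagrand's concentration inequality: for every $M\in\mathbb{N}$, every convex $1$-Lipschitz $G:\mathbb{R}^M\to\mathbb{R}$, and independent random variables $X_1,\dots,X_M$ with $|X_i|\le K$, one has $\mathbb{P}(|G(X)-\mathbb{E}G(X)|\ge tK)\le c_1\mathrm{e}^{-c_2t^2}$ for all $t\ge0$. One has $\kappa<\alpha$.
   Formalization: The constants k1, k2 may depend on p and β (but not on h, s or N): truly absolute ones cannot exist, since edge-count fluctuations force k2 → 0 as p → 0 or β → ∞; the limit of probabilities is read as a liminf. *)

(* Defs.v *)
From HB Require Import structures.
From mathcomp Require Import all_boot all_order all_algebra.
From mathcomp Require Import all_classical all_reals all_analysis.
Import Order.TTheory GRing.Theory Num.Theory.
Import numFieldTopology.Exports numFieldNormedType.Exports.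

Set Implicit Arguments.
Unset Strict Implicit.
Unset Printing Implicit Defensive.

Local Open Scope classical_set_scope.
Local Open Scope ring_scope.

Section MarkovChain.
Context {R : realType} {S : finType}.
Implicit Types (P r : S -> S -> R) (nu : S -> R) (A B : {set S}).

Definition with_holding r (x y : S) : R :=
  if x == y then 1 - \sum_(z | z != x) r x z else r x y.

Fixpoint path_weight P (x : S) (s : seq S) : R :=
  if s is y :: s' then P x y * path_weight P y s' else 1.

(* Law of the first [t] steps: [E x s] is an event on [X_0 = x] and
   [s = (X_1, ..., X_t)]. *)
Definition path_prob P nu (t : nat) (E : S -> seq S -> bool) : R :=
  \sum_(x : S) nu x * \sum_(s : t.-tuple S | E x s) path_weight P x s.

(* [inf {t > 0 : X_t \in A}] read on [s = (X_1, ..., X_t)]; its value is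
   [t + 1] when [A] is not visited at the times [1, ..., t]. *)
Definition hit A (s : seq S) : nat := (find (mem A) s).+1.

Definition prob_hit_at P nu A (t : nat) : R :=
  path_prob P nu t (fun _ s => hit A s == t).

Definition mean_hit P nu A : \bar R :=
  (\sum_(0 <= t <oo) (t%:R * prob_hit_at P nu A t)%:E
   + +oo * (1 - \sum_(0 <= t <oo) (prob_hit_at P nu A t)%:E))%E.

Definition point_mass (x : S) : S -> R := fun y => (y == x)%:R.

(* [P_x(tau_B < tau_A)], decomposed according to the value of [tau_B]. *)
Definition prob_hit_before P (x : S) B A : R :=
  limn (series (fun t => path_prob P (point_mass x) t
    (fun _ s => (hit B s == t) && (t < hit A s)%N))).

Definition last_exit_biased P (mu : S -> R) A B (x : S) : R :=
  if x \in A then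
    mu x * prob_hit_before P x B A
      / \sum_(y in A) mu y * prob_hit_before P y B A
  else 0.

End MarkovChain.

Section RDCW.
Context {R : realType}.
Variables (p beta h : R).

Definition pos_part (x : R) : R := Num.max x 0.

Definition config (N : nat) := {ffun 'I_N -> bool}.

Definition spin N (s : config N) (i : 'I_N) : R := if s i then 1 else -1.

Definition edge (N : nat) := {e : 'I_N * 'I_N | (e.1 < e.2)%N}.

Definition coupling (N : nat) := {ffun edge N -> bool}.

Definition PJ N (A : set (coupling N)) : R :=
  \sum_(J : coupling N | `[< A J >]) \prod_(e : edge N) bernoulli_pmf p (J e).

Section Quenched.
Variables (N : nat) (J : coupling N).

Definition hamiltonian (s : config N) : R :=
  - (N%:R * p)^-1 * (\sum_(e : edge N)
        (J e)%:R * spin s (val e).1 * spin s (val e).2)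
  - h * \sum_(i < N) spin s i.

Definition gibbs (s : config N) : R :=
  expR (- beta * hamiltonian s)
    / \sum_(s' : config N) expR (- beta * hamiltonian s').

Definition metropolis_rate (s s' : config N) : R :=
  if #|[set i | s i != s' i]%SET| == 1%N then
    N%:R^-1 * expR (- beta * pos_part (hamiltonian s' - hamiltonian s))
  else 0.

Definition metropolis : config N -> config N -> R :=
  with_holding metropolis_rate.

End Quenched.

(* [Gamma_N] is indexed by the number of positive spins. *)
Definition gammaN N (k : 'I_N.+1) : R := -1 + 2 * k%:R / N%:R.

Definition magnetisation N (s : config N) : R :=
  N%:R^-1 * \sum_(i < N) spin s i.

Definition level N (k : 'I_N.+1) : {set config N} :=
  [set s | magnetisation s == gammaN k]%SET.

Definition closest N (x : R) (k : 'I_N.+1) : Prop :=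
  forall l : 'I_N.+1, `|gammaN k - x| <= `|gammaN l - x|.

Definition energy (m : R) : R := - (m ^+ 2 / 2) - h * m.

Definition entropy (m : R) : R :=
  (1 - m) / 2 * ln ((1 - m) / 2) + (1 + m) / 2 * ln ((1 + m) / 2).

Definition free_energy (m : R) : R := energy m + beta^-1 * entropy m.

Definition tanh (x : R) : R := (expR x - expR (- x)) / (expR x + expR (- x)).

Record double_well (mm ms mp : R) : Prop := DoubleWell {
  double_well_ordered : mm < ms < mp ;
  double_well_range : -1 < mm /\ mp < 1 ;
  double_well_critical : forall m : R, -1 < m < 1 ->
    (derive1 free_energy m = 0 <-> m \in [:: mm; ms; mp]) ;
  double_well_tanh : forall m : R,
    m = tanh (beta * (m + h)) <-> m \in [:: mm; ms; mp] ;
  double_well_min : \forall m \near mm, free_energy mm <= free_energy m ;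
  double_well_max : \forall m \near ms, free_energy m <= free_energy ms ;
  double_well_global : forall m : R, -1 <= m <= 1 -> m != mp ->
    free_energy mp < free_energy m }.

Definition cw_rate N (k l : 'I_N.+1) : R :=
  expR (- beta * N%:R * pos_part (energy (gammaN l) - energy (gammaN k)))
  * (if val l == k.+1 then (1 - gammaN k) / 2
     else if val k == l.+1 then (1 + gammaN k) / 2
     else 0).

Definition cw_chain N : 'I_N.+1 -> 'I_N.+1 -> R := with_holding (@cw_rate N).

Definition mean_exit N (J : coupling N) (km kp : 'I_N.+1) : \bar R :=
  mean_hit (metropolis J)
    (last_exit_biased (metropolis J) (gibbs J) (level km) (level kp))
    (level kp).

Definition cw_mean_exit N (km kp : 'I_N.+1) : \bar R :=
  mean_hit (@cw_chain N) (point_mass km) [set kp]%SET.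

End RDCW.

Section Constants.
Context {R : realType}.

Definition euclid_norm M (x : 'rV[R]_M) : R :=
  Num.sqrt (\sum_(i < M) x 0 i ^+ 2).

Definition mutually_independent d (T : measurableType d)
    (P : probability T R) M (X : 'I_M -> {RV P >-> R}) : Prop :=
  forall (I : {set 'I_M}) (B : 'I_M -> set R), (forall i, measurable (B i)) ->
    P (\bigcap_(i in [set` I]) (X i @^-1` B i))
    = (\prod_(i in I) P (X i @^-1` B i))%E.

(* [0 < K] is needed: for [K = 0] the deviation event has probability 1. *)
Definition talagrand_constants (c1 c2 : R) : Prop :=
  forall (M : nat) (G : 'rV[R]_M -> R),
    convex_function setT G ->
    (forall x y, `|G x - G y| <= euclid_norm (x - y)) ->
  forall (d : measure_display) (T : measurableType d) (P : probability T R)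
    (X : 'I_M -> {RV P >-> R}) (K : R),
    0 < K -> (forall i w, `|X i w| <= K) -> mutually_independent X ->
  let Y := fun w => G (\row_(i < M) X i w) in
  forall t : R, 0 <= t ->
    (P [set w | (t * K)%:E <= `|(Y w)%:E - 'E_P[Y]|]
      <= (c1 * expR (- c2 * t ^+ 2))%:E)%E.

Variables (c1 c2 p beta h : R).

Definition alpha : R := beta ^+ 2 * (1 - p) / (4 * p).

(* The supremum is attained in [(0, 1)]: the function is continuous there and
   tends to [-oo] at both ends. *)
Definition kappa : R :=
  alpha + sup [set ln eta - beta * Num.sqrt (2 * alpha
                     + ln (c1 / (1 - eta) ^+ 2)) / (p * Num.sqrt (2 * c2))
              | eta in [set eta : R | 0 < eta < 1]].

Definition C1 : R := expR (- 2 * beta * (1 + h) - alpha + kappa).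

Definition C2 : R := expR (2 * beta * (1 + h) + 2 * alpha).

End Constants.

(* Main.v *)
Require Import Defs.
From mathcomp Require Import all_boot all_order all_algebra.
From mathcomp Require Import all_classical all_reals all_analysis.
From mathcomp Require Import ring lra zify.
Import Order.TTheory GRing.Theory Num.Theory.
Import numFieldTopology.Exports numFieldNormedType.Exports.

(** The mean exit time has an exact expression: if [h] is the equilibrium
    potential of the condenser [(A, B)] then
    [E_nu tau_B = (\sum_x mu x h x) / cap(A, B)], where [nu] is the last exit
    distribution on [A] ([mean_hit_last_exit]).  The same identity holds for the
    Curie-Weiss chain on the magnetisations, so the ratio of the two mean times
    is a ratio of numerators times a ratio of capacities.

    Write the Hamiltonian as [1/2 + N E(m) + Delta], where [Delta] is centred
    over the couplings.  Each factor is compared with its mean-field value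
    through averages [\sum_x pi x e^{+- beta Delta x}] over two deterministic
    probability measures [pi].  For the capacity, the Dirichlet principle tested
    with the mean-field voltage ([dilute_capacity_le]) and the Thomson principle
    tested with the mean-field flow ([dilute_capacity_ge]) both lead to
    [flow_measure].  For the numerator, the potential is close to the indicator
    of the levels below the saddle, so that [core_measure], the mean-field Gibbs
    measure of those levels, appears ([dilute_numerator]).  What remains is a
    numerical factor at most [10 / 3] ([ratio_bounds]); it is absorbed by
    [C2 >= 4] and [C1 <= 1 / 4].

    The disorder at a configuration is a sum of independent centred terms with
    a variance proxy bounded in [N].  Convexity of powers turns this into a
    Gaussian tail for the logarithm of each of the four averages, at rates that
    depend on [beta] and [p] only ([average_tail]).  So off an event of
    probability [k1 e^{- k2 s^2}] they are all at most [e^{s/2}], which bounds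
    the ratio on both sides, with error sequences equal to zero.

    That the potential is close to a step holds on the exponential scale.  With
    probability tending to one the disorder is at most [eps N] everywhere
    ([disorder_sup_small]), and a bound on the potential in terms of its
    Dirichlet energy makes the defect of order
    [e^{- beta N (f ms + f mp) / 2}], up to the factor due to the disorder
    ([step_defect_le]), where [mm < ms < mp] are the critical points of the free
    energy [f].  This is negligible against the mass [e^{- beta N f mm}] of the
    left well as soon as [2 f mm < f mp + f ms], which is true for small fields
    because it is true at zero field, where the wells have the same depth
    ([barrier_high]). *)

Set Implicit Arguments.
Unset Strict Implicit.
Unset Printing Implicit Defensive.

Local Open Scope classical_set_scope.
Local Open Scope ring_scope.

Lemma eq_ler (R : realType) (x y : R) : x = y -> x <= y.
Proof. by move=> ->. Qed.

(** * Boundary value problems for finite Markov chains *)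

Definition stochastic (R : realType) (S : finType) (P : S -> S -> R) : Prop :=
  (forall x y, 0 <= P x y) /\ (forall x, \sum_y P x y = 1).

Definition irreducible (R : realType) (S : finType) (P : S -> S -> R) : Prop :=
  forall x y, connect (fun x y => 0 < P x y) x y.

(** [h] is the equilibrium potential of the condenser [(A, B)]:
    [h x] is the probability of reaching [A] before [B] from [x]. *)
Definition is_potential (R : realType) (S : finType) (P : S -> S -> R)
    (A B : {set S}) (h : S -> R) : Prop :=
  [/\ forall x, x \in A -> h x = 1, forall x, x \in B -> h x = 0,
      forall x, x \notin A -> x \notin B -> h x = \sum_y P x y * h y &
      forall x, 0 <= h x <= 1].

Section BoundaryValueProblems.
Context {R : realType} {S : finType}.
Variable P : S -> S -> R.
Hypotheses (Psto : stochastic P) (Pirr : irreducible P).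
Implicit Types (D : {set S}) (f g : S -> R).

(** At a positive maximum the averaging inequality makes all successors maximal
    too, and irreducibility propagates this to [D]. *)
Lemma maximum_principle D z f : z \in D ->
  (forall x, x \in D -> f x <= 0) ->
  (forall x, x \notin D -> f x <= \sum_y P x y * f y) ->
  forall x, f x <= 0.
Proof.
move=> zD fD fP x.
have [Pge0 P1] := Psto.
case: (@arg_maxP _ _ _ z xpredT f) => // x0 _ max0.
have le0 y : f y <= f x0 by exact: max0.
apply: le_trans (le0 x) _; rewrite leNgt; apply/negP => f0.
have step u v : f u = f x0 -> 0 < P u v -> f v = f x0.
  move=> fu Puv.
  have uD : u \notin D.
    by apply/negP => /fD; rewrite fu leNgt f0.
  have S0 : \sum_y P u y * (f x0 - f y) <= 0.
    under eq_bigr do rewrite mulrBr.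
    by rewrite sumrB -mulr_suml P1 mul1r subr_le0 -fu fP.
  have S0' : \sum_y P u y * (f x0 - f y) = 0.
    apply/eqP; rewrite eq_le S0 /= sumr_ge0// => y _.
    by rewrite mulr_ge0// subr_ge0.
  have H y : true -> 0 <= P u y * (f x0 - f y).
    by move=> _; rewrite mulr_ge0// subr_ge0.
  have /eqP := @psumr_eq0P _ _ predT _ H S0' v isT.
  by rewrite mulf_eq0 gt_eqF//= subr_eq0 => /eqP.
have /connectP[p pth zE] := Pirr x0 z.
suff H : forall p u, f u = f x0 -> path (fun x y => 0 < P x y) u p ->
    f (last u p) = f x0.
  by have := fD _ zD; rewrite zE H// leNgt f0.
elim=> [//|v q IH] u fu /= /andP[Puv pq].
exact: IH (step _ _ fu Puv) pq.
Qed.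

Lemma dirichlet_uniqueness D z f g : z \in D ->
  (forall x, x \in D -> f x = g x) ->
  (forall x, x \notin D ->
    f x - g x = \sum_y P x y * (f y - g y)) ->
  f =1 g.
Proof.
move=> zD fgD fgP x; apply/eqP; rewrite eq_le -subr_le0 -[g x <= _]subr_le0.
apply/andP; split.
  apply: (maximum_principle (f := fun x => f x - g x) zD) => y yD.
    by rewrite fgD// subrr.
  by rewrite fgP.
apply: (maximum_principle (f := fun x => g x - f x) zD) => y yD.
  by rewrite fgD// subrr.
rewrite -opprB fgP// -sumrN; apply: ler_sum => u _.
by rewrite -mulrN opprB.
Qed.

(** Uniqueness gives existence: the boundary value problem is a square linear
    system. *)
Lemma dirichlet_existence D z (b : S -> R) : z \in D ->
  exists g, (forall x, x \in D -> g x = b x) /\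
    (forall x, x \notin D -> g x = b x + \sum_y P x y * g y).
Proof.
move=> zD.
pose e (i : 'I_#|S|) : S := enum_val i.
pose r (x : S) : 'I_#|S| := enum_rank x.
pose M : 'M[R]_#|S| := \matrix_(j, i) ((i == j)%:R -
  (if e i \in D then 0 else P (e i) (e j))).
have ME (v : 'rV[R]_#|S|) i : (v *m M) 0 i = v 0 i -
    (if e i \in D then 0 else \sum_y P (e i) y * v 0 (r y)).
  rewrite mxE (eq_bigr (fun j => v 0 j * (i == j)%:R -
    v 0 j * (if e i \in D then 0 else P (e i) (e j)))); last first.
    by move=> j _; rewrite mxE mulrBr.
  rewrite sumrB (bigD1 i)//= eqxx mulr1 big1 ?addr0; last first.
    by move=> j ji; rewrite eq_sym (negbTE ji) mulr0.
  congr (_ - _); case: ifP => _.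
    by rewrite big1// => j _; rewrite mulr0.
  rewrite (reindex r) /=; last first.
    by exists e => y _; rewrite /r /e ?enum_rankK ?enum_valK.
  by apply: eq_bigr => y _; rewrite /e /r enum_rankK mulrC.
have Mu : M \in unitmx.
  rewrite -row_free_unit; apply: inj_row_free => v vM.
  have ve : (fun x => v 0 (r x)) =1 (fun=> 0).
    apply: (dirichlet_uniqueness zD) => x xD.
      have := ME v (r x); rewrite vM mxE /e /r enum_rankK xD subr0.
      by move=> <-.
    have := ME v (r x); rewrite vM mxE /e /r enum_rankK (negbTE xD).
    move=> /eqP; rewrite eq_sym subr_eq0 => /eqP ->; rewrite subr0.
    by apply: eq_bigr => y _; rewrite subr0.
  apply/rowP => i; rewrite mxE.
  by have := ve (e i); rewrite /r /e enum_valK.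
pose v := (\row_i b (e i)) *m invmx M.
have vM : v *m M = \row_i b (e i) by rewrite mulmxKV.
exists (fun x => v 0 (r x)); split => x xD; have := ME v (r x);
  rewrite vM mxE /e /r enum_rankK ?xD ?(negbTE xD).
  by rewrite subr0 => ->.
by move=> ->; rewrite subrK.
Qed.

Lemma potential_exists (A B : {set S}) b : b \in B ->
  (forall x, x \in A -> x \notin B) -> exists h, is_potential P A B h.
Proof.
move=> bB dAB.
have bAB : b \in A :|: B by rewrite inE bB orbT.
have [h [hD hP]] := @dirichlet_existence (A :|: B) b
  (fun x => (x \in A)%:R) bAB.
have hA x : x \in A -> h x = 1 by move=> xA; rewrite hD ?inE ?xA.
have hB x : x \in B -> h x = 0.
  move=> xB; rewrite hD ?inE ?xB ?orbT//.
  by case: (boolP (x \in A)) => // /dAB; rewrite xB.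
have hh x : x \notin A :|: B -> h x = \sum_y P x y * h y.
  by move=> xN; rewrite hP//; move: xN; rewrite inE negb_or => /andP[/negbTE-> _]; rewrite add0r.
exists h; split => //.
  by move=> x xA xB; apply: hh; rewrite inE negb_or xA.
have [_ P1] := Psto.
move=> x; apply/andP; split.
  rewrite -oppr_le0; apply: (maximum_principle (f := fun x => - h x) bAB) => y.
    by rewrite inE => /orP[/hA->|/hB->]; rewrite ?oppr0// lerN10.
  by move=> /hh ->; rewrite -sumrN; under eq_bigr do rewrite -mulrN.
rewrite -subr_le0; apply: (maximum_principle (f := fun x => h x - 1) bAB) => y.
  by rewrite inE => /orP[/hA->|/hB->]; rewrite ?subrr// sub0r lerN10.
move=> /hh {1}->; under [leRHS]eq_bigr do rewrite mulrBr mulr1.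
by rewrite sumrB P1.
Qed.

(** An increasing iteration bounded by the fixed point [psi] converges to a
    fixed point, and the kernel killed on [D] has only one. *)
Lemma killed_iteration_cvg D z (b : nat -> S -> R) (c : S -> R)
    (phi : nat -> S -> R) (psi : S -> R) : z \in D ->
  (forall x, phi 0 x <= psi x) ->
  (forall t x, phi t x <= phi t.+1 x) ->
  (forall t x, phi t.+1 x = b t x + \sum_(y | y \notin D) P x y * phi t y) ->
  (forall t x, b t x <= c x) ->
  (forall x, b^~ x @ \oo --> c x) ->
  (forall x, psi x = c x + \sum_(y | y \notin D) P x y * psi y) ->
  forall x, phi^~ x @ \oo --> psi x.
Proof.
move=> zD phi0 phi_nd phiS bc bcv psiE.
have [Pge0 _] := Psto.
have bnd t x : phi t x <= psi x.
  elim: t x => [|t IH] x; first exact: phi0.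
  rewrite phiS psiE lerD// ler_sum// => y _.
  by rewrite ler_wpM2l.
have nd x : {homo phi^~ x : n m / (n <= m)%N >-> n <= m}.
  by apply/nondecreasing_seqP => t; exact: phi_nd.
have cv x : cvgn (phi^~ x).
  by apply: nondecreasing_is_cvgn (nd x) _; exists (psi x) => _ [t _ <-].
pose l x := limn (phi^~ x).
have phil x : phi^~ x @ \oo --> l x by exact: cv.
have lE x : l x = c x + \sum_(y | y \notin D) P x y * l y.
  have /cvg_lim <- // : (fun t => phi t.+1 x) @ \oo --> l x.
    by rewrite (cvg_shiftS (phi^~ x)).
  rewrite (_ : (fun t => phi t.+1 x) =
    fun t => b t x + \sum_(y | y \notin D) P x y * phi t y).
    apply/cvg_lim => //; apply: cvgD (bcv x) _.
    apply: cvg_big => [|y _]; first exact: add_continuous.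
    by apply: cvgM (phil y); exact: cvg_cst.
  by apply/funext => t; rewrite phiS.
have off : (fun x => if x \in D then 0 else l x) =1
           (fun x => if x \in D then 0 else psi x).
  apply: (dirichlet_uniqueness zD) => x xD; first by rewrite xD.
  rewrite (negbTE xD) lE psiE opprD addrACA subrr add0r -sumrB.
  rewrite [RHS](bigID (mem D)) /= [X in X + _]big1 ?add0r.
    by apply: eq_bigr => y yD; rewrite (negbTE yD) mulrBr.
  by move=> y yD; rewrite yD subrr mulr0.
move=> x; have -> : psi x = l x.
  rewrite lE psiE; congr (_ + _); apply: eq_bigr => y yD.
  by have := off y; rewrite (negbTE yD) => ->.
exact: phil.
Qed.

End BoundaryValueProblems.

(** * Laws of hitting times *)

Lemma nneseries_EFin (R : realType) (a : nat -> R) (l : R) :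
  series a @ \oo --> l -> (\sum_(0 <= t <oo) (a t)%:E)%E = l%:E.
Proof.
move=> al; apply/cvg_lim => //.
rewrite (_ : (fun n => _) = EFin \o series a).
  by apply: cvg_EFin al; near=> n.
by apply/funext => n /=; rewrite /series /= sumEFin.
Unshelve. all: by end_near. Qed.

Section HittingTimes.
Context {R : realType} {S : finType}.
Variable P : S -> S -> R.
Hypotheses (Psto : stochastic P) (Pirr : irreducible P).
Implicit Types (A B : {set S}).

(** With [A] empty this is the law of the hitting time of [B]. *)
Definition hit_weight A B (t : nat) (x : S) : R :=
  \sum_(s : t.-tuple S | (hit B s == t) && (t < hit A s)%N) path_weight P x s.

Lemma sum_tuple_cons t (Q : pred (seq S)) (F : seq S -> R) :
  \sum_(s : t.+1.-tuple S | Q s) F s =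
  \sum_(y : S) \sum_(s : t.-tuple S | Q (y :: s)) F (y :: s).
Proof.
rewrite pair_big_dep /=.
rewrite (reindex (fun q : S * t.-tuple S => [tuple of q.1 :: q.2])) //=.
exists (fun s : t.+1.-tuple S => (thead s, [tuple of behead s])) => [[y s] _|s _].
  by rewrite theadE; congr pair; apply/val_inj.
by rewrite /= -tuple_eta.
Qed.

Lemma sum_tuple0 (Q : pred (seq S)) (F : seq S -> R) :
  \sum_(s : 0.-tuple S | Q s) F s = if Q [::] then F [::] else 0.
Proof.
case: ifP => Q0.
  rewrite (big_pred1 [tuple]) // => s; rewrite tuple0 /= Q0.
  by apply/esym/eqP; rewrite tuple0.
by rewrite big1// => s; rewrite tuple0 /= Q0.
Qed.

Lemma hit_weight0 A B x : hit_weight A B 0 x = 0.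
Proof. by rewrite /hit_weight big1// => s; rewrite tuple0. Qed.

Lemma hit_cons A y s :
  hit A (y :: s) = if y \in A then 1%N else (hit A s).+1.
Proof. by rewrite /hit /=; case: ifP. Qed.

Lemma hit_weightS A B t x : (forall y, y \in A -> y \notin B) ->
  hit_weight A B t.+1 x =
    (t == 0%N)%:R * \sum_(y in B) P x y
    + \sum_(y | y \notin A :|: B) P x y * hit_weight A B t y.
Proof.
move=> dAB.
rewrite /hit_weight (@sum_tuple_cons t
  (fun s => (hit B s == t.+1) && (t.+1 < hit A s)%N)).
rewrite (bigID (mem B)) /=; congr (_ + _).
  rewrite mulr_sumr; apply: eq_bigr => y yB.
  case: t => [|t] /=.
    rewrite (sum_tuple0 (fun s => (hit B (y :: s) == 1%N) &&
      (1 < hit A (y :: s))%N) (fun s => P x y * path_weight P y s)).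
    rewrite mul1r !hit_cons yB /=.
    case: ifPn => [_|/negP[]]; first by rewrite mulr1.
    case: ifPn => // /dAB; by rewrite yB.
  rewrite mul0r big1// => s.
  by rewrite hit_cons yB.
rewrite [LHS](bigID (mem A)) /= [X in X + _]big1 ?add0r; last first.
  move=> y /andP[_ yA]; rewrite big1// => s.
  by rewrite [hit A _]hit_cons yA ltnS ltn0 andbF.
apply: eq_big => [y|y /andP[yB yA]]; first by rewrite inE negb_or andbC.
rewrite mulr_sumr; apply: eq_bigl => s.
by rewrite !hit_cons (negbTE yB) (negbTE yA) eqSS ltnS.
Qed.

Lemma hit_weight_ge0 A B t x : 0 <= hit_weight A B t x.
Proof.
apply: sumr_ge0 => s _; elim: (val s) x => [|y u IH] x //=.
by rewrite mulr_ge0//; case: Psto.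
Qed.

(** One expression for two cases: off [A] and [B] the limit is [1 - h x], the
    probability of reaching [B] before [A]; on [A] it is the charge
    [h x - P h x], the probability of leaving [A] and not returning before
    [B]. *)
Lemma hit_weight_sum_cvg A B z h : z \in B ->
  (forall x, x \in A -> x \notin B) -> is_potential P A B h ->
  forall x, series (fun t => hit_weight A B t x) @ \oo -->
    h x - \sum_y P x y * h y + (1 - h x).
Proof.
move=> zB dAB [hA hB hP h01] x.
have [Pge0 P1] := Psto.
pose psi x := \sum_y P x y * (1 - h y).
have psiE y : h y - \sum_u P y u * h u + (1 - h y) = psi y.
  rewrite /psi; under [RHS]eq_bigr do rewrite mulrBr mulr1.
  by rewrite sumrB P1; ring.
(* The iteration starts at [t = 1]: nothing is hit at time 0. *)
rewrite psiE -(cvg_shiftS (series _)) /=.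
pose phi t x := series (fun t => hit_weight A B t x) t.+1.
have zD : z \in A :|: B by rewrite inE zB orbT.
apply: (@killed_iteration_cvg _ _ P Psto Pirr (A :|: B) z
  (fun _ x => \sum_(y in B) P x y) (fun x => \sum_(y in B) P x y) phi psi zD) => //.
- move=> y; rewrite /phi /series /= big_nat1 hit_weight0.
  apply: sumr_ge0 => u _; rewrite mulr_ge0// subr_ge0.
  by case/andP: (h01 u).
- move=> t y; rewrite /phi /series /= [leRHS]big_nat_recr//= lerDl.
  exact: hit_weight_ge0.
- move=> t y; rewrite /phi /series /= big_nat_recl//= hit_weight0 add0r.
  under eq_bigr do rewrite hit_weightS//.
  rewrite big_split /=; congr (_ + _).
    rewrite -mulr_suml big_nat_recl//= big1_seq ?addr0 ?mul1r//.
  rewrite exchange_big /=; apply: eq_bigr => u _.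
  by rewrite mulr_sumr.
- by move=> y; exact: cvg_cst.
- move=> y; rewrite /psi (bigID (mem B)) /=; congr (_ + _).
    by apply: eq_bigr => u uB; rewrite hB// subr0 mulr1.
  rewrite [LHS](bigID (mem A)) /= [X in X + _]big1 ?add0r; last first.
    by move=> u /andP[_ uA]; rewrite hA// subrr mulr0.
  apply: eq_big => [u|u /andP[uB uA]]; first by rewrite inE negb_or andbC.
  by congr (_ * _); rewrite -[RHS]/(psi u) -psiE -hP// subrr add0r.
Qed.

Lemma path_prob_hit (nu : S -> R) A B t :
  path_prob P nu t (fun _ s => (hit B s == t) && (t < hit A s)%N) =
  \sum_x nu x * hit_weight A B t x.
Proof. by []. Qed.

(** The case of a starting point in [A], where the potential is 1. *)
Lemma prob_hit_beforeE A B z h x : z \in B ->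
  (forall y, y \in A -> y \notin B) -> is_potential P A B h -> x \in A ->
  prob_hit_before P x B A = h x - \sum_y P x y * h y.
Proof.
move=> zB dAB hpot xA; apply/cvg_lim => //.
have := hit_weight_sum_cvg zB dAB hpot (x := x).
have [hA _ _ _] := hpot; rewrite [X in _ + (1 - X)]hA// subrr addr0; apply: cvg_trans.
apply: near_eq_cvg; near=> n; congr (series _ n); apply/funext => t.
rewrite path_prob_hit (bigD1 x)//= /point_mass eqxx mul1r big1 ?addr0//.
by move=> y yx; rewrite (negbTE yx) mul0r.
Unshelve. all: by end_near. Qed.

Lemma prob_hit_atE (nu : S -> R) B t :
  prob_hit_at P nu B t = \sum_x nu x * hit_weight finset.set0 B t x.
Proof.
apply: eq_bigr => x _; congr (_ * _); apply: eq_bigl => s.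
rewrite {3}/hit; have -> : find (mem finset.set0) s = t.
  rewrite -[RHS](size_tuple s); apply: hasNfind; apply/hasPn => y _.
  by rewrite /= inE.
by rewrite ltnSn andbT.
Qed.

(** Almost sure finiteness of the hitting time: the potential of an empty [A]
    is zero. *)
Lemma hit_total_cvg B z x : z \in B ->
  series (fun t => hit_weight finset.set0 B t x) @ \oo --> (1 : R).
Proof.
move=> zB.
have := @hit_weight_sum_cvg finset.set0 B z (fun=> 0) zB.
move=> /(_ _ _ x); rewrite big1 ?subr0 ?add0r; last first.
  by move=> y _; rewrite mulr0.
apply=> //; first by move=> y; rewrite inE.
split=> //.
- by move=> y; rewrite inE.
- by move=> y _ _; rewrite big1// => u _; rewrite mulr0.
- by move=> _; rewrite lexx ler01.
Qed.

(** First step analysis: the truncated means [m_t] satisfy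
    [m_(t+1) = P(tau <= t + 1) + P 1_{B^c} m_t], and the probability tends
    to 1. *)
Lemma mean_series_cvg B z (g : S -> R) : z \in B ->
  (forall x, x \in B -> g x = 0) ->
  (forall x, x \notin B -> g x = 1 + \sum_y P x y * g y) ->
  forall x, x \notin B ->
  series (fun t => t%:R * hit_weight finset.set0 B t x) @ \oo --> g x.
Proof.
move=> zB gB gP.
have [Pge0 P1] := Psto.
have g0 x : 0 <= g x.
  rewrite -oppr_le0; apply: (maximum_principle Psto Pirr (f := fun x => - g x) zB) => y.
    by move=> /gB ->; rewrite oppr0.
  move=> /gP ->; under [leRHS]eq_bigr do rewrite mulrN.
  by rewrite sumrN lerN2 lerDr.
pose psi x := 1 + \sum_(y | y \notin B) P x y * g y.
have psiE x : x \notin B -> psi x = g x.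
  move=> /gP ->; congr (_ + _); rewrite [RHS](bigID (mem B)) /=.
  by rewrite [X in _ = X + _]big1 ?add0r// => y /gB ->; rewrite mulr0.
move=> x xB; rewrite -psiE//.
pose w t x := hit_weight finset.set0 B t x.
pose phi t x := series (fun t => t%:R * w t x) t.+1.
rewrite -(cvg_shiftS (series _)).
apply: (@killed_iteration_cvg _ _ P Psto Pirr B z
  (fun t x => series (w^~ x) t.+2) (fun=> 1) phi psi zB) => //.
- move=> y; rewrite /phi /series /= big_nat1 mul0r.
  by rewrite addr_ge0// sumr_ge0// => u _; rewrite mulr_ge0.
- move=> t y; rewrite /phi /series /= [leRHS]big_nat_recr//= lerDl.
  by rewrite mulr_ge0//; exact: hit_weight_ge0.
- move=> t y; rewrite /phi /series /= big_nat_recl//= mul0r add0r.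
  rewrite [in X in _ = X + _]big_nat_recl//= /w hit_weight0 add0r.
  under eq_bigr do rewrite -addn1 natrD mulrDl mul1r addn1 addrC.
  rewrite big_split /=; congr (_ + _).
  under eq_bigr => i _.
    rewrite hit_weightS; last by move=> u; rewrite inE.
    rewrite mulrDr mulrA (_ : i%:R * (i == 0%N)%:R = 0); last first.
      by case: i => [|i]; rewrite ?mul0r ?mulr0.
    rewrite mul0r add0r finset.set0U mulr_sumr.
    over.
  rewrite exchange_big /=; apply: eq_bigr => u _; rewrite mulr_sumr.
  by apply: eq_bigr => i _; rewrite mulrCA.
- move=> t y; have cv := hit_total_cvg y zB.
  rewrite -(cvg_lim _ cv)//; apply: nondecreasing_cvgn_le.
    apply/nondecreasing_seqP => n; rewrite /series /= big_nat_recr//= lerDl.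
    exact: hit_weight_ge0.
  by apply/cvg_ex; exists 1.
- move=> y; rewrite (cvg_shiftS (fun n => series (w^~ y) n.+1)).
  by rewrite (cvg_shiftS (series (w^~ y))); exact: hit_total_cvg zB.
- move=> y; congr (_ + _); apply: eq_bigr => u uB.
  by rewrite psiE.
Qed.

(** The hitting time is almost surely finite, so the infinite term in
    [mean_hit] has weight zero. *)
Lemma mean_hitE B z (g nu : S -> R) : z \in B ->
  (forall x, x \in B -> g x = 0) ->
  (forall x, x \notin B -> g x = 1 + \sum_y P x y * g y) ->
  (forall x, x \in B -> nu x = 0) -> \sum_x nu x = 1 ->
  mean_hit P nu B = (\sum_x nu x * g x)%:E.
Proof.
move=> zB gB gP nuB nu1; rewrite /mean_hit.
have series_sum (c : nat -> R) (n : nat) : series (fun t => c t * \sum_x nu x *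
    hit_weight finset.set0 B t x) n =
    \sum_x nu x * series (fun t => c t * hit_weight finset.set0 B t x) n.
  rewrite /series /=; under eq_bigr do rewrite mulr_sumr.
  rewrite exchange_big; apply: eq_bigr => x _; rewrite mulr_sumr.
  by apply: eq_bigr => t _; rewrite mulrCA.
rewrite (@nneseries_EFin _ (fun t => t%:R * prob_hit_at P nu B t)
  (\sum_x nu x * g x)); last first.
  rewrite (_ : series _ = fun n => \sum_x nu x *
      series (fun t => t%:R * hit_weight finset.set0 B t x) n).
    apply: cvg_big => [|x _]; first exact: add_continuous.
    have [xB|xB] := boolP (x \in B).
      rewrite nuB// mul0r; under eq_fun do rewrite mul0r.
      exact: cvg_cst.
    by apply: cvgM; [exact: cvg_cst|exact: mean_series_cvg zB gB gP x xB].
  apply/funext => n; rewrite -(series_sum (fun t => t%:R)).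
  by congr (series _ n); apply/funext => t; rewrite prob_hit_atE.
rewrite (@nneseries_EFin _ (prob_hit_at P nu B) 1); last first.
  rewrite (_ : series _ = fun n => \sum_x nu x *
      series (fun t => 1 * hit_weight finset.set0 B t x) n).
    rewrite [X in _ --> X](_ : 1 = \sum_x nu x * 1); last first.
      by rewrite -mulr_suml nu1 mulr1.
    apply: cvg_big => [|x _]; first exact: add_continuous.
    apply: cvgM; first exact: cvg_cst.
    rewrite (_ : (fun t => 1 * hit_weight finset.set0 B t x) =
      (hit_weight finset.set0 B)^~ x); last first.
      by apply/funext => t; rewrite mul1r.
    exact: hit_total_cvg zB.
  apply/funext => n; rewrite -(series_sum (fun=> 1)).
  by congr (series _ n); apply/funext => t; rewrite mul1r prob_hit_atE.
by rewrite subee// mule0 adde0.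
Qed.

End HittingTimes.

(** * Dirichlet form and mean hitting times *)

Section PotentialTheory.
Context {R : realType} {S : finType}.
Variables (P : S -> S -> R) (mu : S -> R).
Hypotheses (Psto : stochastic P) (Pirr : irreducible P).
Hypotheses (mu_gt0 : forall x, 0 < mu x).
Hypothesis Prev : forall x y, mu x * P x y = mu y * P y x.
Implicit Types (A B : {set S}) (f g h : S -> R).

Definition dirichlet f g : R :=
  2^-1 * \sum_x \sum_y mu x * P x y * (f x - f y) * (g x - g y).

(** Summation by parts: reversibility allows to exchange the two variables and
    to average the two resulting expressions. *)
Lemma dirichlet_green f g :
  \sum_x mu x * (f x - \sum_y P x y * f y) * g x = dirichlet f g.
Proof.
have [_ P1] := Psto.
have E x : mu x * (f x - \sum_y P x y * f y) * g x =
    \sum_y mu x * P x y * (f x - f y) * g x.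
  rewrite -mulr_suml; congr (_ * _).
  rewrite -[in LHS](mul1r (f x)) -(P1 x) mulr_suml -sumrB mulr_sumr.
  by apply: eq_bigr => y _; ring.
under eq_bigr do rewrite E.
set L := LHS.
have L' : L = \sum_x \sum_y mu x * P x y * (f y - f x) * g y.
  rewrite /L exchange_big /=; apply: eq_bigr => x _; apply: eq_bigr => y _.
  by rewrite Prev.
have -> : L = 2^-1 * (L + L) by field.
rewrite /dirichlet {2}L'/L -big_split /=; congr (_ * _).
apply: eq_bigr => x _; rewrite -big_split /=; apply: eq_bigr => y _; ring.
Qed.

Lemma dirichlet_ge0 f : 0 <= dirichlet f f.
Proof.
rewrite /dirichlet mulr_ge0// sumr_ge0// => x _; rewrite sumr_ge0// => y _.
rewrite -mulrA mulr_ge0//; last by rewrite -expr2 sqr_ge0.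
by rewrite mulr_ge0 ?(ltW (mu_gt0 _))//; case: Psto.
Qed.

Lemma dirichletDr f g g' : dirichlet f (fun x => g x + g' x) =
  dirichlet f g + dirichlet f g'.
Proof.
rewrite /dirichlet -mulrDr -big_split /=; congr (_ * _).
apply: eq_bigr => x _; rewrite -big_split /=; apply: eq_bigr => y _; ring.
Qed.

Lemma dirichletC f g : dirichlet f g = dirichlet g f.
Proof.
rewrite /dirichlet; congr (_ * _).
by apply: eq_bigr => x _; apply: eq_bigr => y _; ring.
Qed.

(** Off [A] the charge of [h] lives on [B], where [f] vanishes. *)
Lemma potential_pairing A B h f : is_potential P A B h ->
  (forall x, x \in B -> f x = 0) ->
  dirichlet h f = \sum_(x in A) mu x * (h x - \sum_y P x y * h y) * f x.
Proof.
move=> [hA hB hP _] fB; rewrite -dirichlet_green (bigID (mem A)) /=.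
rewrite [X in _ + X]big1 ?addr0// => x xA.
have [xB|xB] := boolP (x \in B); first by rewrite fB// mulr0.
by rewrite -hP// subrr mulr0 mul0r.
Qed.

(** [f - h] vanishes on [A] and [B], hence is orthogonal to [h] for the
    Dirichlet form. *)
Lemma dirichlet_principle A B h f : is_potential P A B h ->
  (forall x, x \in A -> f x = 1) -> (forall x, x \in B -> f x = 0) ->
  dirichlet h h <= dirichlet f f.
Proof.
move=> hpot fA fB; have [hA hB _ _] := hpot.
pose d x := f x - h x.
have hd : dirichlet h d = 0.
  rewrite (potential_pairing hpot) => [|x xB]; last by rewrite /d fB ?hB ?subrr.
  by rewrite big1// => x xA; rewrite /d fA ?hA// subrr mulr0.
have fE : f = fun x => h x + d x.
  by apply/funext => x; rewrite /d addrC subrK.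
have fD u : dirichlet u f = dirichlet u h + dirichlet u d.
  by rewrite {1}fE; exact: dirichletDr.
rewrite fD (dirichletC f h) (dirichletC f d) !fD hd (dirichletC d h) hd.
by rewrite addr0 add0r lerDl dirichlet_ge0.
Qed.

Lemma charge_ge0 A B h x : is_potential P A B h -> x \in A ->
  0 <= h x - \sum_y P x y * h y.
Proof.
move=> [hA _ _ h01] xA; have [Pge0 P1] := Psto.
rewrite hA// -(P1 x) -sumrB sumr_ge0// => y _.
rewrite -[X in X - _]mulr1 -mulrBr mulr_ge0// subr_ge0.
by case/andP: (h01 y).
Qed.

(** Let [g] be the mean time to reach [B].  The Dirichlet pairing of [g] and
    [h] can be computed from the equation of either: the first gives
    [\sum mu h], the second the integral of [g] against the charge of [h] on
    [A].  The last exit distribution is this charge, normalised by its total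
    mass, the capacity. *)
Lemma mean_hit_last_exit A B a b h : a \in A -> b \in B ->
  (forall x, x \in A -> x \notin B) -> is_potential P A B h ->
  0 < dirichlet h h /\
  mean_hit P (last_exit_biased P mu A B) B =
    ((\sum_x mu x * h x) / dirichlet h h)%:E.
Proof.
move=> aA bB dAB hpot; have [hA hB hP h01] := hpot.
have [g0 [gB gP]] := dirichlet_existence Psto Pirr (fun x => (x \notin B)%:R) bB.
have gB0 x : x \in B -> g0 x = 0 by move=> xB; rewrite gB// xB.
have gP1 x : x \notin B -> g0 x = 1 + \sum_y P x y * g0 y.
  by move=> xB; rewrite {1}gP// xB.
pose e x := mu x * (h x - \sum_y P x y * h y).
have capE : dirichlet h h = \sum_(x in A) e x.
  rewrite (potential_pairing hpot hB); apply: eq_bigr => x xA.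
  by rewrite [X in _ * X]hA// mulr1.
have pairE : \sum_(x in A) e x * g0 x = \sum_x mu x * h x.
  rewrite -(potential_pairing hpot gB0) dirichletC -dirichlet_green.
  apply: eq_bigr => x _; have [xB|xB] := boolP (x \in B).
    by rewrite hB// !mulr0.
  by rewrite {1}gP1// addrK mulr1.
have e0 x : x \in A -> 0 <= e x.
  by move=> xA; rewrite mulr_ge0 ?(ltW (mu_gt0 _))// (charge_ge0 hpot).
have num_gt0 : 0 < \sum_x mu x * h x.
  rewrite (bigD1 a)//= hA// mulr1 ltr_wpDr// sumr_ge0// => x _.
  by rewrite mulr_ge0 ?(ltW (mu_gt0 _))//; case/andP: (h01 x).
have cap_gt0 : 0 < dirichlet h h.
  rewrite lt0r dirichlet_ge0 andbT capE; apply/negP => /eqP s0.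
  move: num_gt0; rewrite -pairE big1 ?ltxx// => x xA.
  have -> : e x = 0 by apply: (psumr_eq0P e0 s0).
  by rewrite mul0r.
split=> //.
have phb x : x \in A -> mu x * prob_hit_before P x B A = e x.
  by move=> xA; rewrite (prob_hit_beforeE Psto Pirr bB dAB hpot).
have leE x : last_exit_biased P mu A B x =
    if x \in A then e x / dirichlet h h else 0.
  rewrite /last_exit_biased; case: ifP => // xA; rewrite phb// capE.
  by congr (_ / _); apply: eq_bigr => y /phb.
rewrite (mean_hitE Psto Pirr bB gB0 gP1).
- congr (_%:E); rewrite -pairE mulr_suml [RHS]big_mkcond /=.
  apply: eq_bigr => x _; rewrite leE; case: ifP => _; last by rewrite mul0r.
  by rewrite mulrAC.
- move=> x xB; rewrite leE; case: ifPn => // /dAB; by rewrite xB.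
- under eq_bigr do rewrite leE; rewrite -big_mkcond /= -mulr_suml -capE.
  by rewrite divff// gt_eqF.
Qed.

(** On a singleton the last exit distribution is the point mass. *)
Lemma mean_hit_point_mass B a b h : b \in B -> a \notin B ->
  is_potential P [set a]%SET B h ->
  0 < dirichlet h h /\
  mean_hit P (point_mass a) B = ((\sum_x mu x * h x) / dirichlet h h)%:E.
Proof.
move=> bB aB hpot.
have dAB x : x \in [set a]%SET -> x \notin B by rewrite inE => /eqP ->.
have aA : a \in [set a]%SET by rewrite inE.
have [cap_gt0 <-] := mean_hit_last_exit aA bB dAB hpot.
split=> //; congr (mean_hit P _ B); apply/funext => x.
rewrite /point_mass /last_exit_biased inE big_set1.
have [->|//] := eqVneq x a; rewrite divff//.
rewrite (prob_hit_beforeE Psto Pirr bB dAB hpot)//.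
have [hA hB _ _] := hpot; move: cap_gt0.
rewrite (potential_pairing hpot hB) big_set1 [X in _ * X]hA// mulr1.
by move=> /gt_eqF ->.
Qed.

End PotentialTheory.

Lemma last_exit_biased_scale (R : realType) (S : finType) (P : S -> S -> R)
    (mu : S -> R) (k : R) (A B : {set S}) : k != 0 ->
  last_exit_biased P (fun x => mu x * k) A B = last_exit_biased P mu A B.
Proof.
move=> k0; apply/funext => x; rewrite /last_exit_biased; case: ifP => // _.
under eq_bigr do rewrite mulrAC.
by rewrite -mulr_suml (mulrAC (mu x)) -mulf_div divff// mulr1.
Qed.

(** * Levels and edges of the hypercube *)

Section Hypercube.
Variable N : nat.
Implicit Types (x y : config N) (i : 'I_N).

Definition flip x i : config N := [ffun j => if j == i then ~~ x j else x j].

Definition nplus x : nat := #|[set i | x i]%SET|.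

Definition neighbour x y : bool := #|[set i | x i != y i]%SET| == 1%N.

Lemma flipK i : involutive (flip^~ i).
Proof. by move=> x; apply/ffunP => j; rewrite !ffunE; case: eqP => // _; rewrite negbK. Qed.

Lemma flip_at x i : flip x i i = ~~ x i.
Proof. by rewrite ffunE eqxx. Qed.

Lemma flip_inj x : injective (flip x).
Proof.
move=> i j /ffunP/(_ i); rewrite !ffunE eqxx.
by case: eqP => // _; case: (x i).
Qed.

Lemma flip_diff x i : [set j | x j != flip x i j]%SET = [set i]%SET.
Proof.
apply/setP => j; rewrite !inE ffunE; case: (eqVneq j i) => _; last by rewrite eqxx.
by case: (x j).
Qed.

Lemma neighbour_flip x i : neighbour x (flip x i).
Proof. by rewrite /neighbour flip_diff cards1. Qed.

Lemma neighbourP x y : reflect (exists i, y = flip x i) (neighbour x y).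
Proof.
apply: (iffP idP) => [/cards1P[i dE]|[i ->]]; last exact: neighbour_flip.
exists i; apply/ffunP => j; rewrite ffunE.
have /setP/(_ j) := dE; rewrite !inE.
by case: (eqVneq j i) => _; case: (x j); case: (y j).
Qed.

Lemma neighbourC x y : neighbour x y = neighbour y x.
Proof. by rewrite /neighbour; under eq_finset do rewrite eq_sym. Qed.

Lemma neighbour_neq x y : neighbour x y -> x != y.
Proof.
move=> /neighbourP[i ->]; apply/eqP => /ffunP/(_ i); rewrite flip_at.
by case: (x i).
Qed.

Lemma nplus_flip_up x i : ~~ x i -> nplus (flip x i) = (nplus x).+1.
Proof.
move=> xi; rewrite /nplus (_ : [set _ | _]%SET = i |: [set j | x j]%SET)%SET.
  by rewrite cardsU1 inE xi.
by apply/setP => j; rewrite !inE ffunE; case: eqP => // ->.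
Qed.

Lemma nplus_flip_down x i : x i -> nplus x = (nplus (flip x i)).+1.
Proof. by move=> xi; rewrite -(@nplus_flip_up _ i) ?flip_at ?xi// flipK. Qed.

Lemma nplus_le x : (nplus x <= N)%N.
Proof. by rewrite -[leqRHS]card_ord max_card. Qed.

Lemma neighbour_ind (Q : config N -> Prop) y : Q y ->
  (forall x i, Q (flip x i) -> Q x) -> forall x, Q x.
Proof.
move=> Qy Qf x.
have [n] := ubnP #|[set i | x i != y i]%SET|.
elim: n x => // n IH x; rewrite ltnS => le.
have [|[i]] := set_0Vmem [set i | x i != y i]%SET.
  move=> E; suff -> : x = y by [].
  apply/ffunP => j; have /setP/(_ j) := E; rewrite !inE.
  by move/negbFE/eqP.
move=> iD; apply: (Qf _ i); apply: IH; apply: leq_trans le.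
rewrite (cardsD1 i [set i | x i != y i]%SET) iD ltnS.
apply/subset_leq_card/fintype.subsetP => j; rewrite !inE ffunE.
move: iD; rewrite inE; case: (eqVneq j i) => [->|//].
by case: (x i); case: (y i).
Qed.

Section Sums.
Context {R : realType}.
Implicit Types (f g : config N -> R) (F : config N -> config N -> R).

Lemma sum_neighbour x f :
  \sum_(y | neighbour x y) f y = \sum_i f (flip x i).
Proof.
rewrite (eq_bigl (mem (flip x @: [set: 'I_N]%SET))); last first.
  move=> y; apply/neighbourP/imsetP => [[i ->]|[i _ ->]]; last by exists i.
  by exists i; rewrite ?inE.
rewrite big_imset /=; last by move=> i j _ _; exact: flip_inj.
by apply: eq_bigl => i; rewrite inE.
Qed.

(** Each edge is counted once, from its lower endpoint. *)
Lemma sum_edges_up F : (forall x y, F x y = F y x) ->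
  2^-1 * \sum_x \sum_i F x (flip x i) =
  \sum_(x : config N) \sum_(i | ~~ x i) F x (flip x i).
Proof.
move=> Fs; set U := RHS.
suff -> : \sum_x \sum_i F x (flip x i) = U + U by field.
have downE : \sum_(x : config N) \sum_(i | x i) F x (flip x i) = U.
  rewrite (exchange_big_dep xpredT)//= /U [RHS](exchange_big_dep xpredT)//=.
  apply: eq_bigr => i _; rewrite (reindex_inj (inv_inj (flipK i))) /=.
  by apply: eq_big => x; rewrite ?flip_at// flipK Fs.
rewrite -{1}downE /U -big_split /=; apply: eq_bigr => x _.
by rewrite [LHS](bigID (fun i => x i)).
Qed.

Definition edge_sum F (k : nat) : R :=
  \sum_(x | nplus x == k) \sum_(i | ~~ x i) F x (flip x i).

Definition level_sum f (k : nat) : R := \sum_(x | nplus x == k) f x.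

Definition level_mean f (k : nat) : R := level_sum f k / 'C(N, k)%:R.

Lemma sum_levels f : \sum_x f x = \sum_(k < N.+1) level_sum f k.
Proof.
rewrite (partition_big (fun x => inord (nplus x) : 'I_N.+1) xpredT)//=.
apply: eq_bigr => k _; apply: eq_bigl => x.
by rewrite -val_eqE /= inordK// ltnS nplus_le.
Qed.

Lemma sum_edges_levels F :
  \sum_(x : config N) \sum_(i | ~~ x i) F x (flip x i) = \sum_(k < N) edge_sum F k.
Proof.
rewrite sum_levels big_ord_recr /= [X in _ + X]big1 ?addr0// => x /eqP xN.
rewrite big_pred0// => i; apply/negbF.
have : [set j | x j]%SET == [set: 'I_N]%SET.
  by rewrite eqEcard finset.subsetT cardsT card_ord -[X in (X <= _)%N]xN /=.
by move=> /eqP/setP/(_ i); rewrite !inE => ->.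
Qed.

Lemma edge_sum_lower f k :
  edge_sum (fun x _ => f x) k = (N - k)%:R * level_sum f k.
Proof.
rewrite /edge_sum /level_sum mulr_sumr; apply: eq_bigr => x /eqP xk.
rewrite sumr_const -[LHS]mulr_natl; congr (_%:R * _).
have cE : N = (nplus x + #|~: [set i | x i]%SET|)%N.
  by rewrite /nplus cardsC card_ord.
rewrite -xk [X in (X - _)%N]cE addKn.
by rewrite -cardsE; apply: eq_card => i; rewrite !inE.
Qed.

Lemma edge_sum_upper f k :
  edge_sum (fun _ y => f y) k = k.+1%:R * level_sum f k.+1.
Proof.
rewrite /edge_sum (exchange_big_dep xpredT)//=.
transitivity (\sum_i \sum_(x : config N | (nplus x == k.+1) && x i) f x).
  apply: eq_bigr => i _; rewrite [RHS](reindex_inj (inv_inj (flipK i))) /=.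
  apply: eq_bigl => x; rewrite flip_at.
  by have [xi|xi] := boolP (x i); rewrite ?andbF// nplus_flip_up.
rewrite (exchange_big_dep (fun x => nplus x == k.+1)) /=; last first.
  by move=> i x _ /andP[].
rewrite /level_sum mulr_sumr; apply: eq_bigr => x /eqP xk.
rewrite (eq_bigl (fun i => x i)); last by move=> i; rewrite xk eqxx.
rewrite sumr_const -[LHS]mulr_natl; congr (_%:R * _).
by rewrite -xk /nplus cardsE.
Qed.

Lemma level_sum1 k : level_sum (fun=> 1) k = 'C(N, k)%:R.
Proof.
rewrite /level_sum sumr_const; congr (_%:R).
rewrite -[X in 'C(X, _)](card_ord N) -card_draws -(card_imset _ (f := fun x : config N => [set i | x i]%SET)).
  rewrite -cardsE; apply: eq_card => A; rewrite !inE.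
  apply/imsetP/idP => [[x]|/eqP Ak].
    by rewrite unfold_in => /eqP xk ->; rewrite -xk.
  exists [ffun i => i \in A]; last by apply/setP => i; rewrite !inE ffunE.
  rewrite unfold_in; apply/eqP; rewrite -Ak /nplus; congr #|pred_of_set _|.
  by apply/setP => i; rewrite !inE ffunE.
by move=> x y /setP E; apply/ffunP => i; have := E i; rewrite !inE.
Qed.

End Sums.
End Hypercube.

(** * The Metropolis and Curie-Weiss chains *)

Lemma with_holding_stochastic (R : realType) (S : finType) (r : S -> S -> R) :
  (forall x y, 0 <= r x y) -> (forall x, \sum_(z | z != x) r x z <= 1) ->
  stochastic (with_holding r).
Proof.
move=> r0 r1; split=> [x y|x]; rewrite /with_holding.
  by case: ifP => // _; rewrite subr_ge0.
rewrite (bigD1 x)//= eqxx [X in _ + X](eq_bigr (r x)) ?subrK// => y yx.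
by rewrite eq_sym (negbTE yx).
Qed.

Lemma with_holding_off (R : realType) (S : finType) (r : S -> S -> R) x y :
  x != y -> with_holding r x y = r x y.
Proof. by rewrite /with_holding => /negbTE ->. Qed.

Lemma pos_partE (R : realType) (x y : R) : pos_part (y - x) = Num.max x y - x.
Proof.
rewrite /pos_part; case: (leP x y) => xy; first by rewrite max_l// subr_ge0.
by rewrite subrr max_r// subr_le0 ltW.
Qed.

(** [gammaN] at a natural number, so that levels can be shifted without
    casts. *)
Definition grid (R : realType) (N k : nat) : R := -1 + 2 * k%:R / N%:R.

Section Metropolis.
Context {R : realType}.
Variables (p beta h : R) (N : nat) (J : coupling N).
Hypothesis N0 : (0 < N)%N.
Implicit Types (x y : config N).
Local Notation H := (hamiltonian p h J).
Local Notation P := (metropolis p beta h J).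

(** The energy is shifted by 1/2, the diagonal terms of the mean-field energy,
    so as to fluctuate around [N E(m)]. *)
Definition weight x : R := expR (- beta * (H x - 2^-1)).

Definition conductance x y : R :=
  N%:R^-1 * expR (- beta * (Num.max (H x) (H y) - 2^-1)).

Lemma conductanceC x y : conductance x y = conductance y x.
Proof. by rewrite /conductance maxC. Qed.

Lemma weight_rate x y : neighbour x y ->
  weight x * metropolis_rate p beta h J x y = conductance x y.
Proof.
move=> xy; rewrite /metropolis_rate -/(neighbour x y) xy /weight /conductance.
rewrite mulrCA -expRD pos_partE; congr (_ * expR _); ring.
Qed.

Lemma metropolis_rateN x y : ~~ neighbour x y -> metropolis_rate p beta h J x y = 0.
Proof. by rewrite /metropolis_rate -/(neighbour x y) => /negbTE ->. Qed.

Lemma metropolis_rate_ge0 x y : 0 <= metropolis_rate p beta h J x y.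
Proof. by rewrite /metropolis_rate; case: ifP => // _; rewrite mulr_ge0 ?expR_ge0 ?invr_ge0. Qed.

Lemma metropolis_stochastic : 0 <= beta -> stochastic P.
Proof.
move=> b0; apply: with_holding_stochastic => [|x]; first exact: metropolis_rate_ge0.
apply: (@le_trans _ _ (\sum_(i < N) N%:R^-1)).
  rewrite (bigID (neighbour x)) /= [X in _ + X]big1 ?addr0; last first.
    by move=> y /andP[_ xy]; rewrite metropolis_rateN.
  rewrite (eq_bigl (neighbour x)); last first.
    move=> y; rewrite andbC; case: (boolP (neighbour x y)) => //= xy.
    by rewrite eq_sym neighbour_neq.
  rewrite sum_neighbour ler_sum// => i _.
  rewrite /metropolis_rate -/(neighbour _ _) neighbour_flip ler_piMr//.
  rewrite -expR0 ler_expR mulNr oppr_le0 mulr_ge0//.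
  by rewrite /pos_part le_max lexx orbT.
by rewrite sumr_const card_ord -[_ *+ N]mulr_natl divff// pnatr_eq0 -lt0n.
Qed.

Lemma metropolis_irreducible : irreducible P.
Proof.
move=> x y; move: x; apply: (@neighbour_ind N _ y) => [|x i IH].
  exact: connect0.
apply: connect_trans IH; apply: connect1.
rewrite /metropolis with_holding_off ?neighbour_neq ?neighbour_flip//.
rewrite /metropolis_rate -/(neighbour _ _) neighbour_flip.
by rewrite mulr_gt0 ?expR_gt0// invr_gt0 ltr0n.
Qed.

Lemma weight_gt0 x : 0 < weight x.
Proof. exact: expR_gt0. Qed.

Lemma weight_metropolis x y : x != y -> weight x * P x y =
  if neighbour x y then conductance x y else 0.
Proof.
move=> xy; rewrite /metropolis with_holding_off//; case: ifPn => [/weight_rate//|].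
by move=> /metropolis_rateN ->; rewrite mulr0.
Qed.

Lemma metropolis_reversible x y : weight x * P x y = weight y * P y x.
Proof.
have [->//|xy] := eqVneq x y.
by rewrite !weight_metropolis// 1?eq_sym// neighbourC conductanceC.
Qed.

Lemma metropolis_dirichlet (f : config N -> R) : dirichlet P weight f f =
  \sum_(k < N) edge_sum (fun x y => conductance x y * (f x - f y) ^+ 2) k.
Proof.
pose F x y := conductance x y * (f x - f y) ^+ 2.
rewrite -(sum_edges_levels F) -(@sum_edges_up _ _ F); last first.
  by move=> x y; rewrite /F conductanceC -opprB sqrrN.
rewrite /dirichlet /F; congr (_ * _); apply: eq_bigr => x _.
rewrite -(sum_neighbour x (F x)) [RHS]big_mkcond /=; apply: eq_bigr => y _.
have [->|xy] := eqVneq x y.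
  by rewrite /F subrr mulr0 expr0n /= mulr0; case: ifP.
by rewrite /F weight_metropolis//; case: ifP => _; rewrite ?mul0r// -mulrA.
Qed.

Lemma gibbs_weight x : gibbs p beta h J x =
  weight x * (expR (- beta * 2^-1) / \sum_y expR (- beta * H y)).
Proof. by rewrite /gibbs /weight mulrA -expRD -mulrDr subrK. Qed.

Lemma magnetisationE x : magnetisation x = grid R N (nplus x).
Proof.
have N0' : N%:R != 0 :> R by rewrite pnatr_eq0 -lt0n.
rewrite /magnetisation /grid.
have -> : \sum_(i < N) spin x i = (2 * (nplus x)%:R - N%:R :> R).
  rewrite (eq_bigr (fun i => 2 * (x i)%:R - 1)); last first.
    by move=> i _; rewrite /spin; case: (x i); rewrite /=; ring.
  rewrite sumrB -mulr_sumr sumr_const card_ord -natr_sum; congr (_ * _%:R - _).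
  by rewrite /nplus -sum1_card [RHS]big_mkcond; apply: eq_bigr => i _; rewrite inE; case: (x i).
by field.
Qed.

Lemma grid_inj k l : grid R N k = grid R N l -> k = l.
Proof.
move=> /addrI /(divIf _) E; apply/eqP; rewrite -(eqr_nat R).
have N0' : N%:R != 0 :> R by rewrite pnatr_eq0 -lt0n.
by apply/eqP; apply: (mulfI (_ : 2 != 0 :> R)); [rewrite pnatr_eq0|apply: E].
Qed.

Lemma levelE (k : 'I_N.+1) : @level R N k = [set x | nplus x == k]%SET.
Proof.
apply/setP => x; rewrite !inE magnetisationE -/(grid R N k).
by apply/eqP/eqP => [/grid_inj|->].
Qed.

End Metropolis.

Section PathGraph.
Context {R : realType}.
Variable N : nat.

Lemma sum_path_graph (G : 'I_N.+1 -> 'I_N.+1 -> R) :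
  (forall k l, G k l = G l k) ->
  (forall k l : 'I_N.+1, val l != k.+1 -> val k != l.+1 -> G k l = 0) ->
  2^-1 * \sum_k \sum_l G k l = \sum_(j < N) G (inord j) (inord j.+1).
Proof.
move=> Gs G0; set U := RHS.
suff -> : \sum_k \sum_l G k l = U + U by field.
have UE : \sum_(k : 'I_N.+1) \sum_(l : 'I_N.+1 | val l == k.+1) G k l = U.
  rewrite big_ord_recr /= [X in _ + X]big1 ?addr0; last first.
    by move=> l /eqP lN; have := ltn_ord l; rewrite lN ltnn.
  apply: eq_bigr => j _; rewrite (big_pred1 (inord j.+1)); last first.
    by move=> l; rewrite /= -[RHS](inj_eq val_inj) /= inordK// ltnS.
  by congr (G _ _); apply/val_inj; rewrite /= inordK// ltnW// ltnS.
have DE : \sum_(k : 'I_N.+1) \sum_(l : 'I_N.+1 | val k == l.+1) G k l = U.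
  rewrite (exchange_big_dep xpredT)//= -[RHS]UE.
  by apply: eq_bigr => k _; apply: eq_bigr => l _; rewrite Gs.
rewrite -{1}UE -DE -big_split /=; apply: eq_bigr => k _.
rewrite (bigID (fun l : 'I_N.+1 => val l == k.+1)) /=; congr (_ + _).
rewrite [LHS](bigID (fun l : 'I_N.+1 => val k == l.+1)) /=.
rewrite [X in _ + X]big1 ?addr0; last by move=> l /andP[]; exact: G0.
apply: eq_bigl => l; case: (eqVneq (val k) l.+1) => [->|_]; last by rewrite andbF.
by rewrite andbT; apply/eqP => /=; lia.
Qed.
End PathGraph.

Section CurieWeiss.
Context {R : realType}.
Variables (beta h : R) (N : nat).
Hypothesis N0 : (0 < N)%N.
Implicit Types (k l : 'I_N.+1).
Local Notation P := (@cw_chain R beta h N).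

Definition level_energy (k : nat) : R := N%:R * energy h (grid R N k).

Definition cw_weight (k : nat) : R :=
  'C(N, k)%:R * expR (- beta * level_energy k).

(** The number of edges between the levels [k] and [k + 1]. *)
Definition edge_count (k : nat) : R := (N - k)%:R * 'C(N, k)%:R.

Definition cw_conductance (k : nat) : R := edge_count k / N%:R *
  expR (- beta * Num.max (level_energy k) (level_energy k.+1)).

Lemma edge_countE (k : nat) : edge_count k = k.+1%:R * 'C(N, k.+1)%:R.
Proof. by rewrite /edge_count -!natrM mul_bin_left. Qed.

Let N0' : N%:R != 0 :> R.
Proof. by rewrite pnatr_eq0 -lt0n. Qed.

Lemma cw_rate_up k l : val l = k.+1 ->
  cw_weight k * cw_rate beta h k l = cw_conductance k.
Proof.
move=> lk; rewrite /cw_rate lk eqxx /cw_weight /cw_conductance /edge_count.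
rewrite /gammaN -/(grid R N l) -/(grid R N k) lk pos_partE.
have -> : expR (- beta * Num.max (level_energy k) (level_energy k.+1)) =
    expR (- beta * level_energy k) * expR (- beta * N%:R *
      (Num.max (energy h (grid R N k)) (energy h (grid R N k.+1))
        - energy h (grid R N k))).
  rewrite -expRD; congr expR; rewrite /level_energy -maxr_pMr//; ring.
have -> : (1 - grid R N k) / 2 = (N - k)%:R / N%:R.
  rewrite natrB ?(ltnW (ltn_ord k))//; last by rewrite -ltnS.
  by rewrite /grid; field.
by ring.
Qed.

Lemma cw_rate_down k l : val k = l.+1 ->
  cw_weight k * cw_rate beta h k l = cw_conductance l.
Proof.
move=> kl; rewrite /cw_rate; case: eqP => [lk|_]; first by move: lk kl => /=; lia.
rewrite kl eqxx /cw_weight /cw_conductance edge_countE.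
rewrite /gammaN -/(grid R N l) -/(grid R N k) kl pos_partE (maxC (energy h (grid R N l.+1))).
have -> : expR (- beta * Num.max (level_energy l) (level_energy l.+1)) =
    expR (- beta * level_energy l.+1) * expR (- beta * N%:R *
      (Num.max (energy h (grid R N l)) (energy h (grid R N l.+1))
        - energy h (grid R N l.+1))).
  rewrite -expRD; congr expR; rewrite /level_energy -maxr_pMr//; ring.
have -> : (1 + grid R N l.+1) / 2 = l.+1%:R / N%:R.
  by rewrite /grid; field.
by ring.
Qed.

Lemma cw_rate0 k l : val l != k.+1 -> val k != l.+1 -> cw_rate beta h k l = 0.
Proof. by rewrite /cw_rate => /negbTE -> /negbTE ->; rewrite mulr0. Qed.

Lemma cw_chain_stochastic : 0 <= beta -> stochastic P.
Proof.
move=> b0.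
have up k : (1 - @gammaN R N k) / 2 = (N - k)%:R / N%:R.
  by rewrite natrB -1?ltnS// /gammaN; field.
have down k : (1 + @gammaN R N k) / 2 = k%:R / N%:R by rewrite /gammaN; field.
apply: with_holding_stochastic => [k l|k]; rewrite /cw_rate.
  rewrite mulr_ge0 ?expR_ge0//; case: ifP => _; first by rewrite up.
  by case: ifP => _ //; rewrite down.
apply: (@le_trans _ _ (\sum_(l : 'I_N.+1)
  ((if val l == k.+1 then (N - k)%:R / N%:R else 0) +
   (if val k == l.+1 then k%:R / N%:R else 0 : R)))).
  rewrite big_mkcond /=; apply: ler_sum => l _; case: ifP => _; last first.
    by rewrite addr_ge0//; case: ifP.
  rewrite up down.
  have e1 : expR (- beta * N%:R * pos_part (energy h (@gammaN R N l) -
      energy h (@gammaN R N k))) <= 1.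
    rewrite -expR0 ler_expR -mulrA mulNr oppr_le0 !mulr_ge0//.
    by rewrite /pos_part le_max lexx orbT.
  have [lk|_] := eqVneq (val l) k.+1; last first.
    rewrite add0r; case: ifP => _; last by rewrite mulr0.
    by rewrite ler_piMl.
  by rewrite ler_wpDr ?ler_piMl//; case: ifP.
rewrite big_split /= -!big_mkcond /=.
have le1 (Q : pred 'I_N.+1) (c : R) : 0 <= c ->
    (forall l l', Q l -> Q l' -> l = l') -> \sum_(l | Q l) c <= c.
  move=> c0 Qu; case: (pickP Q) => [l Ql|Q0]; last by rewrite big_pred0.
  rewrite (big_pred1 l)// => l'; apply/idP/eqP => [Ql'|->//]; exact: Qu.
have s1 : (N - k)%:R / N%:R + k%:R / N%:R = 1 :> R.
  by rewrite natrB -1?ltnS//; field.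
rewrite -[leRHS]s1; apply: lerD; apply: le1 => [|l l' /eqP E /eqP E'].
- by rewrite divr_ge0.
- by apply/val_inj; rewrite /= E E'.
- by rewrite divr_ge0.
- by apply/val_inj/eqP; rewrite -eqSS -E E'.
Qed.

Lemma cw_weight_gt0 k : 0 < cw_weight k.
Proof. by rewrite /cw_weight mulr_gt0 ?expR_gt0// ltr0n bin_gt0 -ltnS. Qed.

Lemma cw_conductance_gt0 (k : nat) : (k < N)%N -> 0 < cw_conductance k.
Proof.
move=> kN; rewrite /cw_conductance /edge_count !mulr_gt0 ?expR_gt0// ?invr_gt0 ?ltr0n//.
  by rewrite subn_gt0.
by rewrite bin_gt0 ltnW.
Qed.

Lemma cw_chain_irreducible : irreducible P.
Proof.
have up (k l : 'I_N.+1) : val l = k.+1 -> 0 < P k l.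
  move=> lk; rewrite /cw_chain with_holding_off; last first.
    by apply/eqP => E; move: lk; rewrite E; move=> /=; lia.
  rewrite -(pmulr_rgt0 _ (cw_weight_gt0 k)) cw_rate_up// cw_conductance_gt0//.
  by rewrite -ltnS -lk ltn_ord.
have down (k l : 'I_N.+1) : val k = l.+1 -> 0 < P k l.
  move=> kl; rewrite /cw_chain with_holding_off; last first.
    by apply/eqP => E; move: kl; rewrite E; move=> /=; lia.
  rewrite -(pmulr_rgt0 _ (cw_weight_gt0 k)) cw_rate_down// cw_conductance_gt0//.
  by rewrite -ltnS -kl ltn_ord.
have c0 n (nN : (n < N.+1)%N) : connect (fun x y => 0 < P x y) (Ordinal nN) ord0 /\
    connect (fun x y => 0 < P x y) ord0 (Ordinal nN).
  elim: n nN => [|n IH] nN.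
    by rewrite (_ : Ordinal nN = ord0) ?connect0//; apply/val_inj.
  have [d u] := IH (ltnW nN); split.
    by apply: connect_trans d; apply: connect1; exact: down.
  by apply: connect_trans u _; apply: connect1; exact: up.
move=> [k kN] [l lN]; apply: connect_trans (c0 _ kN).1 (c0 _ lN).2.
Qed.

Lemma cw_chain_reversible k l : cw_weight k * P k l = cw_weight l * P l k.
Proof.
have [->//|kl] := eqVneq k l.
rewrite /cw_chain !with_holding_off// 1?eq_sym//.
have [E|n1] := eqVneq (val l) k.+1; first by rewrite cw_rate_up// cw_rate_down.
have [E|n2] := eqVneq (val k) l.+1; first by rewrite cw_rate_down// cw_rate_up.
by rewrite !cw_rate0// !mulr0.
Qed.

Lemma cw_chain_dirichlet (f : 'I_N.+1 -> R) :
  dirichlet P (fun k => cw_weight k) f f =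
  \sum_(j < N) cw_conductance j * (f (inord j) - f (inord j.+1)) ^+ 2.
Proof.
rewrite /dirichlet sum_path_graph.
- apply: eq_bigr => j _.
  have j0 : val (inord j : 'I_N.+1) = j by rewrite /= inordK// ltnS ltnW.
  have j1 : val (inord j.+1 : 'I_N.+1) = j.+1 by rewrite /= inordK// ltnS.
  rewrite /cw_chain with_holding_off; last first.
    by rewrite -val_eqE j0 j1; apply/eqP => /=; lia.
  by rewrite -mulrA -expr2 cw_rate_up ?j0// j1.
- by move=> k l; rewrite cw_chain_reversible; ring.
- move=> k l n1 n2; have [->|kl] := eqVneq k l; first by rewrite subrr mulr0.
  by rewrite /cw_chain with_holding_off// cw_rate0// mulr0 !mul0r.
Qed.

End CurieWeiss.

(** * The one-dimensional network *)

(** Prescribing the potential on the half-spaces [l <= a] and [b <= l] is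
    harmless: it is constant inside them, hence harmonic there, because [l]
    moves by at most one at each step. *)
Lemma graded_potential (R : realType) (S : finType) (P : S -> S -> R)
    (l : S -> nat) (a b : nat) (u v : S) :
  stochastic P -> irreducible P ->
  (forall x y, 0 < P x y -> (l y <= (l x).+1)%N /\ (l x <= (l y).+1)%N) ->
  (a < b)%N -> l u = a -> l v = b ->
  exists h, [/\ is_potential P [set x | l x == a]%SET [set x | l x == b]%SET h,
    forall x, (l x <= a)%N -> h x = 1 & forall x, (b <= l x)%N -> h x = 0].
Proof.
move=> Psto Pirr Pl ab lu lv.
have vB : v \in [set x | (b <= l x)%N]%SET by rewrite inE lv.
have dAB x : x \in [set x | (l x <= a)%N]%SET -> x \notin [set x | (b <= l x)%N]%SET.
  by rewrite !inE -ltnNge => lx; exact: leq_ltn_trans lx ab.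
have [h [hA hB hP h01]] := potential_exists Psto Pirr vB dAB.
have hA' x : (l x <= a)%N -> h x = 1 by move=> lx; rewrite hA ?inE.
have hB' x : (b <= l x)%N -> h x = 0 by move=> lx; rewrite hB ?inE.
have [P0 P1] := Psto.
have PE x y c : (0 < P x y -> h y = c) -> P x y * h y = P x y * c.
  move=> H; have [/H -> //|] := ltP 0 (P x y).
  move=> Pxy; have -> : P x y = 0 by apply/eqP; rewrite eq_le Pxy P0.
  by rewrite !mul0r.
exists h; split=> //; split=> //.
- by move=> x; rewrite inE => /eqP lx; rewrite hA' ?lx.
- by move=> x; rewrite inE => /eqP lx; rewrite hB' ?lx.
- move=> x; rewrite !inE => xa xb.
  have [la|la] := leqP (l x) a.
    have la' : (l x < a)%N by rewrite ltn_neqAle xa.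
    rewrite hA'// -(P1 x); apply: eq_bigr => y _.
    rewrite (PE x y 1) ?mulr1// => /Pl[le _]; apply: hA'; exact: leq_trans le _.
  have [lb|lb] := leqP b (l x).
    have lb' : (b < l x)%N by rewrite ltn_neqAle eq_sym xb.
    rewrite hB'// big1// => y _.
    rewrite (PE x y 0) ?mulr0// => /Pl[_ le]; apply: hB'.
    by rewrite -ltnS; apply: leq_trans le.
  by apply: hP; rewrite inE -ltnNge.
Qed.

(** For potential drops [d] across conductances [w] in series, the energy is at
    least the square of the total drop divided by the total resistance. *)
Lemma weighted_cauchy_schwarz (R : realType) (I : finType) (Q : pred I)
    (w d : I -> R) : (forall i, Q i -> 0 < w i) ->
  (\sum_(i | Q i) d i) ^+ 2 <=
  (\sum_(i | Q i) (w i)^-1) * \sum_(i | Q i) w i * d i ^+ 2.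
Proof.
move=> w0; set T := \sum_(i | Q i) (w i)^-1; set s := \sum_(i | Q i) d i.
have T0 : 0 <= T by apply: sumr_ge0 => i /w0 wi; rewrite invr_ge0 ltW.
have [T00|Tn0] := eqVneq T 0.
  rewrite /s big_pred0 ?expr0n ?T00 ?mul0r// => i; apply/negP => Qi.
  have := @psumr_eq0P _ _ Q (fun i => (w i)^-1) _ T00 i Qi.
  move=> E; have := w0 i Qi; rewrite -invr_gt0 E ?ltxx// => j Qj.
  by rewrite invr_ge0 ltW ?w0.
have : 0 <= \sum_(i | Q i) w i * (d i - s / (T * w i)) ^+ 2.
  by apply: sumr_ge0 => i Qi; rewrite mulr_ge0 ?sqr_ge0 ?ltW ?w0.
rewrite (eq_bigr (fun i => w i * d i ^+ 2 - 2 * s / T * d i +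
    s ^+ 2 / T ^+ 2 * (w i)^-1)); last first.
  by move=> i /w0 wi; field; rewrite Tn0 gt_eqF.
rewrite big_split sumrB /= -!mulr_sumr -/s -/T.
have -> : s ^+ 2 / T ^+ 2 * T = s ^+ 2 / T by field.
have E (z : R) : z - 2 * s / T * s + s ^+ 2 / T = z - T^-1 * s ^+ 2.
  by field.
by rewrite E subr_ge0 ler_pdivrMl ?lt0r ?Tn0.
Qed.

Section Network.
Context {R : realType}.
Variables (beta h : R) (N : nat).
Hypothesis N0 : (0 < N)%N.
Variables (a b : nat).
Hypotheses (ab : (a < b)%N) (bN : (b <= N)%N).
Local Notation C := (cw_conductance beta h N).
Local Notation between := (fun j : 'I_N => (a <= j < b)%N).

Definition resistance : R := \sum_(j < N | (a <= j < b)%N) (C j)^-1.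

Lemma C_gt0 (j : 'I_N) : 0 < C j.
Proof. exact: cw_conductance_gt0. Qed.

Lemma resistance_gt0 : 0 < resistance.
Proof.
have aN : (a < N)%N by exact: leq_trans ab bN.
rewrite /resistance (bigD1 (Ordinal aN)) /= ?leqnn//.
rewrite ltr_pwDl ?invr_gt0 ?cw_conductance_gt0// sumr_ge0// => j _.
by rewrite invr_ge0 ltW ?C_gt0.
Qed.

Definition voltage (k : nat) : R :=
  (\sum_(j < N | (a <= j < b)%N && (k <= j)%N) (C j)^-1) / resistance.

Lemma voltage_le k : (k <= a)%N -> voltage k = 1.
Proof.
move=> ka; rewrite /voltage (eq_bigl between) ?divff ?gt_eqF ?resistance_gt0//.
by move=> j; case: (leqP a j) => //= aj; rewrite (leq_trans ka aj) andbT.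
Qed.

Lemma voltage_ge k : (b <= k)%N -> voltage k = 0.
Proof.
move=> bk; rewrite /voltage big_pred0 ?mul0r// => j.
apply/negP => /andP[/andP[_ jb] kj].
by have := leq_trans jb (leq_trans bk kj); rewrite ltnn.
Qed.

Lemma voltage_drop (j : 'I_N) : voltage j - voltage j.+1 =
  if (a <= j < b)%N then (C j)^-1 / resistance else 0.
Proof.
rewrite /voltage -mulrBl (bigID (fun i : 'I_N => (j < i)%N)) /=.
rewrite (eq_bigl (fun i : 'I_N => (a <= i < b)%N && (j < i)%N)); last first.
  move=> i; rewrite -andbA; congr (_ && _); case: (ltnP j i) => [/ltnW ->//|_].
  by rewrite andbF.
rewrite addrC addrK; case: ifP => jab; last first.
  rewrite big_pred0 ?mul0r// => i; apply/negP => /andP[/andP[iab ji]].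
  rewrite -leqNgt => ij; move: jab; have -> : (j = i :> nat) by apply/eqP; rewrite eqn_leq ji.
  by rewrite iab.
congr (_ / _); rewrite (big_pred1 j)// => i /=.
apply/idP/eqP => [/andP[/andP[iab ji]]|->]; last by rewrite jab leqnn ltnn.
by rewrite -leqNgt => ij; apply/val_inj/eqP; rewrite eqn_leq ji ij.
Qed.

Lemma telescope_between (u : nat -> R) :
  \sum_(j < N | (a <= j < b)%N) (u j - u j.+1) = u a - u b.
Proof.
rewrite -(big_mkord (fun j => (a <= j < b)%N) (fun j => u j - u j.+1)).
rewrite (big_cat_nat (n := b)) //= [X in _ + X]big1_seq ?addr0; last first.
  move=> j /andP[/andP[_ jb]]; rewrite mem_index_iota => /andP[bj _].
  by move: jb; rewrite ltnNge bj.
rewrite (big_cat_nat (n := a)) ?(ltnW ab)//= big1_seq ?add0r; last first.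
  move=> j /andP[/andP[aj _]]; rewrite mem_index_iota /= => ja.
  by move: ja; rewrite ltnNge aj.
rewrite big_nat_cond (eq_bigl (fun j => (a <= j < b)%N && true)); last first.
  by move=> j; rewrite andbT andbb.
rewrite -big_nat_cond -opprB -[in RHS](telescope_sumr u (ltnW ab)) -sumrN.
by apply: eq_bigr => j _; rewrite opprB.
Qed.

(** A total drop of 1 dissipates at least [1 / \sum r]. *)
Lemma series_law (u r D : nat -> R) : u a - u b = 1 ->
  (forall j : 'I_N, (a <= j < b)%N -> 0 < r j) ->
  (forall j : 'I_N, 0 <= D j) ->
  (forall j : 'I_N, (a <= j < b)%N -> (u j - u j.+1) ^+ 2 <= r j * D j) ->
  1 <= (\sum_(j < N | (a <= j < b)%N) r j) * \sum_(j < N) D j.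
Proof.
move=> uab r0 D0 ur.
have := @weighted_cauchy_schwarz R _ between (fun j => (r j)^-1)
  (fun j => u j - u j.+1) _.
rewrite telescope_between uab expr1n => H.
apply: le_trans (H _) _ => [j jab|]; first by rewrite invr_gt0 r0.
under eq_bigr do rewrite invrK.
rewrite ler_wpM2l//; first by apply: sumr_ge0 => j /r0/ltW.
rewrite [leRHS](bigID between) /= ler_wpDr ?sumr_ge0// ler_sum// => j jab.
by rewrite ler_pdivrMl ?r0// ur.
Qed.

(** The voltage gives the upper bound in the Dirichlet principle, and the series
    law shows that it is optimal. *)
Lemma cw_capacity (km kp : 'I_N.+1) f : 0 <= beta ->
  val km = a -> val kp = b ->
  is_potential (@cw_chain R beta h N) [set km]%SET [set kp]%SET f ->
  dirichlet (@cw_chain R beta h N) (fun k => cw_weight beta h N k) f f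
    = resistance^-1.
Proof.
move=> b0 kma kpb fpot.
have Psto := cw_chain_stochastic h N0 b0.
have Pirr := cw_chain_irreducible beta h N0.
have Prev := cw_chain_reversible beta h N0.
have mu0 := cw_weight_gt0 beta h (N := N).
have inA x : (x \in [set km]%SET) = (val x == a).
  by rewrite inE -kma (inj_eq val_inj).
have inB x : (x \in [set kp]%SET) = (val x == b).
  by rewrite inE -kpb (inj_eq val_inj).
have ordE j : (j <= N)%N -> nat_of_ord (inord j : 'I_N.+1) = j.
  by move=> jN; rewrite inordK.
have [fA fB _ _] := fpot.
apply/eqP; rewrite eq_le; apply/andP; split.
  have volt := dirichlet_principle Psto mu0 Prev fpot
    (f := fun k => voltage k).
  apply: le_trans (volt _ _) _ => [x|x|].
  - by rewrite inA => /eqP xa; rewrite voltage_le// -xa.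
  - by rewrite inB => /eqP xb; rewrite voltage_ge// -xb.
  rewrite cw_chain_dirichlet// (eq_bigr (fun j : 'I_N => if (a <= j < b)%N then
      (C j)^-1 * resistance ^- 2 else 0)); last first.
    move=> j _ /=; rewrite (ordE j) ?(ltnW (ltn_ord j))// ordE// voltage_drop.
    case: ifP => _; last by rewrite expr0n mulr0.
    by have := C_gt0 j; have := resistance_gt0; move=> *; field; rewrite !gt_eqF.
  rewrite -big_mkcond -mulr_suml -/resistance expr2 invfM mulrA divff ?mul1r//.
  by rewrite gt_eqF ?resistance_gt0.
rewrite cw_chain_dirichlet// -[leLHS]mul1r ler_pdivrMr ?resistance_gt0// mulrC.
apply: (@series_law (fun j => f (inord j)) (fun j => (C j)^-1)
  (fun j => C j * (f (inord j) - f (inord j.+1)) ^+ 2)).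
- by rewrite fA ?fB ?subr0// ?inA ?inB /= ordE// (leq_trans (ltnW ab)).
- by move=> j _; rewrite invr_gt0 C_gt0.
- by move=> j; rewrite mulr_ge0 ?sqr_ge0 ?ltW ?C_gt0.
- by move=> j _; rewrite mulKf// gt_eqF ?C_gt0.
Qed.

End Network.

(** * Comparison of the capacities *)

Section EdgeSums.
Context {R : realType}.
Variable N : nat.
Implicit Types (f g : config N -> R) (F G : config N -> config N -> R).

Lemma edge_sumE F k : edge_sum F k =
  \sum_(q : config N * 'I_N | (nplus q.1 == k) && ~~ q.1 q.2)
    F q.1 (flip q.1 q.2).
Proof. by rewrite /edge_sum pair_big_dep. Qed.

Lemma ler_edge_sum F G k :
  (forall x y, nplus x = k -> nplus y = k.+1 -> F x y <= G x y) ->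
  edge_sum F k <= edge_sum G k.
Proof.
move=> FG; apply: ler_sum => x /eqP xk; apply: ler_sum => i xi.
by apply: FG; rewrite ?nplus_flip_up ?xk.
Qed.

Lemma edge_sumD F G k :
  edge_sum (fun x y => F x y + G x y) k = edge_sum F k + edge_sum G k.
Proof. by rewrite /edge_sum -big_split; apply: eq_bigr => x _; rewrite big_split. Qed.

Lemma edge_sumZ c F k : edge_sum (fun x y => c * F x y) k = c * edge_sum F k.
Proof. by rewrite /edge_sum mulr_sumr; apply: eq_bigr => x _; rewrite mulr_sumr. Qed.

Lemma edge_count_gt0 k : (k < N)%N -> 0 < @edge_count R N k.
Proof. by move=> kN; rewrite mulr_gt0 ?ltr0n ?subn_gt0// bin_gt0 ltnW. Qed.

Lemma edge_sum_lowerE f k : (k <= N)%N ->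
  edge_sum (fun x _ => f x) k = @edge_count R N k * level_mean f k.
Proof.
move=> kN; rewrite edge_sum_lower /edge_count /level_mean.
have : 'C(N, k)%:R != 0 :> R by rewrite pnatr_eq0 -lt0n bin_gt0.
by move=> ?; field.
Qed.

Lemma edge_sum_upperE f k : (k < N)%N ->
  edge_sum (fun _ y => f y) k = @edge_count R N k * level_mean f k.+1.
Proof.
move=> kN; rewrite edge_sum_upper edge_countE /level_mean.
have : 'C(N, k.+1)%:R != 0 :> R by rewrite pnatr_eq0 -lt0n bin_gt0.
by move=> ?; field.
Qed.

Lemma level_mean_drop f k : (k < N)%N ->
  level_mean f k - level_mean f k.+1 =
  edge_sum (fun x y => f x - f y) k / @edge_count R N k.
Proof.
move=> kN; have n0 : @edge_count R N k != 0 by rewrite gt_eqF ?edge_count_gt0.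
rewrite (edge_sumD (fun x _ => f x) (fun _ y => - f y)).
rewrite (edge_sum_lowerE f (ltnW kN)) (edge_sum_upperE (fun y => - f y) kN).
rewrite /level_mean /level_sum sumrN; field.
by rewrite n0 /= !pnatr_eq0 -!lt0n !bin_gt0 kN ltnW.
Qed.

(** Energy bound for the flow spread uniformly over the edges between two
    consecutive levels. *)
Lemma level_mean_energy (c : config N -> config N -> R) f k : (k < N)%N ->
  (forall x y, 0 < c x y) ->
  (level_mean f k - level_mean f k.+1) ^+ 2 <=
  edge_sum (fun x y => (c x y)^-1) k / @edge_count R N k ^+ 2 *
  edge_sum (fun x y => c x y * (f x - f y) ^+ 2) k.
Proof.
move=> kN c0; rewrite level_mean_drop// !edge_sumE expr_div_n.
rewrite [leRHS]mulrAC ler_wpM2r ?invr_ge0 ?sqr_ge0//.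
exact: (@weighted_cauchy_schwarz R _ _
  (fun q : config N * 'I_N => c q.1 (flip q.1 q.2))
  (fun q => f q.1 - f (flip q.1 q.2))).
Qed.

Lemma level_mean_const f c k : (k <= N)%N ->
  (forall x, nplus x = k -> f x = c) -> level_mean f k = c.
Proof.
move=> kN fc; have C0 : 'C(N, k)%:R != 0 :> R by rewrite pnatr_eq0 -lt0n bin_gt0.
rewrite /level_mean /level_sum (eq_bigr (fun=> c * 1)); last first.
  by move=> x /eqP/fc ->; rewrite mulr1.
by rewrite -mulr_sumr -/(level_sum _ k) level_sum1 mulfK.
Qed.

Lemma ler_level_mean f g k : (forall x, nplus x = k -> f x <= g x) ->
  level_mean f k <= level_mean g k.
Proof.
move=> fg; rewrite /level_mean ler_wpM2r ?invr_ge0//.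
by apply: ler_sum => x /eqP; exact: fg.
Qed.

Lemma exists_level k : (k <= N)%N -> exists x : config N, nplus x = k.
Proof.
move=> kN; exists [ffun i : 'I_N => (i < k)%N]; rewrite /nplus.
rewrite -sum1_card (eq_bigl (fun i : 'I_N => (i < k)%N)); last first.
  by move=> i; rewrite inE ffunE.
by rewrite (big_ord_narrow kN) sum1_card card_ord.
Qed.

End EdgeSums.

Section DiluteCapacity.
Context {R : realType}.
Variables (p beta h : R) (N : nat) (J : coupling N).
Hypotheses (N0 : (0 < N)%N) (b0 : 0 <= beta).
Variables (a b : nat).
Hypotheses (ab : (a < b)%N) (bN : (b <= N)%N).
Local Notation C := (cw_conductance beta h N).
Local Notation E := (level_energy h N).
Local Notation H := (hamiltonian p h J).
Local Notation c := (conductance p beta h J).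
Local Notation Rs := (resistance beta h N a b).
Local Notation P := (metropolis p beta h J).
Local Notation W := (weight p beta h J).

(** The deviation of the Hamiltonian from its mean over the couplings, which is
    [1/2 + N E(m)]. *)
Definition disorder (x : config N) : R := H x - 2^-1 - E (nplus x).

Definition disorder_mean (t : R) (k : nat) : R :=
  level_mean (fun x => expR (t * disorder x)) k.

Lemma weightE x : W x = expR (- beta * E (nplus x)) * expR (- beta * disorder x).
Proof. by rewrite /weight /disorder -expRD; congr expR; ring. Qed.

(** A Metropolis conductance only depends on the larger of the energies at the
    two endpoints. *)
Lemma max_energy_bounds x y (k : nat) : nplus x = k -> nplus y = k.+1 ->
  Num.max (H x) (H y) - 2^-1 <= Num.max (E k) (E k.+1) + Num.max (disorder x) (disorder y)
  /\ Num.max (E k) (E k.+1) + Num.min (disorder x) (disorder y) <= Num.max (H x) (H y) - 2^-1.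
Proof.
move=> xk yk.
have -> : H x = E k + disorder x + 2^-1 by rewrite /disorder xk; ring.
have -> : H y = E k.+1 + disorder y + 2^-1 by rewrite /disorder yk; ring.
move: (E k) (E k.+1) (disorder x) (disorder y) => r s u v.
split; rewrite ?maxEle ?minEle; do !case: ifP => /=; move=> *; lra.
Qed.

Lemma edge_countC k : (k < N)%N -> @edge_count R N k / C k =
  N%:R * expR (beta * Num.max (E k) (E k.+1)).
Proof.
move=> kN; have := edge_count_gt0 (R := R) kN; move=> n0.
rewrite /cw_conductance mulNr expRN.
have N1 : N%:R != 0 :> R by rewrite pnatr_eq0 -lt0n.
by field; rewrite N1 !gt_eqF ?expR_gt0.
Qed.

Lemma expR_max (t u v : R) :
  expR (t * Num.max u v) <= expR (t * u) + expR (t * v).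
Proof. by case: (leP u v) => _; rewrite ?lerDl ?lerDr expR_ge0. Qed.

Lemma expR_min (t u v : R) :
  expR (- t * Num.min u v) <= expR (- t * u) + expR (- t * v).
Proof. by case: (leP u v) => _; rewrite ?lerDl ?lerDr expR_ge0. Qed.

(** For a flow spread uniformly over a layer of edges, the disorder multiplies
    the mean-field resistance by averages of [e^{beta Delta}] over the two
    adjacent levels; the larger disorder along an edge is bounded by adding the
    exponentials. *)
Lemma level_resistance k : (k < N)%N ->
  edge_sum (fun x y => (c x y)^-1) k / @edge_count R N k ^+ 2 <=
  (C k)^-1 * (disorder_mean beta k + disorder_mean beta k.+1).
Proof.
move=> kN; have n0 := edge_count_gt0 (R := R) kN.
have C0 := cw_conductance_gt0 beta h N0 kN.
pose Y x := expR (beta * disorder x).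
rewrite ler_pdivrMr ?exprn_gt0//.
apply: (@le_trans _ _ (edge_sum (fun x y => @edge_count R N k / C k * (Y x + Y y)) k)).
  apply: ler_edge_sum => x y xk yk; have [ub _] := max_energy_bounds xk yk.
  rewrite edge_countC// /conductance invfM invrK mulNr expRN invrK -mulrA.
  rewrite ler_wpM2l//.
  apply: (le_trans _ (ler_wpM2l (expR_ge0 _) (expR_max beta (disorder x) (disorder y)))).
  by rewrite -expRD -mulrDr ler_expR ler_wpM2l.
rewrite edge_sumZ edge_sumD (edge_sum_lowerE Y (ltnW kN)) (edge_sum_upperE Y kN).
by rewrite /disorder_mean -/Y; apply: eq_ler; field; rewrite gt_eqF.
Qed.

Lemma level_conductance k : (k < N)%N ->
  edge_sum c k <= C k * (disorder_mean (- beta) k + disorder_mean (- beta) k.+1).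
Proof.
move=> kN; have n0 := edge_count_gt0 (R := R) kN.
have C0 := cw_conductance_gt0 beta h N0 kN.
pose Y x := expR (- beta * disorder x).
apply: (@le_trans _ _ (edge_sum (fun x y => C k / @edge_count R N k * (Y x + Y y)) k)).
  apply: ler_edge_sum => x y xk yk; have [_ lb] := max_energy_bounds xk yk.
  rewrite -[C k / _]invf_div edge_countC// /conductance invfM -expRN -mulNr -mulrA.
  rewrite ler_wpM2l ?invr_ge0//.
  apply: (le_trans _ (ler_wpM2l (expR_ge0 _) (expR_min beta (disorder x) (disorder y)))).
  by rewrite -expRD -mulrDr ler_expR !mulNr lerN2 ler_wpM2l.
rewrite edge_sumZ edge_sumD (edge_sum_lowerE Y (ltnW kN)) (edge_sum_upperE Y kN).
by rewrite /disorder_mean -/Y; apply: eq_ler; field; rewrite gt_eqF.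
Qed.

End DiluteCapacity.

Section Comparison.
Context {R : realType}.
Variables (p beta h : R) (N : nat) (J : coupling N).
Hypotheses (N0 : (0 < N)%N) (b0 : 0 <= beta).
Variables (a b : nat).
Hypotheses (ab : (a < b)%N) (bN : (b <= N)%N).
Local Notation C := (cw_conductance beta h N).
Local Notation E := (level_energy h N).
Local Notation w := (cw_weight beta h N).
Local Notation c := (conductance p beta h J).
Local Notation Rs := (resistance beta h N a b).
Local Notation P := (metropolis p beta h J).
Local Notation W := (weight p beta h J).
Local Notation Delta := (disorder p h J).
Local Notation mean := (disorder_mean p h J).
Local Notation lev k := [set x : config N | nplus x == k]%SET.

Let Psto : stochastic P. Proof. exact: metropolis_stochastic. Qed.
Let Pirr : irreducible P. Proof. exact: metropolis_irreducible. Qed.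

Lemma dilute_potential : exists f,
  [/\ is_potential P (lev a) (lev b) f,
      forall x, (nplus x <= a)%N -> f x = 1 &
      forall x, (b <= nplus x)%N -> f x = 0].
Proof.
have [u ua] := exists_level (leq_trans (ltnW ab) bN).
have [v vb] := exists_level bN.
apply: (graded_potential (u := u) (v := v)) => // x y.
have [->|xy] := eqVneq x y; first by rewrite leqnSn.
rewrite /metropolis with_holding_off//.
have [/neighbourP[i ->] _|/metropolis_rateN ->] := boolP (neighbour x y); last first.
  by rewrite ltxx.
have [xi|xi] := boolP (x i); last by rewrite nplus_flip_up// leqnn !leqW.
by rewrite (nplus_flip_down xi) leqnn !leqW.
Qed.

Lemma disorder_mean_ge0 t k : 0 <= mean t k.
Proof. by rewrite divr_ge0// sumr_ge0// => x _; rewrite expR_ge0. Qed.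

Lemma disorder_mean_gt0 t k : (k <= N)%N -> 0 < mean t k.
Proof.
move=> kN; rewrite divr_gt0 ?ltr0n ?bin_gt0//.
have [x xk] := exists_level kN.
rewrite /level_sum (bigD1 x) ?xk//= ltr_pwDl ?expR_gt0// sumr_ge0// => y _.
Qed.

Let C0 (j : 'I_N) : 0 < C j. Proof. exact: cw_conductance_gt0. Qed.
Let Rs0 : 0 < Rs. Proof. exact: resistance_gt0. Qed.

(** The law on configurations induced by the unit flow from level [a] to
    level [b] spread uniformly over each layer of edges: an edge of the flow
    is drawn proportionally to its dissipation, then one of its endpoints. *)
Definition flow_measure (x : config N) : R := (2 * Rs)^-1 *
  \sum_(j < N | (a <= j < b)%N) (C j)^-1 *
    ((nplus x == j)%:R / 'C(N, j)%:R + (nplus x == j.+1)%:R / 'C(N, j.+1)%:R).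

Lemma flow_measureE Y : \sum_x flow_measure x * Y x = (2 * Rs)^-1 *
  \sum_(j < N | (a <= j < b)%N) (C j)^-1 * (level_mean Y j + level_mean Y j.+1).
Proof.
rewrite /flow_measure; under eq_bigr do rewrite -mulrA mulr_suml.
rewrite -mulr_sumr exchange_big /=; congr (_ * _); apply: eq_bigr => j _.
have lE k : \sum_x (nplus x == k)%:R / 'C(N, k)%:R * Y x = level_mean Y k.
  rewrite /level_mean /level_sum [in RHS]big_mkcond mulr_suml /=.
  apply: eq_bigr => x _; case: eqP => _; last by rewrite !mul0r.
  by rewrite mul1r mulrC.
rewrite -!lE -big_split mulr_sumr /=; apply: eq_bigr => x _; ring.
Qed.

Lemma flow_measure_ge0 x : 0 <= flow_measure x.
Proof.
rewrite /flow_measure mulr_ge0 ?invr_ge0 ?mulr_ge0 ?(ltW Rs0)//.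
apply: sumr_ge0 => j _.
by rewrite mulr_ge0 ?invr_ge0 ?(ltW (C0 j))// addr_ge0// divr_ge0.
Qed.

Lemma flow_measure_sum1 : \sum_x flow_measure x = 1.
Proof.
under eq_bigr do rewrite -[flow_measure _]mulr1.
rewrite (flow_measureE (fun=> 1)) (eq_bigr (fun j : 'I_N => (C j)^-1 * 2)).
  by rewrite -mulr_suml -/Rs [_ * 2]mulrC mulVf// mulf_neq0// gt_eqF.
move=> j _; congr (_ * _).
by rewrite !(level_mean_const (c := 1))// ltnW.
Qed.

Variable f : config N -> R.
Hypothesis fpot : is_potential P (lev a) (lev b) f.
Local Notation cap := (dirichlet P W f f).

(** The Dirichlet principle, tested with the mean-field voltage. *)
Lemma dilute_capacity_le :
  cap <= 2 / Rs * \sum_x flow_measure x * expR (- beta * Delta x).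
Proof.
have volt := dirichlet_principle Psto (weight_gt0 p beta h J)
  (metropolis_reversible p beta h J) fpot
  (f := fun x => voltage beta h N a b (nplus x)).
apply: le_trans (volt _ _) _ => [x|x|].
- by rewrite inE => /eqP xa; rewrite voltage_le// xa.
- by rewrite inE => /eqP xb; rewrite voltage_ge// xb.
rewrite metropolis_dirichlet flow_measureE.
have -> : 2 / Rs * ((2 * Rs)^-1 * \sum_(j < N | (a <= j < b)%N)
    (C j)^-1 * (mean (- beta) j + mean (- beta) j.+1)) =
  \sum_(j < N) if (a <= j < b)%N then ((C j)^-1 / Rs) ^+ 2 *
     (C j * (mean (- beta) j + mean (- beta) j.+1)) else 0.
  rewrite -big_mkcond [X in _ * X = _]mulr_sumr [LHS]mulr_sumr; apply: eq_bigr => j _.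
  by field; rewrite !gt_eqF.
apply: ler_sum => j _.
have -> : edge_sum (fun x y => c x y * (voltage beta h N a b (nplus x) -
    voltage beta h N a b (nplus y)) ^+ 2) j =
    (if (a <= j < b)%N then (C j)^-1 / Rs else 0) ^+ 2 * edge_sum c j.
  rewrite -voltage_drop// -edge_sumZ; apply: eq_bigr => x /eqP xj.
  by apply: eq_bigr => i xi; rewrite nplus_flip_up// xj mulrC.
case: ifP => _; last by rewrite expr0n mul0r.
by rewrite ler_wpM2l ?sqr_ge0// level_conductance.
Qed.

Let D j := edge_sum (fun x y => c x y * (f x - f y) ^+ 2) j.

Let c_gt0 x y : 0 < c x y.
Proof. by rewrite mulr_gt0 ?expR_gt0// invr_gt0 ltr0n. Qed.

Let D0 j : 0 <= D j.
Proof.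
apply: sumr_ge0 => x _; apply: sumr_ge0 => i _.
by rewrite mulr_ge0 ?sqr_ge0// ltW.
Qed.

Lemma level_mean_drop_energy (j : 'I_N) :
  (level_mean f j - level_mean f j.+1) ^+ 2 <=
  (C j)^-1 * (mean beta j + mean beta j.+1) * D j.
Proof.
apply: le_trans (level_mean_energy f (ltn_ord j) c_gt0) _.
by rewrite ler_wpM2r// level_resistance.
Qed.

(** The Thomson principle, tested with the mean-field flow: the level means drop
    from 1 to 0, and each layer contributes its resistance. *)
Lemma dilute_capacity_ge :
  1 <= 2 * Rs * (\sum_x flow_measure x * expR (beta * Delta x)) * cap.
Proof.
rewrite flow_measureE mulVKf ?mulf_neq0 ?gt_eqF//.
rewrite metropolis_dirichlet.
have [fA fB _ _] := fpot.
have ua : level_mean f a = 1.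
  apply: level_mean_const => [|x xa]; first exact: leq_trans (ltnW ab) bN.
  by apply: fA; rewrite inE xa.
have ub : level_mean f b = 0.
  by apply: level_mean_const => // x xb; apply: fB; rewrite inE xb.
apply: (@series_law R N a b ab bN (level_mean f) (fun j => (C j)^-1 *
  (mean beta j + mean beta j.+1)) D) => //.
- by rewrite ua ub subr0.
- by move=> j _; rewrite mulr_gt0 ?invr_gt0 ?addr_gt0 ?disorder_mean_gt0// ltnW.
- by move=> j _; exact: level_mean_drop_energy.
Qed.

Lemma level_mean_drop_capacity (j : 'I_N) :
  C j * (level_mean f j - level_mean f j.+1) ^+ 2 <=
  (mean beta j + mean beta j.+1) * cap.
Proof.
rewrite -ler_pdivlMl//; apply: le_trans (level_mean_drop_energy j) _.
rewrite mulrA ler_wpM2l//.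
  by rewrite mulr_ge0 ?invr_ge0 ?(ltW (C0 _))// addr_ge0 ?disorder_mean_ge0.
rewrite metropolis_dirichlet (bigD1 j)//= lerDl sumr_ge0// => i _; exact: D0.
Qed.

End Comparison.

(** * Comparison of the numerators *)

(** What remains of the potential after averaging over levels: a profile of
    controlled energy, measured against the conductance at level [ks]. *)
Definition profile (R : realType) (beta h : R) (N a b ks : nat) (K : R)
    (u : nat -> R) : Prop :=
  [/\ forall k, (k <= N)%N -> 0 <= u k <= 1,
      forall k, (k <= a)%N -> u k = 1,
      forall k, (b <= k <= N)%N -> u k = 0 &
      forall j, (a <= j < b)%N -> cw_conductance beta h N j *
        (u j - u j.+1) ^+ 2 <= K * cw_conductance beta h N ks].

(** The error in the numerator when the potential is replaced by the indicator
    of the levels up to [ks]. *)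
Definition step_defect (R : realType) (beta h : R) (N ks : nat) (u : nat -> R) : R :=
  \sum_(k < N.+1) cw_weight beta h N k * if (k <= ks)%N then 1 - u k else u k.

Definition left_mass (R : realType) (beta h : R) (N ks : nat) : R :=
  \sum_(k < N.+1 | (k <= ks)%N) cw_weight beta h N k.

Section Numerators.
Context {R : realType}.
Variables (p beta h : R) (N : nat) (J : coupling N).
Hypotheses (N0 : (0 < N)%N) (b0 : 0 <= beta).
Variables (a b ks : nat).
Hypotheses (aks : (a <= ks)%N) (ksb : (ks < b)%N) (bN : (b <= N)%N).
Local Notation C := (cw_conductance beta h N).
Local Notation E := (level_energy h N).
Local Notation w := (cw_weight beta h N).
Local Notation Rs := (resistance beta h N a b).
Local Notation P := (metropolis p beta h J).
Local Notation W := (weight p beta h J).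
Local Notation Delta := (disorder p h J).
Local Notation mean := (disorder_mean p h J).
Local Notation lev k := [set x : config N | nplus x == k]%SET.
Local Notation Z := (left_mass beta h N ks).

Let ab : (a < b)%N. Proof. exact: leq_ltn_trans ksb. Qed.
Let ksN : (ks < N)%N. Proof. exact: leq_trans ksb bN. Qed.

(** The Curie-Weiss Gibbs measure conditioned on the levels up to [ks]. *)
Definition core_measure (x : config N) : R :=
  if (nplus x <= ks)%N then expR (- beta * E (nplus x)) / Z else 0.

Lemma left_mass_gt0 : 0 < Z.
Proof.
rewrite /left_mass (bigD1 ord0)//= ltr_pwDl ?(cw_weight_gt0 _ _ ord0)//.
by rewrite sumr_ge0// => k _; rewrite ltW// cw_weight_gt0.
Qed.

Lemma sum_left (F : config N -> R) :
  \sum_(x | (nplus x <= ks)%N) F x =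
  \sum_(k < N.+1 | (k <= ks)%N) level_sum F k.
Proof.
rewrite big_mkcond sum_levels [RHS]big_mkcond; apply: eq_bigr => k _.
rewrite /level_sum; case: ifP => kks.
  by apply: eq_bigr => x /eqP ->; rewrite kks.
by rewrite big1// => x /eqP ->; rewrite kks.
Qed.

Lemma core_measure_sum1 : \sum_x core_measure x = 1.
Proof.
rewrite /core_measure -big_mkcond -mulr_suml sum_left.
rewrite (eq_bigr (fun k : 'I_N.+1 => w k)) ?divff ?gt_eqF ?left_mass_gt0//.
move=> k _; rewrite /cw_weight -level_sum1 mulrC mulr_sumr.
by apply: eq_bigr => x /eqP ->; rewrite mulr1.
Qed.

Lemma core_measure_ge0 x : 0 <= core_measure x.
Proof.
rewrite /core_measure; case: ifP => // _.
by rewrite divr_ge0 ?expR_ge0// ltW ?left_mass_gt0.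
Qed.

Lemma core_weight : \sum_(x | (nplus x <= ks)%N) W x =
  Z * \sum_x core_measure x * expR (- beta * Delta x).
Proof.
rewrite mulr_sumr big_mkcond; apply: eq_bigr => x _.
rewrite /core_measure; case: ifP => _; last by rewrite mul0r mulr0.
by rewrite weightE; field; rewrite gt_eqF ?left_mass_gt0.
Qed.

Lemma resistance_ks : Rs^-1 <= C ks.
Proof.
rewrite -[leRHS]invrK lef_pV2 ?posrE ?invr_gt0 ?cw_conductance_gt0 ?resistance_gt0//.
rewrite /resistance (bigD1 (Ordinal ksN)) /= ?aks// lerDl sumr_ge0// => j _.
by rewrite invr_ge0 ltW ?cw_conductance_gt0.
Qed.

Variables (eps : R) (f : config N -> R).
Hypothesis Deltale : forall x, `|Delta x| <= eps * N%:R.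
Hypothesis fpot : is_potential P (lev a) (lev b) f.
Hypothesis fa : forall x, (nplus x <= a)%N -> f x = 1.
Hypothesis fb : forall x, (b <= nplus x)%N -> f x = 0.
Local Notation cap := (dirichlet P W f f).
Local Notation err := (expR (beta * eps * N%:R)).

Lemma disorder_exp (t : R) x : `|t| <= beta -> expR (t * Delta x) <= err.
Proof.
move=> tb; rewrite ler_expR; apply: le_trans (ler_norm _) _.
by rewrite normrM -mulrA ler_pM.
Qed.

Lemma disorder_mean_le t k : (k <= N)%N -> `|t| <= beta -> mean t k <= err.
Proof.
move=> kN tb; rewrite -[leRHS](level_mean_const (f := fun=> err) (c := err) kN)//.
by apply: ler_level_mean => x _; exact: disorder_exp.
Qed.

Lemma capacity_le_ks : cap <= 2 * err * C ks.
Proof.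
apply: le_trans (dilute_capacity_le N0 b0 ab bN fpot) _.
have -> : 2 * err * C ks = 2 * (C ks * err) by ring.
rewrite -[leLHS]mulrA ler_wpM2l// ler_pM//.
- by rewrite invr_ge0 ltW ?resistance_gt0.
- by rewrite sumr_ge0// => x _; rewrite mulr_ge0 ?expR_ge0 ?flow_measure_ge0.
- exact: resistance_ks.
rewrite -[leRHS]mul1r -[X in _ <= X * _](flow_measure_sum1 beta h N0 ab bN) mulr_suml.
apply: ler_sum => x _; rewrite ler_wpM2l ?flow_measure_ge0//.
by apply: disorder_exp; rewrite normrN ger0_norm.
Qed.

Lemma dilute_profile : profile beta h N a b ks (4 * expR (2 * beta * eps * N%:R))
  (level_mean f).
Proof.
have [_ _ _ f01] := fpot; split.
- move=> k kN; rewrite -[X in X <= _](level_mean_const (f := fun=> 0 : R) (c := 0) kN)//.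
  rewrite -[X in _ <= _ <= X](level_mean_const (f := fun=> 1 : R) (c := 1) kN)//.
  by rewrite !ler_level_mean// => x _; case/andP: (f01 x).
- move=> k ka; apply: level_mean_const => [|x xk]; last by rewrite fa ?xk.
  by rewrite (leq_trans ka)// (leq_trans (ltnW ab)).
- by move=> k /andP[bk kN]; apply: level_mean_const => // x xk; rewrite fb ?xk.
- move=> j /andP[aj jb]; have jN : (j < N)%N by exact: leq_trans bN.
  apply: le_trans (level_mean_drop_capacity p h J N0 b0 f (Ordinal jN)) _ => /=.
  have tb : `|beta| <= beta by rewrite ger0_norm.
  have -> : expR (2 * beta * eps * N%:R) = err * err.
    by rewrite -expRD; congr expR; ring.
  apply: (@le_trans _ _ (2 * err * (2 * err * C ks))); last first.
    by apply: eq_ler; ring.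
  apply: ler_pM.
  + by rewrite addr_ge0 ?disorder_mean_ge0.
  + exact: dirichlet_ge0 (metropolis_stochastic p h J N0 b0) (weight_gt0 p beta h J) f.
  + by rewrite mulr_natl mulr2n lerD ?disorder_mean_le// ltnW.
  + exact: capacity_le_ks.
Qed.

Local Notation core := (\sum_(x : config N | (nplus x <= ks)%N) W x).

(** Up to the factor [e^{beta eps N}] the error made by replacing the potential
    by a step is the defect of its level means, which is assumed to be small
    enough to absorb that factor twice: once in the error and once in the
    weight of the left levels. *)
Lemma dilute_numerator :
  4 * (expR (2 * beta * eps * N%:R) * step_defect beta h N ks (level_mean f)) <= Z ->
  3 / 4 * core <= \sum_x W x * f x <= 5 / 4 * core.
Proof.
move=> defect.
have [_ _ _ f01] := fpot.
have tb : `|- beta| <= beta by rewrite normrN ger0_norm.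
pose bad x := W x * if (nplus x <= ks)%N then 1 - f x else f x.
have badE : \sum_x bad x <= err * step_defect beta h N ks (level_mean f).
  rewrite sum_levels /step_defect mulr_sumr; apply: ler_sum => k _.
  have kN : (k <= N)%N by rewrite -ltnS.
  have CN0 : 'C(N, k)%:R != 0 :> R by rewrite pnatr_eq0 -lt0n bin_gt0.
  rewrite (_ : (if _ then _ else _) = level_mean
      (fun x => if (k <= ks)%N then 1 - f x else f x) k); last first.
    case: ifP => _ //; rewrite /level_mean /level_sum sumrB.
    rewrite -[X in _ = (X - _) / _]/(level_sum (fun=> 1) k) level_sum1.
    by rewrite mulrBl divff.
  rewrite /level_mean /cw_weight /level_sum.
  set S := \sum_(x | _) (if _ then _ else _).
  rewrite (_ : _ * _ = err * expR (- beta * E k) * S); last by field.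
  rewrite mulr_sumr; apply: ler_sum => x /eqP xk.
  rewrite /bad xk weightE xk; apply: ler_wpM2r.
    by case: ifP => _; rewrite ?subr_ge0; case/andP: (f01 x).
  by rewrite mulrC ler_wpM2r ?expR_ge0// disorder_exp.
have coreE : Z <= err * core.
  rewrite core_weight mulrCA -[leLHS]mulr1 ler_wpM2l ?(ltW left_mass_gt0)//.
  rewrite -[leLHS]core_measure_sum1 mulr_sumr ler_sum// => x _.
  rewrite mulrCA ler_peMr ?core_measure_ge0// -expRD -[leLHS]expR0 ler_expR.
  have := Deltale x; rewrite ler_norml => /andP[_ le].
  by rewrite mulNr subr_ge0 -mulrA ler_wpM2l.
have bad_small : 4 * \sum_x bad x <= core.
  have err0 : 0 < err by exact: expR_gt0.
  rewrite -(ler_pM2l err0); apply: le_trans coreE; apply: le_trans defect.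
  rewrite mulrCA ler_wpM2l//.
  have -> : expR (2 * beta * eps * N%:R) = err * err.
    by rewrite -expRD; congr expR; ring.
  by rewrite -[leRHS]mulrA ler_wpM2l ?expR_ge0.
have numE : \sum_x W x * f x = core - \sum_(x | (nplus x <= ks)%N) bad x +
    \sum_(x | ~~ (nplus x <= ks)%N) bad x.
  rewrite [LHS](bigID (fun x => (nplus x <= ks)%N)) /= -sumrB; congr (_ + _).
    by apply: eq_bigr => x xk; rewrite /bad xk; ring.
  by apply: eq_bigr => x /negbTE xk; rewrite /bad xk.
have bad0 (Q : pred (config N)) : 0 <= \sum_(x | Q x) bad x.
  apply: sumr_ge0 => x _; rewrite mulr_ge0 ?(ltW (weight_gt0 _ _ _ _ _))//.
  by case: ifP => _; rewrite ?subr_ge0; case/andP: (f01 x).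
have := bad0 (fun x => (nplus x <= ks)%N).
have := bad0 (fun x => ~~ (nplus x <= ks)%N).
move: bad_small; rewrite (bigID (fun x => (nplus x <= ks)%N)) /= numE.
by move=> *; lra.
Qed.

End Numerators.

(** * The ratio of the mean exit times *)

Section Ratio.
Context {R : realType}.
Variables (p beta h : R) (N : nat).
Hypotheses (N0 : (0 < N)%N) (b0 : 0 <= beta).
Variables (km kp : 'I_N.+1) (ks : nat).
Hypotheses (aks : (km <= ks)%N) (ksb : (ks < kp)%N).
Local Notation a := (nat_of_ord km).
Local Notation b := (nat_of_ord kp).
Local Notation Z := (left_mass beta h N ks).
Local Notation Rs := (resistance beta h N a b).

Let ab : (a < b)%N. Proof. exact: leq_ltn_trans ksb. Qed.
Let bN : (b <= N)%N. Proof. by rewrite -ltnS. Qed.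

Variable (eps : R).
Hypothesis eps0 : 0 <= eps.
Hypothesis defect : forall u,
  profile beta h N a b ks (4 * expR (2 * beta * eps * N%:R)) u ->
  4 * (expR (2 * beta * eps * N%:R) * step_defect beta h N ks u) <= Z.

Let err1 : 1 <= expR (2 * beta * eps * N%:R).
Proof. by rewrite -[leLHS]expR0 ler_expR !mulr_ge0. Qed.

Lemma cw_mean_exit_bounds : exists2 num : R,
  cw_mean_exit beta h km kp = (num * Rs)%:E & 3 / 4 * Z <= num <= 5 / 4 * Z.
Proof.
have Psto := cw_chain_stochastic h N0 b0.
have Pirr := cw_chain_irreducible beta h N0.
have Prev := cw_chain_reversible beta h N0.
have mu0 := cw_weight_gt0 beta h (N := N).
have [f [fpot fa fb]] : exists f, [/\ is_potential (@cw_chain R beta h N)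
    [set km]%SET [set kp]%SET f, forall k : 'I_N.+1, (k <= a)%N -> f k = 1 &
    forall k : 'I_N.+1, (b <= k)%N -> f k = 0].
  have -> : [set km]%SET = [set k : 'I_N.+1 | nat_of_ord k == a]%SET.
    by apply/setP => k; rewrite !inE -(inj_eq val_inj).
  have -> : [set kp]%SET = [set k : 'I_N.+1 | nat_of_ord k == b]%SET.
    by apply/setP => k; rewrite !inE -(inj_eq val_inj).
  apply: (@graded_potential _ _ _ (@nat_of_ord N.+1) a b km kp) => // k l.
  have [->|kl] := eqVneq k l; first by rewrite leqnSn.
  rewrite /cw_chain with_holding_off// => Pkl.
  have [lk|n1] := eqVneq (val l) k.+1; first by move: lk => /= ->; rewrite leqnn !leqW.
  have [lk|n2] := eqVneq (val k) l.+1; first by move: lk => /= ->; rewrite leqnn !leqW.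
  by move: Pkl; rewrite cw_rate0// ltxx.
have [_ _ _ f01] := fpot.
have kpkm : km \notin [set kp]%SET.
  by rewrite inE -(inj_eq val_inj) /=; apply/eqP => E; move: ab; rewrite E ltnn.
have [_] := mean_hit_point_mass Psto Pirr mu0 Prev (set11 kp) kpkm fpot.
have capE := cw_capacity N0 ab bN b0 erefl erefl fpot.
rewrite capE invrK => mE.
exists (\sum_(k : 'I_N.+1) cw_weight beta h N k * f k) => //.
pose u j := f (inord j).
have uprof : profile beta h N a b ks (4 * expR (2 * beta * eps * N%:R)) u.
  split.
  - by move=> k _; exact: f01.
  - by move=> k ka; apply: fa; rewrite inordK// ltnS (leq_trans ka)// (leq_trans (ltnW ab)).
  - by move=> k /andP[bk kN]; apply: fb; rewrite inordK.
  - move=> j /andP[aj jb]; have jN : (j < N)%N by exact: leq_trans bN.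
    have ksN : (ks < N)%N by exact: leq_trans ksb bN.
    apply: (@le_trans _ _ (cw_conductance beta h N ks)); last first.
      rewrite ler_peMl ?(ltW (cw_conductance_gt0 _ _ _ _))//.
      by move: err1; lra.
    apply: le_trans (resistance_ks _ _ N0 aks ksb bN).
    rewrite -capE cw_chain_dirichlet// (bigD1 (Ordinal jN))//= lerDl.
    rewrite sumr_ge0// => i _.
    by rewrite mulr_ge0 ?sqr_ge0// ltW// cw_conductance_gt0.
have := defect uprof.
pose bad (k : 'I_N.+1) := cw_weight beta h N k * if (k <= ks)%N then 1 - f k else f k.
have -> : step_defect beta h N ks u = \sum_k bad k.
  by apply: eq_bigr => k _; rewrite /u inord_val.
have bad0 (Q : pred 'I_N.+1) : 0 <= \sum_(k | Q k) bad k.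
  apply: sumr_ge0 => k _; rewrite mulr_ge0 ?(ltW (mu0 _))//.
  by case: ifP => _; rewrite ?subr_ge0; case/andP: (f01 k).
move=> badZ.
have badZ' : 4 * \sum_k bad k <= Z.
  apply: le_trans badZ; rewrite ler_wpM2l// ler_peMl//; exact: (bad0 xpredT).
have -> : \sum_(k : 'I_N.+1) cw_weight beta h N k * f k =
    Z - \sum_(k < N.+1 | (k <= ks)%N) bad k + \sum_(k < N.+1 | ~~ (k <= ks)%N) bad k.
  rewrite [LHS](bigID (fun k : 'I_N.+1 => (k <= ks)%N)) /= /left_mass -sumrB.
  congr (_ + _); first by apply: eq_bigr => k kk; rewrite /bad kk; ring.
  by apply: eq_bigr => k /negbTE kk; rewrite /bad kk.
have := bad0 (fun k => (k <= ks)%N).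
have := bad0 (fun k => ~~ (k <= ks)%N).
move: badZ'; rewrite (bigID (fun k : 'I_N.+1 => (k <= ks)%N)) /=.
by move=> *; lra.
Qed.

Variables (J : coupling N) (M : R).
Local Notation Delta := (disorder p h J).
Hypothesis Deltale : forall x, `|Delta x| <= eps * N%:R.
Hypothesis M0 : 0 < M.
Hypothesis core_up : \sum_x core_measure beta h ks x * expR (beta * Delta x) <= M.
Hypothesis core_down : \sum_x core_measure beta h ks x * expR (- beta * Delta x) <= M.
Hypothesis flow_up : \sum_x flow_measure beta h a b x * expR (beta * Delta x) <= M.
Hypothesis flow_down : \sum_x flow_measure beta h a b x * expR (- beta * Delta x) <= M.

Lemma dilute_mean_exit_bounds : exists num cap : R,
  [/\ mean_exit p beta h J km kp = (num / cap)%:E,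
      3 / 4 * (Z / M) <= num <= 5 / 4 * (Z * M), 0 < cap,
      cap <= 2 / Rs * M & 1 <= 2 * Rs * M * cap].
Proof.
have Psto := metropolis_stochastic p h J N0 b0.
have Pirr := metropolis_irreducible p beta h J N0.
have Prev := metropolis_reversible p beta h J.
have mu0 := weight_gt0 p beta h J.
have [f [fpot fa fb]] := dilute_potential p h J N0 b0 ab bN.
have [u ua] := exists_level (leq_trans (ltnW ab) bN).
have [v vb] := exists_level bN.
have uA : u \in [set x : config N | nplus x == a]%SET by rewrite inE ua.
have vB : v \in [set x : config N | nplus x == b]%SET by rewrite inE vb.
have dAB x : x \in [set x : config N | nplus x == a]%SET ->
    x \notin [set x : config N | nplus x == b]%SET.
  by rewrite !inE => /eqP ->; apply/eqP => E; move: ab; rewrite E ltnn.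
have [cap0 mE] := mean_hit_last_exit Psto Pirr mu0 Prev uA vB dAB fpot.
have Rs0 := resistance_gt0 beta h N0 ab bN.
have Z0 := left_mass_gt0 beta h N ks.
exists (\sum_x weight p beta h J x * f x),
  (dirichlet (metropolis p beta h J) (weight p beta h J) f f); split => //.
- rewrite -mE /mean_exit !levelE//; congr (mean_hit _ _ _).
  set k := expR (- beta * 2^-1) / \sum_y expR (- beta * hamiltonian p h J y).
  have k0 : k != 0.
    rewrite mulf_neq0 ?gt_eqF ?expR_gt0// invr_gt0.
    rewrite (bigD1 u)//=; apply: ltr_pwDl; first exact: expR_gt0.
    by apply: sumr_ge0 => y _; exact: expR_ge0.
  rewrite -[RHS](last_exit_biased_scale _ _ _ _ k0); congr (last_exit_biased _ _ _ _).
  by apply/funext => x; rewrite gibbs_weight.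
- have dprof := dilute_profile N0 b0 aks ksb bN Deltale fpot fa fb.
  have := dilute_numerator b0 Deltale fpot (defect dprof).
  rewrite core_weight => /andP[lo hi].
  apply/andP; split.
    apply: le_trans lo; rewrite ler_wpM2l// ler_wpM2l ?(ltW Z0)//.
    rewrite -[leLHS]mul1r ler_pdivrMr//.
    set X := \sum_x _.
    have X0 : 0 <= X.
      by apply: sumr_ge0 => x _; rewrite mulr_ge0 ?expR_ge0 ?core_measure_ge0.
    (* The arithmetic-geometric mean inequality turns the upper bound on the
       average of [e^{beta Delta}] into a lower bound on that of
       [e^{- beta Delta}]. *)
    have amgm (y : R) : 2 <= expR (beta * y) / M + M * expR (- beta * y).
      have z0 : 0 < expR (beta * y) by exact: expR_gt0.
      rewrite mulNr expRN -subr_ge0.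
      have -> : expR (beta * y) / M + M / expR (beta * y) - 2 =
          (expR (beta * y) - M) ^+ 2 / (M * expR (beta * y)).
        by field; rewrite !gt_eqF.
      by rewrite divr_ge0 ?sqr_ge0// mulr_ge0// ltW.
    have : 2 <= (\sum_x core_measure beta h ks x * expR (beta * Delta x)) / M + M * X.
      have E2 : \sum_(x : config N) core_measure beta h ks x * 2 = 2 :> R.
        by rewrite -mulr_suml core_measure_sum1 mul1r.
      rewrite -[leLHS]E2 mulr_suml /X mulr_sumr -big_split /=.
      apply: ler_sum => x _.
      have := ler_wpM2l (core_measure_ge0 beta h ks x) (amgm (Delta x)).
      by move=> /le_trans; apply; apply: eq_ler; ring.
    have : (\sum_x core_measure beta h ks x * expR (beta * Delta x)) / M <= 1.
      by rewrite ler_pdivrMr// mul1r.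
    by rewrite [X * M]mulrC => *; lra.
  apply: le_trans hi _; rewrite ler_wpM2l// ler_wpM2l ?(ltW Z0)//.
- apply: le_trans (dilute_capacity_le N0 b0 ab bN fpot) _.
  by rewrite ler_wpM2l// divr_ge0// ltW.
- apply: le_trans (dilute_capacity_ge N0 b0 ab bN fpot) _.
  by rewrite ler_wpM2r ?(ltW cap0)// ler_wpM2l// mulr_ge0// ltW.
Qed.

(** Apart from the averages, which [M] bounds, each numerator is known up to a
    factor [1 +- 1/4] and the capacity up to a factor 2, which makes
    [10 / 3 = 2 (5 / 4) / (3 / 4)]. *)
Lemma ratio_bounds : exists2 r : R,
  (mean_exit p beta h J km kp / cw_mean_exit beta h km kp)%E = r%:E &
  3 / 10 / M ^+ 2 <= r <= 10 / 3 * M ^+ 2.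
Proof.
have [num [cap [-> /andP[numl numu] cap0 capu capl]]] := dilute_mean_exit_bounds.
have [cnum -> /andP[cnuml cnumu]] := cw_mean_exit_bounds.
have Rs0 := resistance_gt0 beta h N0 ab bN.
have Z0 := left_mass_gt0 beta h N ks.
have cnum0 : 0 < cnum by lra.
exists (num / cap / (cnum * Rs)).
  by rewrite inver mulf_eq0 (gt_eqF cnum0) (gt_eqF Rs0).
have ZM0 : 0 < Z * M by rewrite mulr_gt0.
have ZM1 : 0 < Z / M by rewrite divr_gt0.
have cc0 : 0 < cap * (cnum * Rs) by rewrite !mulr_gt0.
have qE : cap * (cnum * Rs) = cap * Rs * cnum by ring.
have q2 : cap * Rs <= 2 * M.
  by rewrite -ler_pdivlMr// mulrAC.
have q1 : (2 * M)^-1 <= cap * Rs.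
  by rewrite -[leLHS]mul1r ler_pdivrMr ?mulr_gt0//; apply: le_trans capl _; apply: eq_ler; ring.
have q0 : 0 <= cap * Rs by rewrite mulr_ge0// ltW.
rewrite -[num / cap / _]mulrA -invfM; apply/andP; split.
  rewrite ler_pdivlMr// qE; apply: le_trans numl.
  have -> : 3 / 4 * (Z / M) = 3 / 10 / M ^+ 2 * (2 * M * (5 / 4 * Z)).
    by field; rewrite gt_eqF.
  rewrite ler_wpM2l ?divr_ge0 ?sqr_ge0//.
  by apply: ler_pM => //; apply: ltW.
rewrite ler_pdivrMr// qE; apply: le_trans numu _.
have -> : 5 / 4 * (Z * M) = 10 / 3 * M ^+ 2 * ((2 * M)^-1 * (3 / 4 * Z)).
  by field; rewrite gt_eqF.
apply: ler_wpM2l; first by rewrite mulr_ge0 ?sqr_ge0.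
apply: ler_pM => //; first by rewrite invr_ge0 mulr_ge0// ltW.
by rewrite mulr_ge0 ?divr_ge0// ltW.
Qed.

End Ratio.

(** * The double well *)

Section FreeEnergy.
Context {R : realType}.
Variables (beta h : R).
Local Notation f := (free_energy beta h).

Definition atanh (m : R) : R := (ln ((1 + m) / 2) - ln ((1 - m) / 2)) / 2.

(** The derivative of the free energy. *)
Definition force (m : R) : R := - m - h + beta^-1 * atanh m.

Lemma is_derive_free_energy (m : R) : -1 < m < 1 -> is_derive m 1 f (force m).
Proof.
move=> /andP[m1 m2].
have p0 : 0 < (1 + m) / 2 by lra.
have q0 : 0 < (1 - m) / 2 by lra.
pose P : R -> R := 2^-1 \*: (cst 1 + id).
pose Q : R -> R := 2^-1 \*: (cst 1 - id).
have PE x : P x = (1 + x) / 2 by rewrite /P /= -[LHS]/(2^-1 * (1 + x)) mulrC.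
have QE x : Q x = (1 - x) / 2 by rewrite /Q /= -[LHS]/(2^-1 * (1 - x)) mulrC.
have dP : is_derive m 1 P (2^-1 *: (0 + 1)) by exact: is_deriveZ.
have dQ : is_derive m 1 Q (2^-1 *: (0 - 1)) by exact: is_deriveZ.
have dlP : is_derive m 1 (@ln R \o P) ((P m)^-1 * (2^-1 *: (0 + 1))).
  by apply: is_derive1_comp; apply: is_derive1_ln; rewrite PE.
have dlQ : is_derive m 1 (@ln R \o Q) ((Q m)^-1 * (2^-1 *: (0 - 1))).
  by apply: is_derive1_comp; apply: is_derive1_ln; rewrite QE.
have -> : f = (- (2^-1 \*: (id * id)) - h \*: id) +
    beta^-1 \*: (Q * (@ln R \o Q) + P * (@ln R \o P)).
  apply/funext => x; rewrite /free_energy /energy /entropy.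
  rewrite -PE -QE.
  by rewrite -[RHS]/(- (2^-1 * (x * x)) - h * x + beta^-1 * (Q x * ln (Q x) + P x * ln (P x))) expr2 [in LHS](mulrC (x * x)).
apply: is_derive_eq; rewrite /force /atanh.
rewrite /GRing.scale /= PE QE !mulVKf ?gt_eqF//; move: beta^-1 => c.
by field.
Qed.

Lemma free_energy_derive1 (m : R) : -1 < m < 1 -> derive1 f m = force m.
Proof. by move=> m1; rewrite derive1E; apply/derive_val/is_derive_free_energy. Qed.

Lemma free_energy_continuous (m : R) : -1 < m < 1 -> {for m, continuous f}.
Proof.
move=> m1; apply/differentiable_continuous/derivable1_diffP.
by have [] := is_derive_free_energy m1.
Qed.

Lemma force_continuous (m : R) : -1 < m < 1 -> {for m, continuous force}.
Proof.
move=> /andP[m1 m2].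
apply: cvgD.
  by apply: cvgB; [apply: cvgN; exact: cvg_id|exact: cvg_cst].
apply: cvgM; first exact: cvg_cst.
apply: cvgM; last exact: cvg_cst.
apply: cvgB.
  apply: (@continuous_comp _ _ _ (fun x : R => (1 + x) / 2) (@ln R)).
    by apply: cvgM; [apply: cvgD; [exact: cvg_cst|exact: cvg_id]|exact: cvg_cst].
  by apply: continuous_ln; lra.
apply: (@continuous_comp _ _ _ (fun x : R => (1 - x) / 2) (@ln R)).
  by apply: cvgM; [apply: cvgB; [exact: cvg_cst|exact: cvg_id]|exact: cvg_cst].
by apply: continuous_ln; lra.
Qed.

Lemma free_energy_mvt (x y : R) : -1 < x -> x < y -> y < 1 ->
  exists2 c, x < c < y & f y - f x = force c * (y - x).
Proof.
move=> x1 xy y1.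
have [||c] := @MVT R f force x y xy.
- move=> z; rewrite in_itv /= => /andP[xz zy].
  apply: is_derive_free_energy; apply/andP; split; lra.
- apply: derivable_within_continuous => z; rewrite in_itv /= => /andP[xz zy].
  have [] // := @is_derive_free_energy z _; apply/andP; split; lra.
- by rewrite in_itv /= => cxy ->; exists c.
Qed.

Lemma free_energy_incr (x y : R) : -1 < x -> x < y -> y < 1 ->
  (forall z, x < z < y -> 0 < force z) -> f x < f y.
Proof.
move=> x1 xy y1 g0; rewrite -subr_gt0.
have [c cxy ->] := free_energy_mvt x1 xy y1.
by rewrite mulr_gt0 ?g0// subr_gt0.
Qed.

Lemma free_energy_decr (x y : R) : -1 < x -> x < y -> y < 1 ->
  (forall z, x < z < y -> force z < 0) -> f y < f x.
Proof.
move=> x1 xy y1 g0; rewrite -subr_lt0.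
have [c cxy ->] := free_energy_mvt x1 xy y1.
by rewrite pmulr_llt0 ?g0// subr_gt0.
Qed.

(** By the intermediate value theorem. *)
Lemma force_sign (x y : R) : -1 < x -> y < 1 ->
  (forall z, x <= z <= y -> force z != 0) -> x <= y ->
  (0 < force x) = (0 < force y).
Proof.
move=> x1 y1 nz xy.
have cont : {within `[x, y], continuous force}.
  apply: continuous_in_subspaceT => z; rewrite inE /= in_itv /= => /andP[xz zy].
  apply: force_continuous; apply/andP; split; lra.
have nx := nz x; have ny := nz y.
rewrite lexx xy in nx; rewrite lexx xy in ny.
move: nx ny => /(_ isT) nx /(_ isT) ny.
have [|px|nx0] := ltgtP 0 (force x); last by move: nx; rewrite -nx0 eqxx.
  move=> px; apply/esym; rewrite lt_neqAle eq_sym ny /= leNgt; apply/negP => ny0.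
  have [|c] := @IVT _ force x y 0 xy cont.
    by rewrite ge_min le_max (ltW ny0) (ltW px) orbT.
  rewrite in_itv /= => cxy c0.
  by have := nz c cxy; rewrite c0 eqxx.
apply/esym/negbTE/negP => ny0.
have [|c] := @IVT _ force x y 0 xy cont.
  by rewrite ge_min le_max (ltW ny0) (ltW px) orbT.
rewrite in_itv /= => cxy c0.
by have := nz c cxy; rewrite c0 eqxx.
Qed.

End FreeEnergy.

Section ZeroField.
Context {R : realType}.
Variable beta : R.
Hypothesis beta1 : 1 < beta.

Lemma free_energyE h (x : R) :
  free_energy beta h x = free_energy beta 0 x - h * x.
Proof. by rewrite /free_energy /energy; ring. Qed.

Lemma free_energyN (x : R) : free_energy beta 0 (- x) = free_energy beta 0 x.
Proof.
rewrite /free_energy /energy /entropy sqrrN opprK.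
by rewrite !mul0r [X in _ + beta^-1 * X]addrC.
Qed.

Lemma forceE h (x : R) : force beta h x = force beta 0 x - h.
Proof. by rewrite /force; ring. Qed.

Lemma force0 : force beta 0 0 = 0.
Proof. by rewrite /force /atanh addr0 !subr0 oppr0 subrr mul0r mulr0 addr0. Qed.

Lemma forceN (x : R) : force beta 0 (- x) = - force beta 0 x.
Proof. by rewrite /force /atanh opprK; ring. Qed.

(** At zero field the free energy decreases on the interval from 0 to
    [well_edge]; see [force_lt0]. *)
Definition well_edge : R := (1 - beta^-1) / 2.

Lemma betaV : 0 < beta^-1 < 1.
Proof. by rewrite invr_gt0 invf_lt1 ?(lt_trans ltr01 beta1) ?beta1// ltr0_neq0. Qed.

Lemma well_edge_gt0 : 0 < well_edge < 1.
Proof. by rewrite /well_edge; have /andP[] := betaV; move=> *; apply/andP; split; lra. Qed.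

(** By the inequality [atanh m <= m / (1 - m)]. *)
Lemma force_lt0 (m : R) : 0 < m <= well_edge -> force beta 0 m < 0.
Proof.
move=> /andP[m0 me]; have /andP[b0 b1] := betaV.
have m1 : m < 1 by apply: le_lt_trans me _; case/andP: well_edge_gt0.
have le : atanh m <= m / (1 - m).
  rewrite /atanh ler_pdivrMr// -ln_div ?posrE; [|lra|lra].
  have -> : (1 + m) / 2 / ((1 - m) / 2) = 1 + 2 * m / (1 - m) by field; lra.
  have -> : m / (1 - m) * 2 = 2 * m / (1 - m) by ring.
  apply: le_ln1Dx; apply: lt_le_trans (_ : -1 < 0) _; first by lra.
  by rewrite divr_ge0//; lra.
rewrite /force subr0.
have : beta^-1 * atanh m <= beta^-1 * (m / (1 - m)) by rewrite ler_wpM2l// ltW.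
suff : beta^-1 * (m / (1 - m)) < m by lra.
rewrite mulrCA -[ltRHS]mulr1 ltr_pM2l// ltr_pdivrMr; last by lra.
by move: me; rewrite /well_edge; lra.
Qed.

(** The first bound keeps the saddle well above the left minimum; the second
    one keeps the force positive at [- well_edge], which places this point
    between the left minimum and the saddle. *)
Definition field_bound : R :=
  Num.min ((free_energy beta 0 0 - free_energy beta 0 well_edge) / 4)
    (- force beta 0 well_edge).

Lemma field_bound_gt0 : 0 < field_bound.
Proof.
have /andP[e0 e1] := well_edge_gt0.
rewrite /field_bound lt_min oppr_gt0 force_lt0 ?e0 ?lexx// andbT divr_gt0//.
rewrite subr_gt0; apply: free_energy_decr => // z /andP[z0 ze].
by rewrite force_lt0// z0 ltW.
Qed.

End ZeroField.

Section DoubleWell.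
Context {R : realType}.
Variables (beta h mm ms mp : R).
Hypotheses (beta1 : 1 < beta) (h0 : 0 < h) (hb : h < field_bound beta).
Hypothesis dw : double_well beta h mm ms mp.
Local Notation f := (free_energy beta h).
Local Notation g := (force beta h).

Lemma wells_ordered : [/\ -1 < mm, mm < ms, ms < mp & mp < 1].
Proof. by have [+ [r1 r2] _ _ _ _ _] := dw; move=> /andP[]. Qed.

Let force_eq0 m : -1 < m < 1 -> g m = 0 -> m \in [:: mm; ms; mp].
Proof.
move=> m1 gm; have crit := double_well_critical dw.
by apply/(crit m m1); rewrite free_energy_derive1.
Qed.

Let force_well m : m \in [:: mm; ms; mp] -> g m = 0.
Proof.
have [w1 w2 w3 w4] := wells_ordered; have crit := double_well_critical dw.
move=> mw; have m1 : -1 < m < 1.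
  by move: mw; rewrite !inE => /or3P[]/eqP->; apply/andP; split; lra.
by rewrite -free_energy_derive1//; apply/(crit m m1).
Qed.

Let sign_between u v m : -1 < u -> v < 1 -> u < m < v ->
  (forall z, u < z < v -> z \notin [:: mm; ms; mp]) ->
  forall z, u < z < v -> (0 < g z) = (0 < g m).
Proof.
move=> u1 v1 /andP[um mv] nw z /andP[uz zv].
have nz y : u < y < v -> g y != 0.
  move=> /andP[uy yv]; apply/eqP => gy.
  have yI : u < y < v by rewrite uy yv.
  by apply/(negP (nw y yI))/force_eq0 => //; apply/andP; split; lra.
have [zm|mz] := leP z m; last apply/esym; apply: force_sign; try lra.
  by move=> y /andP[y1 y2]; apply: nz; apply/andP; split; lra.
by move=> y /andP[y1 y2]; apply: nz; apply/andP; split; lra.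
Qed.

Lemma global_min m : -1 <= m <= 1 -> f mp <= f m.
Proof.
have gm := double_well_global dw; move=> m1.
by have [->|/gm] := eqVneq m mp; rewrite ?lexx// => /(_ m1)/ltW.
Qed.

Let near_left_well u v : u < mm < v ->
  exists2 e, 0 < e & forall m, mm - e < m < mm + e -> u < m < v /\ f mm <= f m.
Proof.
move=> /andP[um mv]; have lmin := double_well_min dw.
have /nbhs_ballP[e /= e0 eP] := lmin.
set E := Num.min e (Num.min (mm - u) (v - mm)).
have [E1 E2 E3] : [/\ E <= e, E <= mm - u & E <= v - mm].
  by split; rewrite /E !ge_min lexx ?orbT.
exists E; first by rewrite /E !lt_min e0 !subr_gt0 um mv.
move=> m /andP[A B]; split; first by apply/andP; split; lra.
by apply: eP; rewrite /ball /= ltr_norml; apply/andP; split; lra.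
Qed.

(** The force has a constant sign between consecutive critical points, and the
    wrong sign would contradict the local minimality of [mm]. *)
Lemma force_rising m : mm < m < ms -> 0 < g m.
Proof.
have [w1 w2 w3 w4] := wells_ordered.
move=> mI; rewrite ltNge; apply/negP => gm0.
have neg z : mm < z < ms -> g z < 0.
  move=> zI; have : ~~ (0 < g z).
    rewrite (sign_between (u := mm) (v := ms) (m := m))// -?leNgt//; try lra.
    by move=> y /andP[y1 y2]; rewrite !inE !negb_or !neq_lt; apply/and3P; split; apply/orP; [right|left|left]; lra.
  rewrite -leNgt le_eqVlt => /orP[/eqP gz|//].
  have : z \in [:: mm; ms; mp] by apply: force_eq0 => //; apply/andP; split; lra.
  by rewrite !inE => /or3P[]/eqP zE; move: zI; rewrite zE => /andP[]; lra.
have [|e e0 eP] := @near_left_well (-1) ms; first by rewrite w1.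
have [|/andP[_ z1] z2] := eP (mm + e / 2); first by apply/andP; split; lra.
suff : f (mm + e / 2) < f mm by rewrite ltNge z2.
apply: free_energy_decr; try lra.
by move=> z /andP[za zb]; apply: neg; apply/andP; split; lra.
Qed.

(** The wrong sign would make [f ms] smaller than the global minimum. *)
Lemma force_falling m : ms < m < mp -> g m < 0.
Proof.
have [w1 w2 w3 w4] := wells_ordered.
have nw y : ms < y < mp -> y \notin [:: mm; ms; mp].
  by move=> /andP[y1 y2]; rewrite !inE !negb_or !neq_lt; apply/and3P; split; apply/orP; [right|right|left]; lra.
move=> mI; rewrite ltNge; apply/negP; rewrite le_eqVlt => /orP[/eqP gm|gm].
  apply/(negP (nw m mI))/force_eq0 => //.
  by move: mI => /andP[]; move=> *; apply/andP; split; lra.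
have pos z : ms < z < mp -> 0 < g z.
  by move=> zI; rewrite (sign_between (u := ms) (v := mp) (m := m))//; lra.
have : f ms < f mp by apply: free_energy_incr => //; lra.
by rewrite ltNge global_min//; apply/andP; split; lra.
Qed.

Lemma force_left m : -1 < m < mm -> g m < 0.
Proof.
have [w1 w2 w3 w4] := wells_ordered.
have nw y : -1 < y < mm -> y \notin [:: mm; ms; mp].
  by move=> /andP[y1 y2]; rewrite !inE !negb_or !neq_lt; apply/and3P; split; apply/orP; left; lra.
move=> /andP[m1 m2]; rewrite ltNge; apply/negP; rewrite le_eqVlt => /orP[/eqP gm|gm].
  have mI : -1 < m < mm by rewrite m1 m2.
  by apply/(negP (nw m mI))/force_eq0 => //; apply/andP; split; lra.
have [|e e0 eP] := @near_left_well m 1; first by apply/andP; split; lra.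
have [|/andP[z1 _] z2] := eP (mm - e / 2); first by apply/andP; split; lra.
suff : f (mm - e / 2) < f mm by rewrite ltNge z2.
apply: free_energy_incr; try lra.
move=> z /andP[za zb].
pose u := (m - 1) / 2.
have u1 : -1 < u by rewrite /u; lra.
have mI : u < m < mm by rewrite /u; apply/andP; split; lra.
have zI : u < z < mm by rewrite /u; apply/andP; split; lra.
have m1' : mm < 1 by lra.
rewrite (sign_between u1 m1' mI _ zI)// => y /andP[ya yb].
by apply: nw; apply/andP; split; lra.
Qed.

Lemma rising x y : mm <= x -> x <= y -> y <= ms -> f x <= f y.
Proof.
have [w1 w2 w3 w4] := wells_ordered.
move=> mx; rewrite le_eqVlt => /orP[/eqP ->//|xy] ys; apply/ltW.
apply: free_energy_incr; try lra.
by move=> z /andP[z1 z2]; apply: force_rising; apply/andP; split; lra.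
Qed.

Lemma falling x y : ms <= x -> x <= y -> y <= mp -> f y <= f x.
Proof.
have [w1 w2 w3 w4] := wells_ordered.
move=> mx; rewrite le_eqVlt => /orP[/eqP ->//|xy] ys; apply/ltW.
apply: free_energy_decr; try lra.
by move=> z /andP[z1 z2]; apply: force_falling; apply/andP; split; lra.
Qed.

Lemma left_well_min x : -1 < x -> x <= ms -> f mm <= f x.
Proof.
have [w1 w2 w3 w4] := wells_ordered.
move=> x1 xs; have [xm|mx] := ltP x mm; last exact: rising.
apply/ltW/free_energy_decr; try lra.
by move=> z /andP[z1 z2]; apply: force_left; apply/andP; split; lra.
Qed.

(** The left minimum exceeds the right one by at most [2 h], because
    [f (- mp) = f mp + 2 h mp] and [- mp] lies in the left well; and it is below
    the saddle by at least [f_0 0 - f_0 well_edge - h], where [f_0] is the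
    zero-field free energy. *)
Lemma barrier_high : 2 * f mm < f mp + f ms.
Proof.
have [w1 w2 w3 w4] := wells_ordered.
have hpos : 0 < h := h0.
pose d := well_edge beta.
have /andP[d0 d1] : 0 < d < 1 by exact: well_edge_gt0.
move: hb; rewrite /field_bound lt_min -/d => /andP[hb1 hb2].
have gneg m : 0 <= m -> m <= d -> g m < 0.
  move=> m0 md; rewrite forceE; move: m0; rewrite le_eqVlt => /orP[/eqP <-|m0].
    by rewrite force0 sub0r oppr_lt0.
  have : force beta 0 m < 0 by apply: force_lt0 => //; rewrite m0.
  by lra.
have gd : 0 < g (- d) by rewrite forceE forceN; lra.
have mp0 : 0 < mp.
  rewrite ltNge; apply/negP; rewrite le_eqVlt => /orP[/eqP mp0|mp0].
    have : g mp < 0 by apply: gneg; rewrite mp0 ?lexx// ltW.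
    by rewrite force_well ?ltxx// !inE eqxx !orbT.
  have := @global_min (- mp); rewrite !(free_energyE beta h) free_energyN.
  have : h * mp < 0 by rewrite pmulr_rlt0.
  move=> hm /(_ _); rewrite mulrN.
  have -> : -1 <= - mp <= 1 by apply/andP; split; lra.
  by move=> /(_ isT); lra.
have mpd : d < mp.
  rewrite ltNge; apply/negP => mpd.
  by have := gneg mp (ltW mp0) mpd; rewrite force_well ?ltxx// !inE eqxx !orbT.
have gwell m : g m != 0 -> [/\ m != mm, m != ms & m != mp].
  by move=> gm; split; apply/eqP => mE; move: gm; rewrite mE force_well ?eqxx// !inE eqxx ?orbT.
have [n1 n2 n3] : [/\ - d != mm, - d != ms & - d != mp] by apply: gwell; rewrite gt_eqF.
have dI : mm < - d < ms.
  apply/andP; split.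
    rewrite lt_neqAle eq_sym n1 /= leNgt; apply/negP => dm.
    have : g (- d) < 0 by apply: force_left; apply/andP; split; lra.
    by lra.
  rewrite lt_neqAle n2 /= leNgt; apply/negP => dm.
  have : g (- d) < 0 by apply: force_falling; apply/andP; split; lra.
  by lra.
case/andP: dI => dI1 dI2.
have g00 : g 0 < 0 by apply: gneg => //; exact: ltW.
have ms0 : ms < 0.
  have [_ k2 _] : [/\ 0 != mm, 0 != ms & 0 != mp] by apply: gwell; rewrite lt_eqF.
  rewrite lt_neqAle eq_sym k2 /= leNgt; apply/negP => ms0.
  have : 0 < g 0 by apply: force_rising; apply/andP; split; lra.
  by lra.
have b1 : f 0 <= f ms by apply: falling; lra.
have b2 : f mm <= f (- d) by apply: left_well_min; lra.
have b3 : f mm <= f (- mp) by apply: left_well_min; lra.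
move: b1 b2 b3; rewrite !(free_energyE beta h) !free_energyN.
have hd : h * d < h by rewrite gtr_pMr.
have hmp : h * mp < h by rewrite gtr_pMr.
by rewrite !mulrN mulr0; lra.
Qed.

End DoubleWell.

(** * Sharpness of the potential *)

Section BinomialEntropy.
Local Open Scope nat_scope.
Variables (N k : nat).
Hypothesis kN : k <= N.

(** Proportional to the binomial distribution of parameter [k / N], whose mode
    is [k]. *)
Definition binomial_term (j : nat) : nat := 'C(N, j) * (k ^ j * (N - k) ^ (N - j)).

Lemma binomial_termS j : j < N ->
  binomial_term j.+1 * (j.+1 * (N - k)) = binomial_term j * ((N - j) * k).
Proof.
move=> jN; rewrite /binomial_term.
have -> : N - j = (N - j.+1).+1 by rewrite subnSK.
have E := mul_bin_left N j; have E' : N - j = (N - j.+1).+1 by rewrite subnSK.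
rewrite E' in E; rewrite !expnS; move: E.
move: ('C(N, j.+1)) ('C(N, j)) (k ^ j) (N - j.+1) (N - k) => A B K M X.
move: (X ^ M) => L E; transitivity ((j.+1 * A) * (k * K * (X * L))).
  by ring.
by rewrite E; ring.
Qed.

Lemma binomial_mode_up j i : j + i <= k -> binomial_term j <= binomial_term (j + i).
Proof.
elim: i => [|i IH]; first by rewrite addn0.
rewrite addnS => ji; apply: leq_trans (IH (ltnW ji)) _.
have iN : j + i < N by exact: leq_trans ji kN.
have := binomial_termS iN; move: (j + i) ji iN => m mk mN E.
have [NE|Nk] := eqVneq (N - k) 0.
  have -> : binomial_term m = 0; last by [].
  by rewrite /binomial_term NE exp0n ?muln0// subn_gt0.
have le : m.+1 * (N - k) <= (N - m) * k.
  by rewrite mulnC; apply: leq_mul => //; lia.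
have pos : 0 < m.+1 * (N - k) by rewrite muln_gt0 /= lt0n.
rewrite -(leq_pmul2r pos) E; exact: leq_mul.
Qed.

Lemma binomial_mode_down i : k + i <= N -> binomial_term (k + i) <= binomial_term k.
Proof.
elim: i => [|i IH]; first by rewrite addn0.
rewrite addnS => iN; apply: leq_trans (IH (ltnW iN)).
have := binomial_termS iN => E.
have pos : 0 < (k + i).+1 * (N - k) by rewrite muln_gt0 /=; lia.
rewrite -(leq_pmul2r pos) E; apply: leq_mul => //.
by rewrite [leqRHS]mulnC; apply: leq_mul; lia.
Qed.

Lemma binomial_sum : \sum_(j < N.+1) binomial_term j = N ^ N.
Proof.
rewrite -[X in _ = X ^ _](subnK kN) expnDn; apply: eq_bigr => j _.
by rewrite /binomial_term; congr (_ * _); rewrite mulnC.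
Qed.

Lemma binomial_term_le : binomial_term k <= N ^ N.
Proof.
have kN' : k < N.+1 by [].
by rewrite -binomial_sum (bigD1 (Ordinal kN')) //= leq_addr.
Qed.

(** The mode is at least the average of the [N + 1] terms. *)
Lemma binomial_term_ge : N ^ N <= N.+1 * binomial_term k.
Proof.
rewrite -binomial_sum -[N.+1 in leqRHS]card_ord -sum_nat_const.
apply: leq_sum => j _; case: (leqP j k) => jk.
  by rewrite -[in leqRHS](subnKC jk); apply: binomial_mode_up; rewrite subnKC.
rewrite -(subnKC (ltnW jk)); apply: binomial_mode_down.
by rewrite subnKC ?(ltnW jk)// -ltnS.
Qed.

End BinomialEntropy.

Section WeightBounds.
Context {R : realType}.
Variables (beta h : R) (N : nat).
Hypotheses (b0 : 0 < beta) (N0 : (0 < N)%N).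

Lemma expR_xlnx (k : nat) : expR (k%:R * ln (k%:R / N%:R)) = (k%:R / N%:R) ^+ k :> R.
Proof.
case: k => [|k]; first by rewrite mul0r expR0 expr0.
by rewrite expRM_natl lnK// posrE divr_gt0// ltr0n.
Qed.

Lemma expR_entropy k : (k <= N)%N ->
  expR (- N%:R * entropy (grid R N k)) * (k ^ k * (N - k) ^ (N - k))%:R = (N ^ N)%:R.
Proof.
move=> kN; have N1 : N%:R != 0 :> R by rewrite pnatr_eq0 -lt0n.
have up : (1 - grid R N k) / 2 = (N - k)%:R / N%:R.
  by rewrite natrB// /grid; field.
have down : (1 + grid R N k) / 2 = k%:R / N%:R by rewrite /grid; field.
rewrite /entropy up down.
have -> : - N%:R * ((N - k)%:R / N%:R * ln ((N - k)%:R / N%:R) + k%:R / N%:R * ln (k%:R / N%:R))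
  = - ((N - k)%:R * ln ((N - k)%:R / N%:R) + k%:R * ln (k%:R / N%:R)) :> R by field.
rewrite expRN expRD !expR_xlnx natrM !natrX.
have pow (m : nat) : (m%:R ^+ m) / (m%:R / N%:R) ^+ m = N%:R ^+ m :> R.
  case: m => [|m]; first by rewrite !expr0 divr1.
  by rewrite -expr_div_n invf_div mulrCA divff ?mulr1 ?pnatr_eq0.
rewrite invfM -mulrA [X in _ * X = _](_ : _ = N%:R ^+ k * (N - k)%:R ^+ (N - k)); last first.
  by rewrite -(pow k); ring.
by rewrite mulrCA [X in _ * X = _]mulrC pow -exprD subnKC.
Qed.

(** The binomial coefficient is [e^{- N I(m)}] up to a factor [N + 1]. *)
Lemma cw_weight_bounds k : (k <= N)%N ->
  expR (- beta * N%:R * free_energy beta h (grid R N k)) / N.+1%:R <= cw_weight beta h N k /\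
  cw_weight beta h N k <= expR (- beta * N%:R * free_energy beta h (grid R N k)).
Proof.
move=> kN.
have -> : expR (- beta * N%:R * free_energy beta h (grid R N k)) =
    expR (- N%:R * entropy (grid R N k)) * expR (- beta * level_energy h N k).
  rewrite -expRD; congr expR; rewrite /free_energy /level_energy.
  by field; rewrite gt_eqF.
have up := binomial_term_le kN; have lo := binomial_term_ge kN.
have T0 : (0 < k ^ k * (N - k) ^ (N - k))%N.
  by rewrite muln_gt0 !expn_gt0 !lt0n !orNb.
have T0R : 0 < (k ^ k * (N - k) ^ (N - k))%:R :> R by rewrite ltr0n.
have SE := expR_entropy kN.
rewrite /cw_weight; split; first rewrite mulrAC; apply: ler_wpM2r; rewrite ?expR_ge0//.
  rewrite ler_pdivrMr ?ltr0n// -(ler_pM2r T0R) SE -!natrM ler_nat.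
  by apply: leq_trans lo _; rewrite /binomial_term; apply: eq_leq; ring.
rewrite -(ler_pM2r T0R) SE -natrM ler_nat; exact: up.
Qed.

Lemma level_energy_step k : (k < N)%N -> 0 <= h ->
  `|level_energy h N k.+1 - level_energy h N k| <= 2 * (1 + h).
Proof.
move=> kN h0; have N1 : N%:R != 0 :> R by rewrite pnatr_eq0 -lt0n.
have NR : 0 < N%:R :> R by rewrite ltr0n.
have -> : level_energy h N k.+1 - level_energy h N k =
    2 - 2 * (2 * k%:R + 1) / N%:R - 2 * h.
  rewrite /level_energy /energy /grid -natr1.
  by field.
have kN' : k%:R + 1 <= N%:R :> R by rewrite natr1 ler_nat.
have q1 : (2 * k%:R + 1) / N%:R <= 2 :> R by rewrite ler_pdivrMr//; lra.
have q0 : 0 <= (2 * k%:R + 1) / N%:R :> R by rewrite divr_ge0.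
by rewrite ler_norml -mulrA; apply/andP; split; lra.
Qed.

(** One flip changes the mean-field energy by at most [2 (1 + h)], so a
    conductance is comparable to the weight of either endpoint. *)
Lemma cw_conductance_bounds k : (k < N)%N -> 0 <= h ->
  [/\ cw_conductance beta h N k <= cw_weight beta h N k,
    expR (- (2 * beta * (1 + h))) / N%:R * cw_weight beta h N k <= cw_conductance beta h N k &
    expR (- (2 * beta * (1 + h))) / N%:R * cw_weight beta h N k.+1 <= cw_conductance beta h N k].
Proof.
move=> kN h0; have NR : 0 < N%:R :> R by rewrite ltr0n.
have := level_energy_step kN h0; rewrite ler_norml => /andP[E1 E2].
have cost (x y : R) : y <= x + 2 * (1 + h) ->
    expR (- (2 * beta * (1 + h))) * expR (- beta * x) <= expR (- beta * y).
  move=> xy; rewrite -expRD ler_expR.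
  have : beta * y <= beta * (x + 2 * (1 + h)) by rewrite ler_wpM2l// ltW.
  by rewrite !mulNr; lra.
rewrite /cw_conductance /cw_weight; split.
- apply: ler_pM; rewrite ?expR_ge0//.
    by rewrite /edge_count divr_ge0// mulr_ge0.
    rewrite /edge_count ler_pdivrMr// mulrC ler_wpM2l// ler_nat leq_subr//.
  rewrite ler_expR !mulNr lerN2 ler_wpM2l ?(ltW b0)//.
  by rewrite le_max lexx.
- rewrite [leLHS](_ : _ = 'C(N, k)%:R / N%:R * (expR (- (2 * beta * (1 + h))) *
    expR (- beta * level_energy h N k))); last by ring.
  apply: ler_pM; rewrite ?divr_ge0 ?mulr_ge0 ?expR_ge0//.
    rewrite ler_wpM2r ?invr_ge0 ?(ltW NR)// /edge_count ler_peMl//.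
    by rewrite ler1n subn_gt0.
  by apply: cost; rewrite ge_max; apply/andP; split; lra.
- rewrite [leLHS](_ : _ = 'C(N, k.+1)%:R / N%:R * (expR (- (2 * beta * (1 + h))) *
    expR (- beta * level_energy h N k.+1))); last by ring.
  apply: ler_pM; rewrite ?divr_ge0 ?mulr_ge0 ?expR_ge0//.
    rewrite ler_wpM2r ?invr_ge0 ?(ltW NR)// edge_countE ler_peMl//.
    by rewrite ler1n.
  by apply: cost; rewrite ge_max; apply/andP; split; lra.
Qed.

End WeightBounds.

Section DefectBound.
Context {R : realType}.
Variables (beta h : R) (N a b ks : nat).
Hypotheses (b0 : 0 < beta) (h0 : 0 <= h) (N0 : (0 < N)%N).
Hypotheses (aks : (a <= ks)%N) (ksb : (ks < b)%N) (bN : (b <= N)%N).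
Local Notation F k := (free_energy beta h (grid R N k)).
Local Notation w := (cw_weight beta h N).
Local Notation C := (cw_conductance beta h N).
Variables (low top K : R) (u : nat -> R).
Hypothesis F_left : forall k j, (a <= j < k)%N -> (k <= ks)%N -> F j.+1 <= F k.
Hypothesis F_right : forall k j, (ks < k <= j)%N -> (j < b)%N -> F j <= F k.
Hypothesis F_low : forall k, (k <= N)%N -> low <= F k.
Hypothesis F_top : top <= F ks.
Hypotheses (K0 : 0 <= K) (uprof : profile beta h N a b ks (K ^+ 2) u).

Let cost := expR (2 * beta * (1 + h)).
Let B := K * cost * N.+1%:R * expR (- beta * N%:R * ((top + low) / 2)).

Let NR : 0 < N%:R :> R. Proof. by rewrite ltr0n. Qed.
Let cost1 : 1 <= cost.
Proof. by rewrite /cost -[leLHS]expR0 ler_expR !mulr_ge0 ?ltW// ltr_wpDr. Qed.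

(** The square of the drop across [j] is at most [K^2 C ks / C j], and [C j] is
    at least of the order of [e^{- beta N F k}].  Multiplied by [w k], at most
    [e^{- beta N F k}], the drop is of the order of
    [e^{- beta N (top + F k) / 2}]. *)
Let weighted_drop k i j : (k <= N)%N -> (i <= N)%N -> (a <= j < b)%N ->
  expR (- (2 * beta * (1 + h))) / N%:R * w i <= C j -> F i <= F k ->
  w k * `|u j - u j.+1| <= B.
Proof.
move=> kN iN jab Cj Fik; have [_ _ _ energy] := uprof.
have jN : (j < N)%N by case/andP: jab => _ jb; exact: leq_trans bN.
have ksN : (ks < N)%N by exact: leq_trans bN.
have C0 : 0 < C j by exact: cw_conductance_gt0.
have [wi _] := cw_weight_bounds h b0 N0 iN.
have [_ wk] := cw_weight_bounds h b0 N0 kN.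
have [Cks _ _] := cw_conductance_bounds b0 N0 ksN h0.
have [_ wks] := cw_weight_bounds h b0 N0 (ltnW ksN).
have N1R : 0 < N.+1%:R :> R by rewrite ltr0n.
have cost0 : 0 < cost by exact: expR_gt0.
have w0 : 0 <= w k by rewrite mulr_ge0 ?expR_ge0.
have B0 : 0 <= B by rewrite !mulr_ge0 ?expR_ge0// ltW.
have wd0 : 0 <= w k * `|u j - u j.+1| by rewrite mulr_ge0.
rewrite -(@ler_pXn2r _ 2) ?nnegrE// exprMn real_normK ?num_real//.
have mono (x y : R) : x <= y -> expR (- beta * N%:R * y) <= expR (- beta * N%:R * x).
  move=> xy; rewrite ler_expR !mulNr lerN2 ler_wpM2l// mulr_ge0// ltW//.
have Clow : (cost * N%:R * N.+1%:R)^-1 * expR (- beta * N%:R * F k) <= C j.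
  apply: le_trans Cj.
  apply: (@le_trans _ _ (expR (- (2 * beta * (1 + h))) / N%:R *
     (expR (- beta * N%:R * F i) / N.+1%:R))); last first.
    by rewrite ler_wpM2l// divr_ge0 ?expR_ge0// ltW.
  rewrite expRN -/cost [leRHS](_ : _ = (cost * N%:R * N.+1%:R)^-1 *
    expR (- beta * N%:R * F i)); last by rewrite !invfM; ring.
  by rewrite ler_wpM2l ?invr_ge0 ?mulr_ge0 ?mono// ltW.
have Chigh : C ks <= expR (- beta * N%:R * top).
  by apply: le_trans Cks _; apply: le_trans wks _; exact: mono.
have en : (u j - u j.+1) ^+ 2 <= K ^+ 2 * expR (- beta * N%:R * top) *
    (cost * N%:R * N.+1%:R) * expR (beta * N%:R * F k).
  rewrite -(ler_pM2l C0); apply: le_trans (energy j jab) _.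
  apply: (@le_trans _ _ (K ^+ 2 * expR (- beta * N%:R * top))).
    by rewrite ler_wpM2l ?sqr_ge0.
  rewrite [leLHS](_ : _ =
      (cost * N%:R * N.+1%:R)^-1 * expR (- beta * N%:R * F k) *
      (K ^+ 2 * expR (- beta * N%:R * top) * (cost * N%:R * N.+1%:R) *
       expR (beta * N%:R * F k))); last first.
    rewrite !mulNr (expRN (beta * N%:R * F k)).
    by field; rewrite !gt_eqF ?expR_gt0// !pnatr_eq0 -lt0n N0.
  rewrite ler_wpM2r// !mulr_ge0 ?sqr_ge0 ?expR_ge0// ltW//.
apply: (@le_trans _ _ (expR (- beta * N%:R * F k) ^+ 2 *
   (K ^+ 2 * expR (- beta * N%:R * top) *
    (cost * N%:R * N.+1%:R) * expR (beta * N%:R * F k)))).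
  apply: ler_pM; rewrite ?sqr_ge0//.
  by rewrite ler_pXn2r ?nnegrE ?expR_ge0.
have -> : expR (- beta * N%:R * F k) ^+ 2 *
   (K ^+ 2 * expR (- beta * N%:R * top) *
    (cost * N%:R * N.+1%:R) * expR (beta * N%:R * F k)) =
   K ^+ 2 * (cost * (N%:R * N.+1%:R)) * (expR (- beta * N%:R * top) * expR (- beta * N%:R * F k)).
  rewrite !mulNr (expRN (beta * N%:R * F k)).
  by field; rewrite gt_eqF ?expR_gt0.
have -> : B ^+ 2 = K ^+ 2 * (cost ^+ 2 * (N.+1%:R * N.+1%:R)) *
    (expR (- beta * N%:R * top) * expR (- beta * N%:R * low)).
  rewrite /B !exprMn -[expR (_ * ((top + low) / 2)) ^+ 2]expRM_natl -expRD.
  rewrite (_ : 2%:R * (- beta * N%:R * ((top + low) / 2)) =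
    - beta * N%:R * top + - beta * N%:R * low); last by field.
  by ring.
apply: ler_pM; rewrite ?mulr_ge0 ?sqr_ge0 ?expR_ge0 ?(ltW cost0)//.
  rewrite ler_wpM2l ?sqr_ge0//; apply: ler_pM; rewrite ?mulr_ge0 ?(ltW cost0)//.
    by rewrite expr2 ler_peMl// ltW.
  by rewrite ler_wpM2r// ler_nat.
by rewrite ler_wpM2l ?expR_ge0// mono// F_low.
Qed.

Let sum_drops k m n : (m <= n <= N)%N ->
  (forall j, (m <= j < n)%N -> w k * `|u j - u j.+1| <= B) ->
  w k * `|u m - u n| <= N%:R * B.
Proof.
move=> /andP[mn nN] drop.
have w0 : 0 <= w k by rewrite mulr_ge0 ?expR_ge0.
have cost0 : 0 < cost by exact: expR_gt0.
have B0 : 0 <= B by rewrite !mulr_ge0 ?expR_ge0// ltW.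
have -> : u m - u n = \sum_(m <= j < n) (u j - u j.+1).
  rewrite -opprB -(telescope_sumr u mn) -sumrN.
  by apply: eq_bigr => j _; rewrite opprB.
apply: le_trans (ler_wpM2l w0 (ler_norm_sum _ _ _)) _.
rewrite mulr_sumr; apply: (@le_trans _ _ (\sum_(m <= j < n) B)).
  by rewrite [leLHS]big_nat [leRHS]big_nat; apply: ler_sum => j jmn; exact: drop.
rewrite sumr_const_nat -[leLHS]mulr_natl ler_wpM2r// ler_nat.
by apply: leq_trans nN; exact: leq_subr.
Qed.

(** Climbing back from level [k] to the nearer boundary level, the drops of the
    profile are controlled because the free energy never exceeds [F k]. *)
Lemma step_defect_le : step_defect beta h N ks u <= N.+1%:R * (N%:R * B).
Proof.
have [u01 ua ub energy] := uprof.
rewrite -[N.+1 in leRHS]card_ord mulr_natl -sumr_const.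
apply: ler_sum => k _; have kN : (k <= N)%N by rewrite -ltnS.
have cost0 : 0 < cost by exact: expR_gt0.
have NB0 : 0 <= N%:R * B by rewrite !mulr_ge0 ?expR_ge0// ltW.
have w0 : 0 <= w k by rewrite mulr_ge0 ?expR_ge0.
case: (leqP k ks) => kks.
  have [ka|ak] := leqP k a; first by rewrite ua// subrr mulr0.
  have -> : 1 - u k = u a - u k by rewrite (ua a).
  apply: (@le_trans _ _ (w k * `|u a - u k|)).
    by rewrite ler_wpM2l// ler_norm.
  apply: sum_drops => [|j]; first by rewrite (ltnW ak).
  move=> /andP[aj jk]; have jb : (j < b)%N by exact: leq_trans jk (leq_trans kks (ltnW ksb)).
  have jN : (j < N)%N by exact: leq_trans bN.
  have [_ _ C3] := cw_conductance_bounds b0 N0 jN h0.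
  by apply: (weighted_drop (i := j.+1)) => //; rewrite ?aj// F_left ?aj.
have [bk|kb] := leqP b k; first by rewrite ub ?bk// mulr0.
have -> : u k = u k - u b by rewrite (ub b) ?leqnn// subr0.
apply: (@le_trans _ _ (w k * `|u k - u b|)).
  by rewrite ler_wpM2l// ler_norm.
apply: sum_drops => [|j]; first by rewrite (ltnW kb).
move=> /andP[kj jb]; have jN : (j < N)%N by exact: leq_trans bN.
have [_ C2 _] := cw_conductance_bounds b0 N0 jN h0.
apply: (weighted_drop (i := j)) => //; first exact: ltnW.
  by rewrite jb andbT (leq_trans aks)// (leq_trans (ltnW kks)).
by rewrite F_right// kks.
Qed.

End DefectBound.

Lemma exp_beats_quartic (R : realType) (c t : R) : 0 <= c -> 0 < t ->
  \forall N \near \oo, c * N.+1%:R ^+ 4 <= expR (t * N%:R).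
Proof.
move=> c0 t0; near=> N.
have N1 : 1 <= N%:R :> R by near: N; exact: nbhs_infty_ger.
have Nc : 16 * c / (t / 5) ^+ 5 <= N%:R by near: N; exact: nbhs_infty_ger.
have N0 : 0 < N%:R :> R by apply: lt_le_trans N1.
have s0 : 0 < t / 5 by rewrite divr_gt0.
(* The fifth power of [e^{t N / 5} >= t N / 5] beats the quartic. *)
have -> : t * N%:R = 5%:R * (t / 5 * N%:R) by field.
rewrite expRM_natl; apply: (@le_trans _ _ ((t / 5 * N%:R) ^+ 5)); last first.
  have sN0 : 0 <= t / 5 * N%:R by apply: mulr_ge0 => //; exact: ltW.
  apply: lerXn2r; rewrite ?nnegrE ?expR_ge0//.
  apply: (@le_trans _ _ (1 + t / 5 * N%:R)); first by rewrite lerDr.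
  exact: expR_ge1Dx.
apply: (@le_trans _ _ (16 * c * N%:R ^+ 4)).
  have -> : 16 * c * N%:R ^+ 4 = c * (2 * N%:R) ^+ 4 by ring.
  by rewrite ler_wpM2l// lerXn2r ?nnegrE ?mulr_ge0// -natr1; lra.
rewrite exprMn [in leRHS]exprS [leRHS](_ : _ = (t / 5) ^+ 5 * N%:R * N%:R ^+ 4); last by ring.
rewrite ler_wpM2r ?exprn_ge0//.
by move: Nc; rewrite ler_pdivrMr ?exprn_gt0// [N%:R * _]mulrC.
Unshelve. all: by end_near. Qed.

Section Grid.
Context {R : realType}.

Lemma grid_le N k l : (k <= l)%N -> grid R N k <= grid R N l.
Proof. by move=> kl; rewrite /grid lerD2l ler_wpM2r ?invr_ge0// ler_wpM2l// ler_nat. Qed.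

Lemma grid_lt N k l : (0 < N)%N -> (k < l)%N -> grid R N k < grid R N l.
Proof.
by move=> N0 kl; rewrite /grid ltrD2l ltr_pM2r ?invr_gt0 ?ltr0n// ltr_pM2l// ltr_nat.
Qed.

Lemma grid_le_mono N k l : (0 < N)%N -> (grid R N k <= grid R N l) = (k <= l)%N.
Proof.
move=> N0; apply/idP/idP => [|/grid_le//]; apply: contraTT.
by rewrite -ltnNge -ltNge => /grid_lt ->.
Qed.

Lemma gridS N k : (0 < N)%N -> grid R N k.+1 = grid R N k + 2 / N%:R.
Proof.
move=> N0; have N1 : N%:R != 0 :> R by rewrite pnatr_eq0 -lt0n.
by rewrite /grid -natr1; field.
Qed.

Lemma grid_bounds N k : (k <= N)%N -> -1 <= grid R N k <= 1.
Proof.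
case: N => [|N] kN; first by rewrite /grid invr0 mulr0 addr0 lexx /=; lra.
have N0 : 0 < N.+1%:R :> R by rewrite ltr0n.
have q0 : 0 <= k%:R / N.+1%:R :> R by rewrite divr_ge0.
have q1 : k%:R / N.+1%:R <= 1 :> R by rewrite ler_pdivrMr// mul1r ler_nat.
have -> : grid R N.+1 k = -1 + 2 * (k%:R / N.+1%:R) by rewrite /grid mulrA.
by move: q0 q1; move: (_ / _) => q q0 q1; apply/andP; split; lra.
Qed.

Lemma grid_floor N (x : R) : (0 < N)%N -> -1 <= x < 1 ->
  exists k, [/\ (k < N)%N, grid R N k <= x & x < grid R N k.+1].
Proof.
move=> N0 /andP[x0 x1]; have NR : 0 < N%:R :> R by rewrite ltr0n.
have y0 : 0 <= N%:R * ((1 + x) / 2).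
  by rewrite mulr_ge0 ?(ltW NR)// divr_ge0//; lra.
have /andP[k1 k2] := truncn_itv y0.
set k := Num.truncn _ in k1 k2; exists k; split.
- rewrite -(ltr_nat R); apply: le_lt_trans k1 _.
  by rewrite -[ltRHS]mulr1 ltr_pM2l//; lra.
- have : 2 * k%:R / N%:R <= 1 + x by rewrite ler_pdivrMr//; lra.
  by rewrite /grid; lra.
- have : 1 + x < 2 * k.+1%:R / N%:R by rewrite ltr_pdivlMr//; lra.
  by rewrite /grid; lra.
Qed.

(** A grid point closest to [x] may lie on either side of it, but its two
    neighbours surround [x]. *)
Lemma closest_next N (x : R) (k : 'I_N.+1) : (0 < N)%N -> closest x k ->
  (k < N)%N -> x <= grid R N k.+1.
Proof.
move=> N0 cl kN; rewrite leNgt; apply/negP => kx.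
have kN1 : (k.+1 < N.+1)%N by [].
have := cl (Ordinal kN1); rewrite /gammaN -/(grid R N k) -/(grid R N k.+1) /=.
have lt := grid_lt N0 (ltnSn k).
by rewrite !ler0_norm; lra.
Qed.

Lemma closest_prev N (x : R) (k : 'I_N.+1) j : (0 < N)%N -> closest x k ->
  (j < k)%N -> grid R N j <= x.
Proof.
move=> N0 cl jk; rewrite leNgt; apply/negP => kx.
have jN : (j < N.+1)%N by exact: ltn_trans jk (ltn_ord k).
have := cl (Ordinal jN); rewrite /gammaN -/(grid R N k) -/(grid R N j) /=.
have lt := grid_lt N0 jk.
by rewrite !ger0_norm; lra.
Qed.

Lemma closest_dist N (x : R) (k : 'I_N.+1) : (0 < N)%N -> -1 <= x < 1 ->
  closest x k -> `|grid R N k - x| <= 2 / N%:R.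
Proof.
move=> N0 x1 cl; have [j [jN j1 j2]] := grid_floor N0 x1.
have jN' : (j < N.+1)%N by exact: ltnW.
apply: le_trans (cl (Ordinal jN')) _; rewrite /gammaN -/(grid R N j) /=.
by move: j2; rewrite gridS// => j2; rewrite ler0_norm; lra.
Qed.

Lemma near_grid (e : R) : 0 < e -> \forall N \near \oo, 2 / N%:R < e.
Proof.
move=> e0; near=> N.
have Ne : 2 / e < N%:R by near: N; exact: nbhs_infty_gtr.
have N0 : 0 < N%:R :> R by apply: lt_trans Ne; rewrite divr_gt0.
by rewrite ltr_pdivrMr// mulrC -ltr_pdivrMr.
Unshelve. all: by end_near. Qed.

End Grid.

Section DefectSmall.
Context {R : realType}.
Variables (beta h mm ms mp : R).
Hypotheses (beta1 : 1 < beta) (h0 : 0 < h) (hb : h < field_bound beta).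
Hypothesis dw : double_well beta h mm ms mp.
Local Notation f := (free_energy beta h).

Definition well_gap : R := (f ms + f mp) / 2 - f mm.

Lemma well_gap_gt0 : 0 < well_gap.
Proof. by have := barrier_high beta1 h0 hb dw; rewrite /well_gap; lra. Qed.

Lemma free_energy_modulus (x e : R) : -1 < x < 1 -> 0 < e ->
  exists2 d : R, 0 < d & forall y, `|y - x| < d -> `|f y - f x| < e.
Proof.
move=> x1 e0; have /cvgrPdist_lt/(_ _ e0) := @free_energy_continuous R beta h x x1.
move=> /nbhs_ballP[d /= d0 dP]; exists d => // y yx.
by rewrite distrC; apply: dP; rewrite /ball /= distrC.
Qed.

(** The defect is of the order of [e^{- beta N (f ms + f mp) / 2}] and the left
    mass of the order of [e^{- beta N f mm}].  The disorder and the continuity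
    of [f] cost [9/2] times a ninth of the gap between the two exponents; the
    remaining half of the gap beats the polynomial factors. *)
Lemma defect_small (km kp : forall N : nat, 'I_N.+1) :
  (forall N, closest mm (km N)) -> (forall N, closest mp (kp N)) ->
  \forall N \near \oo, exists ks, [/\ (0 < N)%N, (km N <= ks)%N, (ks < kp N)%N &
    forall u, profile beta h N (km N) (kp N) ks
      (4 * expR (2 * beta * (well_gap / 9) * N%:R)) u ->
    4 * (expR (2 * beta * (well_gap / 9) * N%:R) * step_defect beta h N ks u) <=
    left_mass beta h N ks].
Proof.
move=> ckm ckp.
have b0 : 0 < beta by exact: lt_trans beta1.
have [w1 w2 w3 w4] := wells_ordered dw.
have g0 := well_gap_gt0; set e := well_gap / 9.
have e0 : 0 < e by rewrite divr_gt0.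
have mmI : -1 < mm < 1 by apply/andP; split; lra.
have msI : -1 < ms < 1 by apply/andP; split; lra.
have [d1 d10 d1P] := free_energy_modulus mmI e0.
have [d2 d20 d2P] := free_energy_modulus msI e0.
pose d := Num.min (Num.min d1 d2) (Num.min (ms - mm) (mp - ms)).
have d0 : 0 < d by rewrite /d !lt_min d10 d20 !subr_gt0 w2 w3.
have [dd1 dd2 dd3 dd4] : [/\ d <= d1, d <= d2, d <= ms - mm & d <= mp - ms].
  by split; rewrite /d !ge_min lexx ?orbT.
near=> N.
have N0 : (0 < N)%N by near: N; exact: nbhs_infty_gt.
have Nd : 2 / N%:R < d by near: N; exact: near_grid.
have poly : 8 * expR (2 * beta * (1 + h)) * N.+1%:R ^+ 4 <=
    expR (beta * well_gap / 2 * N%:R).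
  near: N; apply: exp_beats_quartic; first by rewrite mulr_ge0 ?expR_ge0.
  by rewrite divr_gt0// mulr_gt0.
have msI' : -1 <= ms < 1 by apply/andP; split; lra.
have mmI' : -1 <= mm < 1 by apply/andP; split; lra.
have mpI' : -1 <= mp < 1 by apply/andP; split; lra.
have [ks [ksN ks1 ks2]] := grid_floor N0 msI'.
have am := closest_dist N0 mmI' (ckm N).
have bp := closest_dist N0 mpI' (ckp N).
have NR : 0 < N%:R :> R by rewrite ltr0n.
have n0 : 0 < 2 / N%:R :> R by rewrite divr_gt0.
have aks : (km N <= ks)%N.
  rewrite -ltnS ltnNge -(@grid_le_mono R _ _ _ N0) -ltNge; apply: le_lt_trans _ ks2.
  by move: am; rewrite ler_norml => /andP[_ ?]; lra.
have ksb : (ks < kp N)%N.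
  rewrite ltnNge -(@grid_le_mono R _ _ _ N0) -ltNge; apply: le_lt_trans ks1 _.
  by move: bp; rewrite ler_norml => /andP[? _]; lra.
have bN : (kp N <= N)%N by rewrite -ltnS.
exists ks; split=> // u.
set E := expR (2 * beta * e * N%:R); set K := 2 * expR (beta * e * N%:R).
have EE : 4 * E = K ^+ 2.
  rewrite /K exprMn -expRM_natl (_ : 2%:R * _ = 2 * beta * e * N%:R); last by ring.
  by congr (_ * _); ring.
rewrite EE => uprof.
have ksmod : f ms - e <= f (grid R N ks).
  have : `|f (grid R N ks) - f ms| < e.
    by apply: d2P; move: ks2; rewrite gridS// => ks2; rewrite ler0_norm; lra.
  by rewrite ltr_norml => /andP[]; lra.
have kmmod : f (grid R N (km N)) <= f mm + e.
  have : `|f (grid R N (km N)) - f mm| < e by apply: d1P; lra.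
  by rewrite ltr_norml => /andP[]; lra.
have [Zlow _] := cw_weight_bounds h b0 N0 (leq_trans aks (ltnW ksN)).
have Z1 : cw_weight beta h N (km N) <= left_mass beta h N ks.
  rewrite /left_mass (bigD1 (km N))//= lerDl sumr_ge0// => k _.
  exact/ltW/cw_weight_gt0.
apply: le_trans Z1; apply: le_trans Zlow.
apply: (@le_trans _ _ (4 * (E * (N.+1%:R * (N%:R * (K *
   expR (2 * beta * (1 + h)) * N.+1%:R *
   expR (- beta * N%:R * ((f ms - e + f mp) / 2)))))))).
  rewrite ler_wpM2l// ler_wpM2l ?expR_ge0//.
  apply: (@step_defect_le R beta h N (km N) (kp N) ks b0 (ltW h0) N0 aks ksb
    bN (f mp) (f ms - e) K u _ _ _ ksmod _ uprof).
  - move=> k j /andP[aj jk] kks; apply: (rising dw).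
    + apply: le_trans (closest_next N0 (ckm N) _) _.
        by apply: leq_ltn_trans aj _; apply: leq_trans jk (leq_trans kks (ltnW ksN)).
      by rewrite grid_le// ltnS.
    + exact: grid_le.
    + by apply: le_trans ks1; exact: grid_le.
  - move=> k j /andP[ksk kj] jb; apply: (falling dw).
    + by apply: ltW; apply: lt_le_trans ks2 _; exact: grid_le.
    + exact: grid_le.
    + exact: closest_prev (ckp N) jb.
  - by move=> k kN; apply: (global_min dw); exact: grid_bounds.
  - by rewrite mulr_ge0 ?expR_ge0.
rewrite ler_pdivlMr ?ltr0n//.
set c := expR (2 * beta * (1 + h)) in poly *.
have c0 : 0 < c by exact: expR_gt0.
have N1 : 0 < N.+1%:R :> R by rewrite ltr0n.
apply: (@le_trans _ _ (expR (beta * well_gap / 2 * N%:R) *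
   (E * expR (beta * e * N%:R) * expR (- beta * N%:R * ((f ms - e + f mp) / 2))))).
  rewrite [leLHS](_ : _ = (8 * c * (N%:R * N.+1%:R ^+ 3)) *
   (E * expR (beta * e * N%:R) * expR (- beta * N%:R * ((f ms - e + f mp) / 2)))); last first.
    by rewrite /K; ring.
  rewrite ler_wpM2r ?mulr_ge0 ?expR_ge0//; apply: le_trans poly.
  rewrite ler_wpM2l ?mulr_ge0 ?(ltW c0)// exprS ler_wpM2r ?exprn_ge0 ?(ltW N1)//.
  by rewrite ler_nat.
rewrite /E -!expRD ler_expR.
have -> : beta * well_gap / 2 * N%:R + (2 * beta * e * N%:R + beta * e * N%:R +
   - beta * N%:R * ((f ms - e + f mp) / 2)) =
   beta * N%:R * (well_gap / 2 + 3 * e - (f ms - e + f mp) / 2) by field.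
rewrite mulNr mulNr -mulrN ler_wpM2l ?mulr_ge0 ?(ltW b0)//.
by move: kmmod; rewrite /e /well_gap; lra.
Unshelve. all: by end_near. Qed.

End DefectSmall.

(** * Concentration of the disorder *)

Section CentredDisorder.
Context {R : realType}.
Variable N : nat.

Lemma sum_edges (F : 'I_N * 'I_N -> R) :
  \sum_(e : edge N) F (val e) = \sum_(q : 'I_N * 'I_N | (q.1 < q.2)%N) F q.
Proof.
rewrite (reindex_omap (val : edge N -> 'I_N * 'I_N) insub) /=; last first.
  by move=> q qlt; rewrite insubT.
by apply: eq_bigl => e; rewrite (valP e) valK eqxx.
Qed.

Lemma sum_edges_square (s : 'I_N -> R) :
  (\sum_i s i) ^+ 2 = \sum_i s i ^+ 2 +
    2 * \sum_(e : edge N) s (val e).1 * s (val e).2.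
Proof.
rewrite (sum_edges (fun q => s q.1 * s q.2)) -(pair_big_dep xpredT
  (fun i j : 'I_N => (i < j)%N) (fun i j => s i * s j)) /=.
pose U := \sum_i s i ^+ 2; rewrite -/U.
pose V := \sum_(i : 'I_N) \sum_(j : 'I_N | (i < j)%N) s i * s j; rewrite -/V.
have VE : V = \sum_(i : 'I_N) \sum_(j : 'I_N | (j < i)%N) s i * s j.
  rewrite /V (exchange_big_dep xpredT)//=.
  by apply: eq_bigr => i _; apply: eq_bigr => j _; rewrite mulrC.
have -> : U + 2 * V = U + V + V by ring.
rewrite {2}VE /U /V -!big_split expr2 mulr_suml /=; apply: eq_bigr => i _.
rewrite mulr_sumr (bigD1 i)//= -expr2 -addrA; congr (_ + _).
rewrite (bigID (fun j : 'I_N => (i < j)%N)) /=; congr (_ + _).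
  by apply: eq_bigl => j; case: ltngtP => ij; rewrite ?andbF// andbT -(inj_eq val_inj) neq_ltn ij orbT.
by apply: eq_bigl => j; rewrite -leqNgt -(inj_eq val_inj) -ltn_neqAle.
Qed.

Lemma card_edge_le : #|{: edge N}|%:R <= N%:R ^+ 2 / 2 :> R.
Proof.
have := sum_edges_square (fun=> 1 : R).
have -> : \sum_(e : edge N) 1 * 1 = #|{: edge N}|%:R :> R.
  by rewrite mulr1 sumr_const.
rewrite !sumr_const card_ord expr1n => E.
by rewrite ler_pdivlMr// mulrC E lerDr.
Qed.

Variables (p h : R).
Hypotheses (N0 : (0 < N)%N) (p0 : 0 < p).

(** The diagonal terms in the square of the magnetisation sum up to the
    constant 1/2. *)
Lemma disorder_centred (J : coupling N) x : disorder p h J x =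
  \sum_(e : edge N) - ((N%:R * p)^-1 * (spin x (val e).1 * spin x (val e).2))
    * ((J e)%:R - p).
Proof.
have N1 : N%:R != 0 :> R by rewrite pnatr_eq0 -lt0n.
have p1 : p != 0 by rewrite gt_eqF.
rewrite /disorder /level_energy -(@magnetisationE R N N0 x) /magnetisation /energy.
rewrite /hamiltonian.
set S := \sum_(i < N) spin x i.
have SE : S ^+ 2 = N%:R + 2 * \sum_(e : edge N) spin x (val e).1 * spin x (val e).2.
  rewrite /S sum_edges_square; congr (_ + _).
  rewrite (eq_bigr (fun=> 1)) ?sumr_const ?card_ord// => i _.
  by rewrite /spin; case: (x i); rewrite ?sqrrN expr1n.
set T := \sum_(e : edge N) spin x (val e).1 * spin x (val e).2 in SE.
set L := \sum_(e : edge N) (J e)%:R * spin x (val e).1 * spin x (val e).2.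
have -> : \sum_(e : edge N) - ((N%:R * p)^-1 * (spin x (val e).1 * spin x (val e).2))
    * ((J e)%:R - p) = - (N%:R * p)^-1 * L + (N%:R)^-1 * T.
  rewrite /L /T !mulr_sumr -big_split /=; apply: eq_bigr => e _.
  by field; rewrite N1.
have -> : N%:R * (- ((N%:R^-1 * S) ^+ 2 / 2) - h * (N%:R^-1 * S)) =
    - (S ^+ 2) / N%:R / 2 - h * S by field.
by rewrite SE; field; rewrite N1.
Qed.

End CentredDisorder.

Lemma expR_quadratic (R : realType) (x : R) : `|x| <= 2^-1 ->
  expR x <= 1 + x + 2 * x ^+ 2.
Proof.
rewrite ler_norml => /andP[x1 x2].
have y0 : 0 < 1 - x by lra.
have le : expR x <= (1 - x)^-1.
  rewrite -[x in expR x]opprK expRN lef_pV2 ?posrE ?expR_gt0//.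
  exact: expR_ge1Dx.
apply: le_trans le _; rewrite -[leLHS]mul1r ler_pdivrMr//.
have -> : (1 + x + 2 * x ^+ 2) * (1 - x) = 1 + x ^+ 2 * (1 - 2 * x) by ring.
by rewrite lerDl mulr_ge0 ?sqr_ge0//; lra.
Qed.

Section Concentration.
Context {R : realType}.
Variables (p h : R) (N : nat).
Hypotheses (p01 : 0 < p < 1) (N0 : (0 < N)%N).
Local Notation coup := (coupling N).

Definition coupling_mass (J : coup) : R := \prod_(e : edge N) bernoulli_pmf p (J e).

Definition coupling_mean (F : coup -> R) : R := \sum_J coupling_mass J * F J.

Lemma coupling_mass_ge0 J : 0 <= coupling_mass J.
Proof.
apply: prodr_ge0 => e _; apply: bernoulli_pmf_ge0.
by case/andP: p01 => *; rewrite !ltW.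
Qed.

(** Independence of the couplings. *)
Lemma coupling_mean_prod (G : edge N -> bool -> R) :
  coupling_mean (fun J => \prod_e G e (J e)) =
  \prod_e (p * G e true + (1 - p) * G e false).
Proof.
rewrite /coupling_mean /coupling_mass.
transitivity (\sum_(J : coup) \prod_(e : edge N)
    (bernoulli_pmf p (J e) * G e (J e))).
  by apply: eq_bigr => J _; rewrite big_split.
rewrite -(bigA_distr_bigA (fun e b => bernoulli_pmf p b * G e b)) /=.
by apply: eq_bigr => e _; rewrite big_bool.
Qed.

Lemma coupling_mean1 : coupling_mean (fun=> 1) = 1.
Proof.
transitivity (coupling_mean (fun J => \prod_(e : edge N) 1)).
  by apply: eq_bigr => J _; rewrite big1.
by rewrite (coupling_mean_prod (fun _ _ => 1)) big1// => e _; ring.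
Qed.

Lemma ler_coupling_mean F G : (forall J, F J <= G J) ->
  coupling_mean F <= coupling_mean G.
Proof. by move=> FG; apply: ler_sum => J _; rewrite ler_wpM2l ?coupling_mass_ge0. Qed.

Lemma PJE (A : set coup) : PJ p A = coupling_mean (fun J => `[< A J >]%:R).
Proof.
rewrite /PJ big_mkcond; apply: eq_bigr => J _; rewrite -/(coupling_mass J).
by case: asboolP => _; rewrite ?mulr1 ?mulr0.
Qed.

Lemma PJ_markov (A : set coup) F : (forall J, 0 <= F J) ->
  (forall J, A J -> 1 <= F J) -> PJ p A <= coupling_mean F.
Proof.
move=> F0 F1; rewrite PJE; apply: ler_coupling_mean => J.
by case: asboolP => // /F1.
Qed.

Lemma PJ_subset (A B : set coup) : A `<=` B -> PJ p A <= PJ p B.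
Proof.
move=> AB; rewrite !PJE; apply: ler_coupling_mean => J; rewrite ler_nat.
by case: asboolP => // /AB BJ; case: asboolP.
Qed.

Lemma PJ_setU (A B : set coup) : PJ p (A `|` B) <= PJ p A + PJ p B.
Proof.
rewrite !PJE /coupling_mean -big_split /=; apply: ler_sum => J _.
rewrite -mulrDr ler_wpM2l ?coupling_mass_ge0// -natrD ler_nat.
case: asboolP => // -[AJ|BJ]; last by rewrite (asboolT BJ) addn1.
by rewrite (asboolT AJ).
Qed.

Lemma PJ_setC (A : set coup) : PJ p A = 1 - PJ p (~` A).
Proof.
rewrite !PJE -[X in X - _]coupling_mean1 /coupling_mean -sumrB; apply: eq_bigr => J _.
rewrite -mulrBr; congr (_ * _).
have -> : `[< (~` A) J >] = ~~ `[< A J >] by exact: asbool_neg.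
by case: `[< A J >] => /=; rewrite ?subr0 ?subrr.
Qed.

Local Notation Delta := (disorder p h).

(** The disorder at [x] is a sum of independent centred variables, hence
    sub-Gaussian with a variance proxy that depends neither on [N] nor on
    [x]. *)
Lemma disorder_mgf (t : R) x : `|t| <= N%:R * p / 2 ->
  coupling_mean (fun J => expR (t * Delta J x)) <= expR (t ^+ 2 / p ^+ 2).
Proof.
case/andP: p01 => p0 p1 tN.
have NR : 0 < N%:R :> R by rewrite ltr0n.
pose c (e : edge N) := - (t * ((N%:R * p)^-1 * (spin x (val e).1 * spin x (val e).2))).
pose G e (b : bool) := expR (c e * (b%:R - p)).
have -> : coupling_mean (fun J => expR (t * Delta J x)) =
    coupling_mean (fun J => \prod_e G e (J e)).
  apply: eq_bigr => J _; congr (_ * _); rewrite (disorder_centred h N0 p0).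
  rewrite -expR_sum mulr_sumr; congr expR; apply: eq_bigr => e _.
  by rewrite /c; ring.
rewrite coupling_mean_prod.
set d := `|t| / (N%:R * p).
have d0 : 0 <= d by rewrite divr_ge0// mulr_ge0// ltW.
have d2 : d <= 2^-1.
  by rewrite /d ler_pdivrMr ?mulr_gt0//; apply: le_trans tN _; rewrite mulrC.
have cE e : `|c e| = d.
  have s1 (i : 'I_N) : `|spin x i| = 1 :> R.
    by rewrite /spin; case: (x i); rewrite ?normrN normr1.
  rewrite /c normrN !normrM !s1 !mulr1 /d; congr (_ * _).
  by rewrite ger0_norm// invr_ge0 mulr_ge0// ltW.
have edge1 e : p * G e true + (1 - p) * G e false <= expR (2 * d ^+ 2).
  have c2 : c e ^+ 2 = d ^+ 2 by rewrite -(cE e) real_normK ?num_real.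
  have bnd (y : R) : `|y| <= 1 -> expR (c e * y) <= 1 + c e * y + 2 * (d ^+ 2 * y ^+ 2).
    move=> y1; rewrite -c2 -exprMn; apply: expR_quadratic.
    by rewrite normrM cE (le_trans _ d2)// ler_piMr.
  have b1 := bnd (1 - p); have b2 := bnd (0 - p).
  rewrite /G /=.
  have {}b1 : expR (c e * (1 - p)) <= 1 + c e * (1 - p) + 2 * (d ^+ 2 * (1 - p) ^+ 2).
    by apply: b1; rewrite ger0_norm; lra.
  have {}b2 : expR (c e * (0 - p)) <= 1 + c e * (0 - p) + 2 * (d ^+ 2 * (0 - p) ^+ 2).
    by apply: b2; rewrite sub0r normrN ger0_norm; lra.
  apply: (@le_trans _ _ (1 + 2 * d ^+ 2)); last exact: expR_ge1Dx.
  have q1 : p * expR (c e * (1 - p)) <= p * (1 + c e * (1 - p) + 2 * (d ^+ 2 * (1 - p) ^+ 2)).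
    by rewrite ler_wpM2l// ltW.
  have q2 : (1 - p) * expR (c e * (0 - p)) <=
      (1 - p) * (1 + c e * (0 - p) + 2 * (d ^+ 2 * (0 - p) ^+ 2)).
    by rewrite ler_wpM2l//; lra.
  apply: (le_trans (lerD q1 q2)).
  have -> : p * (1 + c e * (1 - p) + 2 * (d ^+ 2 * (1 - p) ^+ 2)) +
      (1 - p) * (1 + c e * (0 - p) + 2 * (d ^+ 2 * (0 - p) ^+ 2)) =
      1 + 2 * d ^+ 2 * (p * (1 - p)) by ring.
  rewrite lerD2l; apply: ler_piMr; first by rewrite mulr_ge0 ?sqr_ge0.
  by apply: mulr_ile1; lra.
apply: (@le_trans _ _ (\prod_(e : edge N) expR (2 * d ^+ 2))).
  apply: ler_prod => e _; rewrite edge1 andbT addr_ge0// mulr_ge0 ?expR_ge0//; lra.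
rewrite prodr_const -expRM_natl ler_expR.
apply: (@le_trans _ _ (N%:R ^+ 2 / 2 * (2 * d ^+ 2))).
  apply: ler_wpM2r; first by rewrite mulr_ge0 ?sqr_ge0.
  exact: card_edge_le.
apply: eq_ler.
have -> : t ^+ 2 = `|t| ^+ 2 by rewrite real_normK ?num_real.
by rewrite /d; field; rewrite !gt_eqF.
Qed.

End Concentration.

Lemma bernoulli_inequality (R : realType) (z : R) n : 0 <= z ->
  1 + n%:R * (z - 1) <= z ^+ n.
Proof.
move=> z0; elim: n => [|n IH]; first by rewrite mul0r addr0 expr0.
rewrite exprS; apply: le_trans (ler_wpM2l z0 IH).
rewrite -subr_ge0 -natr1.
have -> : z * (1 + n%:R * (z - 1)) - (1 + (n%:R + 1) * (z - 1)) = n%:R * (z - 1) ^+ 2.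
  by ring.
by rewrite mulr_ge0 ?sqr_ge0.
Qed.

Lemma power_mean (R : realType) (I : finType) (w Y : I -> R) n :
  (forall i, 0 <= w i) -> \sum_i w i = 1 -> (forall i, 0 <= Y i) ->
  (\sum_i w i * Y i) ^+ n <= \sum_i w i * Y i ^+ n.
Proof.
move=> w0 w1 Y0; set X := \sum_i w i * Y i.
have X0 : 0 <= X by apply: sumr_ge0 => i _; rewrite mulr_ge0.
have [XE|Xn0] := eqVneq X 0.
  case: n => [|n]; last first.
    by rewrite XE expr0n /=; apply: sumr_ge0 => i _; rewrite mulr_ge0 ?exprn_ge0.
  by rewrite expr0; under eq_bigr do rewrite expr0 mulr1; rewrite w1.
have -> : X ^+ n = \sum_i w i * (X ^+ n * (1 + n%:R * (Y i / X - 1))).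
  transitivity (\sum_i (X ^+ n * (1 - n%:R) * w i + X ^+ n * n%:R / X * (w i * Y i))).
    by rewrite big_split /= -!mulr_sumr w1 -/X; field.
  by apply: eq_bigr => i _; field.
apply: ler_sum => i _; rewrite ler_wpM2l//.
have -> : Y i ^+ n = X ^+ n * (Y i / X) ^+ n by rewrite -exprMn mulrCA divff ?mulr1.
by rewrite ler_wpM2l ?exprn_ge0// bernoulli_inequality// divr_ge0.
Qed.

Section Tails.
Context {R : realType}.
Variables (p h : R) (N : nat).
Hypotheses (p01 : 0 < p < 1) (N0 : (0 < N)%N).
Local Notation Delta := (disorder p h).

(** Markov's inequality for the [n]-th power, which a convexity argument moves
    inside the average: optimising over [n] gives a Gaussian tail for the
    logarithm of an exponential average. *)
Lemma average_tail (w : config N -> R) (t s : R) (n : nat) :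
  (forall x, 0 <= w x) -> \sum_x w x = 1 ->
  n%:R * `|t| <= N%:R * p / 2 ->
  PJ p [set J : coupling N | expR s < \sum_x w x * expR (t * Delta J x)] <=
  expR (- (n%:R * s) + n%:R ^+ 2 * t ^+ 2 / p ^+ 2).
Proof.
move=> w0 w1 nt.
pose X J := \sum_x w x * expR (t * Delta J x).
have X0 J : 0 <= X J by apply: sumr_ge0 => x _; rewrite mulr_ge0 ?expR_ge0.
pose F J := expR (- (n%:R * s)) * X J ^+ n.
apply: le_trans (@PJ_markov R p N p01 _ F _ _) _.
- by move=> J; rewrite mulr_ge0 ?expR_ge0 ?exprn_ge0.
- move=> J /= sX; rewrite /F expRN expRM_natl mulrC ler_pdivlMr ?exprn_gt0 ?expR_gt0//.
  by rewrite mul1r lerXn2r ?nnegrE ?expR_ge0// ltW.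
apply: (@le_trans _ _ (\sum_x w x * (expR (- (n%:R * s)) *
    coupling_mean p (fun J => expR (n%:R * t * Delta J x))))).
  rewrite /coupling_mean; under [leRHS]eq_bigr do rewrite !mulr_sumr.
  rewrite exchange_big /=; apply: ler_sum => J _; rewrite /F.
  apply: (@le_trans _ _ (coupling_mass p J * (expR (- (n%:R * s)) *
     \sum_x w x * expR (t * Delta J x) ^+ n))).
    rewrite ler_wpM2l ?coupling_mass_ge0// ler_wpM2l ?expR_ge0//.
    by apply: power_mean => // x; exact: expR_ge0.
  rewrite !mulr_sumr; apply: eq_ler; apply: eq_bigr => x _.
  by rewrite -expRM_natl -(mulrA n%:R t); ring.
set V := expR (_ + _).
have -> : V = \sum_x w x * V by rewrite -mulr_suml w1 mul1r.
apply: ler_sum => x _; rewrite /V expRD.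
rewrite ler_wpM2l// ler_wpM2l ?expR_ge0// -exprMn.
by apply: disorder_mgf => //; rewrite normrM (ger0_norm (ler0n R n)).
Qed.

(** A union bound over the [2^N] configurations, with exponential moments of
    order [th N], which the sub-Gaussian bound still covers. *)
Lemma disorder_sup_tail (eps th : R) : 0 <= th -> th <= p / 2 ->
  PJ p [set J : coupling N | exists x, eps * N%:R < `|Delta J x|] <=
  2 * 2 ^+ N * expR (- (th * eps - th ^+ 2 / p ^+ 2) * N%:R ^+ 2).
Proof.
move=> th0 thp.
have NR : 0 < N%:R :> R by rewrite ltr0n.
pose e0 := expR (- (th * N%:R * (eps * N%:R))).
pose F J := \sum_(x : config N) e0 * (expR (th * N%:R * Delta J x) + expR (- (th * N%:R) * Delta J x)).
apply: le_trans (@PJ_markov R p N p01 _ F _ _) _.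
- by move=> J; apply: sumr_ge0 => x _; rewrite mulr_ge0 ?addr_ge0 ?expR_ge0.
- move=> J /= [x xe]; rewrite /F (bigD1 x)//= ler_wpDr//.
    by apply: sumr_ge0 => y _; rewrite mulr_ge0 ?addr_ge0 ?expR_ge0.
  have tN : 0 <= th * N%:R by rewrite mulr_ge0.
  apply: (@le_trans _ _ (e0 * expR (th * N%:R * `|Delta J x|))).
    rewrite /e0 -expRD -[leLHS]expR0 ler_expR addrC subr_ge0 ler_wpM2l//.
    exact: ltW.
  rewrite ler_wpM2l ?expR_ge0//; have [D0|D0] := leP 0 (Delta J x).
    by rewrite ger0_norm// lerDl expR_ge0.
  by rewrite ltr0_norm// mulrN -mulNr lerDr expR_ge0.
have mgf (t : R) (x : config N) : `|t| = th * N%:R ->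
    coupling_mean p (fun J => expR (t * Delta J x)) <= expR (th ^+ 2 * N%:R ^+ 2 / p ^+ 2).
  move=> tE; apply: (@le_trans _ _ (expR (t ^+ 2 / p ^+ 2))).
    apply: disorder_mgf => //.
    by rewrite tE mulrC -mulrA ler_wpM2l ?(ltW NR).
  by rewrite -[t ^+ 2](real_normK (num_real t)) tE exprMn.
have tN : 0 <= th * N%:R by rewrite mulr_ge0// ltW.
apply: (@le_trans _ _ (\sum_(x : config N) e0 * (2 * expR (th ^+ 2 * N%:R ^+ 2 / p ^+ 2)))).
  apply: (@le_trans _ _ (\sum_(x : config N) e0 *
     (coupling_mean p (fun J => expR (th * N%:R * Delta J x)) +
      coupling_mean p (fun J => expR (- (th * N%:R) * Delta J x))))).
    rewrite /coupling_mean /F; under eq_bigr do rewrite mulr_sumr.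
    rewrite exchange_big /=; apply: eq_ler.
    apply: eq_bigr => x _; rewrite -big_split mulr_sumr /=.
    by apply: eq_bigr => J _; ring.
  apply: ler_sum => x _; rewrite ler_wpM2l ?expR_ge0// mulr_natl mulr2n.
  by apply: lerD; apply: mgf; rewrite ?normrN ger0_norm.
rewrite sumr_const card_ffun card_bool card_ord -[leLHS]mulr_natl natrX.
apply: eq_ler.
rewrite (_ : - (th * eps - th ^+ 2 / p ^+ 2) * N%:R ^+ 2 =
  - (th * N%:R * (eps * N%:R)) + th ^+ 2 * N%:R ^+ 2 / p ^+ 2); last by ring.
by rewrite expRD -/e0; ring.
Qed.

End Tails.

Lemma disorder_sup_small (R : realType) (p h eps c : R) : 0 < p < 1 ->
  0 < eps -> 0 < c -> \forall N \near \oo,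
  PJ p [set J : coupling N | exists x, eps * N%:R < `|disorder p h J x|] <= c.
Proof.
move=> p01 eps0 c0; have /andP[p0 p1] := p01.
pose th := Num.min (p / 2) (eps * p ^+ 2 / 2).
have th0 : 0 < th by rewrite /th lt_min !divr_gt0 ?mulr_gt0 ?exprn_gt0.
have thp : th <= p / 2 by rewrite /th ge_min lexx.
pose q := th * eps / 2.
have q0 : 0 < q by rewrite divr_gt0 ?mulr_gt0.
have qE : q <= th * eps - th ^+ 2 / p ^+ 2.
  have : th ^+ 2 / p ^+ 2 <= th * eps / 2.
    rewrite ler_pdivrMr ?exprn_gt0// expr2 -!mulrA ler_wpM2l ?(ltW th0)//.
    by rewrite /th ge_min; apply/orP; right; apply: eq_ler; ring.
  by rewrite /q; lra.
near=> N.
have N0 : (0 < N)%N by near: N; exact: nbhs_infty_gt.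
have NR : 0 < N%:R :> R by rewrite ltr0n.
have Nq : 2 / q <= N%:R by near: N; exact: nbhs_infty_ger.
have Nc : 2 / c <= N%:R by near: N; exact: nbhs_infty_ger.
apply: le_trans (disorder_sup_tail h p01 N0 eps (ltW th0) thp) _.
apply: (@le_trans _ _ (2 * expR (- N%:R))).
  rewrite -mulrA ler_wpM2l//.
  have e2 : 2 ^+ N <= expR (N%:R) :> R.
    rewrite -[N%:R]mulr1 expRM_natl lerXn2r ?nnegrE ?expR_ge0//.
    by apply: le_trans (expR_ge1Dx 1); rewrite -[2]/(1 + 1).
  apply: le_trans (ler_wpM2r (expR_ge0 _) e2) _.
  rewrite -expRD ler_expR.
  have : q * N%:R ^+ 2 <= (th * eps - th ^+ 2 / p ^+ 2) * N%:R ^+ 2.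
    by rewrite ler_wpM2r ?sqr_ge0.
  have : 2 * N%:R <= q * N%:R ^+ 2.
    rewrite expr2 mulrA ler_wpM2r ?(ltW NR)//.
    by move: Nq; rewrite ler_pdivrMr// mulrC.
  by rewrite mulNr; lra.
have : expR (- N%:R) <= c / 2.
  rewrite expRN -[c / 2]invrK lef_pV2 ?posrE ?expR_gt0 ?invr_gt0 ?divr_gt0//.
  rewrite invf_div; apply: le_trans Nc _.
  by apply: le_trans (expR_ge1Dx _); rewrite lerDr.
by lra.
Unshelve. all: by end_near. Qed.

Lemma limn_einf_ge (R : realType) (u : nat -> \bar R) (l : \bar R) :
  (\forall n \near \oo, l <= u n)%E -> (l <= limn_einf u)%E.
Proof.
move=> [M _ lu]; rewrite limn_einf_lim; apply: lime_ge; first exact: is_cvg_einfs.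
exists M => // n /= Mn; apply: le_ereal_inf_tmp => _ [m /= nm <-].
by apply: lu => /=; exact: leq_trans nm.
Qed.

(** * The exit time estimate *)

Section Constants.
Context {R : realType}.
Variables (c1 c2 p beta h : R).
Hypotheses (p01 : 0 < p < 1) (beta1 : 1 < beta) (h0 : 0 < h).

Let e2 : 4 <= expR 2 :> R.
Proof.
rewrite (_ : 2 = 2%:R * 1 :> R); last by rewrite mulr1.
rewrite expRM_natl (_ : 4 = 2 ^+ 2 :> R); last by ring.
rewrite lerXn2r ?nnegrE ?expR_ge0//.
by apply: le_trans (expR_ge1Dx 1); rewrite -[2]/(1 + 1).
Qed.

Let bh : 2 <= 2 * beta * (1 + h).
Proof.
rewrite -mulrA -[leLHS]mulr1 ler_wpM2l// -[leLHS]mulr1 ler_pM//.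
  by have := beta1; lra.
by have := h0; lra.
Qed.

(** Both terms under the supremum are nonpositive, as [eta < 1]. *)
Lemma kappa_le_alpha : kappa c1 c2 p beta <= alpha p beta.
Proof.
have /andP[p0 p1] := p01.
rewrite /kappa -lerBrDl subrr; apply: ge_sup.
  by eexists; exists 2^-1 => //=; apply/andP; split; lra.
move=> _ [eta /= /andP[e0 e1] <-].
have l0 : ln eta <= 0 by apply: ln_le0; exact: ltW.
rewrite subr_le0; apply: le_trans l0 _.
have b0 : 0 <= beta by have := beta1; lra.
by rewrite divr_ge0// mulr_ge0 ?sqrtr_ge0// ltW.
Qed.

Lemma alpha_ge0 : 0 <= alpha p beta.
Proof.
have /andP[p0 p1] := p01.
by rewrite /alpha divr_ge0// mulr_ge0 ?sqr_ge0//; lra.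
Qed.

Lemma C1_le : C1 c1 c2 p beta h <= 4^-1.
Proof.
apply: (@le_trans _ _ (expR (- 2))).
  have := kappa_le_alpha; have := bh; rewrite /C1 ler_expR !mulNr => *; lra.
by rewrite expRN lef_pV2 ?posrE ?expR_gt0.
Qed.

Lemma C2_ge : 4 <= C2 p beta h.
Proof.
apply: le_trans e2 _; rewrite /C2 ler_expR.
by have := alpha_ge0; have := bh; lra.
Qed.

End Constants.

(** The powers available in [average_tail] are natural numbers; rounding the
    optimal one costs a factor in the exponent and excludes small [s]. *)
Lemma gaussian_exponent (R : realType) (v s : R) : 0 < v -> 4 * v <= s ->
  exists n : nat, - (n%:R * (s / 2)) + n%:R ^+ 2 * v <= - (s ^+ 2 / (32 * v)).
Proof.
move=> v0 vs; have s0 : 0 < s by lra.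
have q0 : 0 <= s / (4 * v) by rewrite divr_ge0 ?mulr_ge0 ?(ltW s0)// ltW.
have /andP[n1 n2] := truncn_itv q0.
set n := Num.truncn _ in n1 n2; exists n.
have n1' : n%:R * (4 * v) <= s by rewrite -ler_pdivlMr ?mulr_gt0.
have n2' : s / (8 * v) <= n%:R.
  have : 1 <= s / (4 * v) by rewrite ler_pdivlMr ?mulr_gt0// mul1r.
  have -> : s / (8 * v) = s / (4 * v) / 2 by field; rewrite gt_eqF.
  move: n2; rewrite -natr1 => n2 q1.
  have [n0|n0] := posnP n; first by move: n2; rewrite n0; lra.
  have : 1 <= n%:R :> R by rewrite ler1n.
  by lra.
apply: (@le_trans _ _ (- (n%:R * (s / 4)))).
  have : n%:R * (n%:R * (4 * v)) <= n%:R * s by rewrite ler_wpM2l.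
  by lra.
rewrite lerN2 (_ : s ^+ 2 / (32 * v) = s / (8 * v) * (s / 4)); last first.
  by field; rewrite gt_eqF.
by rewrite ler_wpM2r// divr_ge0// ltW.
Qed.

Section GoodEvent.
Context {R : realType}.
Variables (p beta h mm ms mp : R).
Hypotheses (p01 : 0 < p < 1) (beta1 : 1 < beta) (h0 : 0 < h).
Hypotheses (hb : h < field_bound beta) (dw : double_well beta h mm ms mp).
Variables (km kp : forall N : nat, 'I_N.+1).
Hypotheses (ckm : forall N, closest mm (km N)) (ckp : forall N, closest mp (kp N)).

Let v := beta ^+ 2 / p ^+ 2.

Lemma ratio_probability (s : R) : 0 < s ->
  \forall N \near \oo,
  1 - (5 + expR (v / 2)) * expR (- (32 * v)^-1 * s ^+ 2) <=
  PJ p [set J : coupling N | exists2 r : R,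
    (mean_exit p beta h J (km N) (kp N) / cw_mean_exit beta h (km N) (kp N))%E = r%:E &
    3 / 10 * expR (- s) <= r <= 10 / 3 * expR s].
Proof.
move=> s0; have /andP[p0 p1] := p01.
have b0 : 0 < beta by exact: lt_trans beta1.
have v0 : 0 < v by rewrite divr_gt0 ?exprn_gt0.
pose k := expR (- (32 * v)^-1 * s ^+ 2).
have k0 : 0 < k by exact: expR_gt0.
have PJ0 N (A : set (coupling N)) : 0 <= PJ p A.
  rewrite PJE; apply: sumr_ge0 => J _.
  by rewrite mulr_ge0 ?coupling_mass_ge0.
(* For small [s] the claim is void, by the term [e^{v / 2}] in [k1]. *)
have [vs|sv] := leP (4 * v) s; last first.
  apply: nearW => N; apply: le_trans (PJ0 N _).
  rewrite -/k subr_le0.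
  suff : 1 <= expR (v / 2) * k by have := k0; lra.
  rewrite /k -expRD -[leLHS]expR0 ler_expR mulNr subr_ge0.
  rewrite mulrC ler_pdivrMr; last by rewrite pmulr_rgt0.
  have v40 : 0 <= 4 * v by rewrite pmulr_rge0// ltW.
  have : s ^+ 2 <= (4 * v) ^+ 2 by rewrite lerXn2r ?nnegrE ?(ltW s0) ?(ltW sv).
  by rewrite exprMn; lra.
have [n nE] := gaussian_exponent v0 vs.
have g0 := well_gap_gt0 beta1 h0 hb dw.
set eps := well_gap beta h mm ms mp / 9.
have eps0 : 0 < eps by rewrite divr_gt0.
have near1 := defect_small beta1 h0 hb dw ckm ckp.
have near2 := disorder_sup_small h p01 eps0 k0.
have near3 := nbhs_infty_ger (2 * n%:R * beta / p).
move: near1 near2 near3; apply: filterS3 => N [ks [N0 aks ksb defect]] supk Nn.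
pose SUP := [set J : coupling N | exists x, eps * N%:R < `|disorder p h J x|].
have bN : (kp N <= N)%N by rewrite -ltnS.
pose T (w : config N -> R) (t : R) := [set J : coupling N |
  expR (s / 2) < \sum_x w x * expR (t * disorder p h J x)].
have tail w t : (forall x, 0 <= w x) -> \sum_x w x = 1 -> `|t| = beta -> PJ p (T w t) <= k.
  move=> w0 w1 tb; apply: le_trans (@average_tail R p h N p01 N0 w t (s / 2) n w0 w1 _) _.
    rewrite tb ler_pdivlMr//; move: Nn; rewrite ler_pdivrMr//; lra.
  rewrite ler_expR -[t ^+ 2](real_normK (num_real t)) tb -mulrA -/v.
  by apply: le_trans nE _; rewrite mulNr mulrC.
have tbp : `|beta| = beta by rewrite ger0_norm// ltW.
have tbn : `|- beta| = beta by rewrite normrN.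
have core0 := core_measure_ge0 beta h ks (N := N).
have core1 := core_measure_sum1 beta h N ks.
have flow0 : forall x : config N, 0 <= flow_measure beta h (km N) (kp N) x.
  by move=> x; apply: flow_measure_ge0 => //; exact: leq_ltn_trans ksb.
have flow1 : \sum_(x : config N) flow_measure beta h (km N) (kp N) x = 1.
  by apply: flow_measure_sum1 => //; exact: leq_ltn_trans ksb.
pose core (x : config N) := core_measure beta h ks x.
pose flow (x : config N) := flow_measure beta h (km N) (kp N) x.
(* Five exceptional events, each of probability at most [k]. *)
rewrite PJ_setC -/k lerD2l lerN2.
apply: (@le_trans _ _ (PJ p (SUP `|` (T core beta `|` (T core (- beta) `|`
  (T flow beta `|` T flow (- beta))))))).
  apply: PJ_subset => // J /= nr; apply: contrapT => /not_orP[nS /not_orP[n1]].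
  move=> /not_orP[n2 /not_orP[n3 n4]]; apply: nr.
  have := @ratio_bounds R p beta h N N0 (ltW b0) (km N) (kp N) ks aks ksb eps
    (ltW eps0) defect J (expR (s / 2)).
  case.
  - move=> x; rewrite leNgt; apply/negP => lt; apply: nS; by exists x.
  - exact: expR_gt0.
  - by rewrite leNgt; apply/negP => ?; apply: n1.
  - by rewrite leNgt; apply/negP => ?; apply: n2.
  - by rewrite leNgt; apply/negP => ?; apply: n3.
  - by rewrite leNgt; apply/negP => ?; apply: n4.
  move=> r rE; rewrite -expRM_natl (_ : 2%:R * (s / 2) = s); last by field.
  by rewrite -expRN => rb; exists r.
have U (A B : set (coupling N)) : PJ p (A `|` B) <= PJ p A + PJ p B by exact: PJ_setU.
have := U SUP (T core beta `|` (T core (- beta) `|` (T flow beta `|` T flow (- beta)))).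
have := U (T core beta) (T core (- beta) `|` (T flow beta `|` T flow (- beta))).
have := U (T core (- beta)) (T flow beta `|` T flow (- beta)).
have := U (T flow beta) (T flow (- beta)).
have := tail core beta core0 core1 tbp.
have := tail core (- beta) core0 core1 tbn.
have := tail flow beta flow0 flow1 tbp.
have := tail flow (- beta) flow0 flow1 tbn.
have : 0 <= expR (v / 2) * k by rewrite mulr_ge0 ?expR_ge0.
move: supk; rewrite -/SUP.
move: (PJ p (T core beta)) (PJ p (T core (- beta))) (PJ p (T flow beta)) (PJ p (T flow (- beta))).
by move=> *; lra.
Qed.

End GoodEvent.

Theorem theorem1p3 (R : realType) (c1 c2 : R)
    (hc1 : 0 < c1) (hc2 : 0 < c2) (hT : talagrand_constants c1 c2)
    (p : R) (hp : 0 < p < 1) (beta : R) (hbeta : 1 < beta) :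
  exists k1 k2 : R, [/\ 0 < k1, 0 < k2 &
  exists2 h0 : R, 0 < h0 &
  forall (h : R), 0 < h < h0 ->
  C1 c1 c2 p beta h < C2 p beta h /\
  forall (mm ms mp : R), double_well beta h mm ms mp ->
  forall (km kp : forall N : nat, 'I_N.+1),
    (forall N, closest mm (km N)) -> (forall N, closest mp (kp N)) ->
  forall s : R, 0 < s ->
  exists a b : nat -> R,
    [/\ a @ \oo --> 0, b @ \oo --> 0 &
    ((1 - k1 * expR (- k2 * s ^+ 2))%:E <=
      limn_einf (fun N => (PJ p [set J : coupling N |
        ((C1 c1 c2 p beta h * expR (- s) * (1 + a N))%:E
           <= mean_exit p beta h J (km N) (kp N)
                / cw_mean_exit beta h (km N) (kp N)
           <= (C2 p beta h * expR s * (1 + b N))%:E)%E])%:E))%E]].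
Proof.
have /andP[p0 p1] := hp; have b0 : 0 < beta by exact: lt_trans hbeta.
have v0 : 0 < beta ^+ 2 / p ^+ 2 by rewrite divr_gt0 ?exprn_gt0.
exists (5 + expR (beta ^+ 2 / p ^+ 2 / 2)), (32 * (beta ^+ 2 / p ^+ 2))^-1; split.
- by rewrite addr_gt0 ?expR_gt0.
- by rewrite invr_gt0 mulr_gt0.
exists (field_bound beta); first exact: field_bound_gt0.
move=> h /andP[h0 hb].
have lo : C1 c1 c2 p beta h <= 4^-1 by exact: C1_le.
have up : 4 <= C2 p beta h by exact: C2_ge.
split; first by lra.
move=> mm ms mp dw km kp ckm ckp s s0.
exists (fun=> 0), (fun=> 0); split; [exact: cvg_cst|exact: cvg_cst|].
apply: limn_einf_ge.
have := ratio_probability hp hbeta h0 hb dw ckm ckp s0.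
apply: filterS => N; rewrite lee_fin => /le_trans; apply.
apply: PJ_subset => // J /= [r -> /andP[r1 r2]].
rewrite !addr0 !mulr1 !lee_fin; apply/andP; split.
  by apply: le_trans r1; rewrite ler_wpM2r ?expR_ge0//; lra.
by apply: le_trans r2 _; rewrite ler_wpM2r ?expR_ge0//; lra.
Qed.
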